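(* Let $\mathfrak{g}$ be an AE-Lie algebra over $\mathbb{K}\in\{\mathbb{R},\mathbb{C}\}$ and $R\ge1$. Then for all $x,y\in\widehat{\mathrm{S}}{}_R^\bullet(\mathfrak{g})$ the map $$\mathbb{K}\ni z\longmapsto x\star_zy\in\widehat{\mathrm{S}}{}_R^\bullet(\mathfrak{g})$$ is analytic with (absolutely convergent) Taylor expansion at $z=0$ given by $x\star_zy=\sum_{n=0}^\infty z^nC_n(x,y)$. The collection of algebras $\bigl\{\bigl(\widehat{\mathrm{S}}{}_R^\bullet(\mathfrak{g}),\star_z\bigr)\bigr\}_{z\in\mathbb{K}}$ is an entire deformation of the completed symmetric tensor algebra $\widehat{\mathrm{S}}{}_R^\bullet(\mathfrak{g})$, i.e. $\star_0$ is the symmetric tensor product and the Taylor series $\sum_{n=0}^\infty z^nC_n(x,y)$ converges absolutely for all $z\in\mathbb{K}$ and all $x,y\in\widehat{\mathrm{S}}{}_R^\bullet(\mathfrak{g})$.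
   Context: Let $\mathbb{K}$ be $\mathbb{R}$ or $\mathbb{C}$. AE-Lie algebra: a Hausdorff locally convex Lie algebra $\mathfrak{g}$ over $\mathbb{K}$ (Lie bracket jointly continuous) such that every continuous seminorm $p$ has an asymptotic estimate, i.e. a continuous seminorm $q$ with $p(w_n(x_1,\dots,x_n))\le q(x_1)\cdots q(x_n)$ for all $n\ge1$, all $x_1,\dots,x_n\in\mathfrak{g}$ and all words $w_n$ made out of $n-1$ Lie brackets of $x_1,\dots,x_n$ with arbitrary placement of brackets. Topology: for a continuous seminorm $p$ on $\mathfrak{g}$ let $p^n=p^{\otimes n}$ be its projective tensor power on $\mathfrak{g}^{\otimes n}$ ($p^0=|\cdot|$ on $\mathbb{K}$). $\mathrm{S}^n(\mathfrak{g})\subseteq\mathfrak{g}^{\otimes n}$ is the space of symmetric tensors, $\mathrm{S}^\bullet(\mathfrak{g})=\bigoplus_n\mathrm{S}^n(\mathfrak{g})$ with the commutative product given by symmetrizing the tensor product, $p_R(x)=\sum_nn!^Rp^n(x_n)$ for $x=\sum_nx_n$, and $\widehat{\mathrm{S}}{}_R^\bullet(\mathfrak{g})$ is the completion of $\mathrm{S}^\bullet(\mathfrak{g})$ with respect to all the seminorms $p_R$, $p$ continuous on $\mathfrak{g}$. Gutt star product: let $\mathfrak{q}\colon\mathrm{S}^\bullet(\mathfrak{g})\to\mathcal{U}(\mathfrak{g})$, $\xi_1\cdots\xi_n\mapsto\frac1{n!}\sum_{\sigma\in S_n}\xi_{\sigma(1)}\odot\cdots\odot\xi_{\sigma(n)}$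 be the Poincaré-Birkhoff-Witt symmetrization isomorphism, where $\odot$ is the product of $\mathcal{U}(\mathfrak{g})$. For $x\in\mathrm{S}^k(\mathfrak{g})$, $y\in\mathrm{S}^\ell(\mathfrak{g})$ with $k+\ell\ge1$ set $x\star_zy=\sum_{n=0}^{k+\ell-1}z^nC_n(x,y)$ with $C_n(x,y)=\pi_{k+\ell-n}\bigl(\mathfrak{q}^{-1}(\mathfrak{q}(x)\odot\mathfrak{q}(y))\bigr)$, $\pi_r$ being the projection onto $\mathrm{S}^r(\mathfrak{g})$; $1\star_z1=1$; extend bilinearly. For $R\ge1$ both $\star_z$ and the bilinear maps $C_n$ are continuous on $\mathrm{S}^\bullet(\mathfrak{g})$ with respect to the seminorms $p_R$; the same symbols denote their continuous extensions to $\widehat{\mathrm{S}}{}_R^\bullet(\mathfrak{g})$. *)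

(* Defs.v *)
From HB Require Import structures.
From mathcomp Require Import all_boot all_order all_algebra all_fingroup.
From mathcomp Require Import generic_quotient.
From mathcomp Require Import all_classical all_reals all_analysis.
From mathcomp Require Import complex.

Set Implicit Arguments.
Unset Strict Implicit.
Unset Printing Implicit Defensive.

Import Order.TTheory GRing.Theory Num.Theory.
Import numFieldNormedType.Exports.

Local Open Scope classical_set_scope.
Local Open Scope ring_scope.
Local Open Scope quotient_scope.

(* K-algebras given by generators X and relations r: the free algebra K<X>,
   written with formal linear combinations of words, modulo the two-sided ideal
   generated by the differences a - b with [r a b]. *)
Section Presentation.
Variables (K : fieldType) (X : Type).

Inductive fsum : Type :=
| FWord of seq X
| FZero
| FAdd of fsum & fsum
| FScale of K & fsum.

HB.instance Definition _ := gen_eqMixin fsum.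
HB.instance Definition _ := gen_choiceMixin fsum.

(* the product s . a . t *)
Fixpoint fwrap (s t : seq X) (a : fsum) : fsum :=
  match a with
  | FWord w => FWord (s ++ w ++ t)
  | FZero => FZero
  | FAdd a b => FAdd (fwrap s t a) (fwrap s t b)
  | FScale c a => FScale c (fwrap s t a)
  end.

Fixpoint feval (V : lmodType K) (f : seq X -> V) (a : fsum) : V :=
  match a with
  | FWord w => f w
  | FZero => 0
  | FAdd a b => feval f a + feval f b
  | FScale c a => c *: feval f a
  end.

Variable r : fsum -> fsum -> Prop.

Inductive fcongr : fsum -> fsum -> Prop :=
| fcongr_rel s t a b : r a b -> fcongr (fwrap s t a) (fwrap s t b)
| fcongr_refl a : fcongr a a
| fcongr_sym a b : fcongr a b -> fcongr b a
| fcongr_trans a b c : fcongr a b -> fcongr b c -> fcongr a c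
| fcongr_add a a' b b' :
    fcongr a a' -> fcongr b b' -> fcongr (FAdd a b) (FAdd a' b')
| fcongr_scale c a a' : fcongr a a' -> fcongr (FScale c a) (FScale c a')
| fcongr_addA a b c : fcongr (FAdd a (FAdd b c)) (FAdd (FAdd a b) c)
| fcongr_addC a b : fcongr (FAdd a b) (FAdd b a)
| fcongr_add0 a : fcongr (FAdd FZero a) a
| fcongr_addN a : fcongr (FAdd (FScale (- 1) a) a) FZero
| fcongr_scaleA c d a : fcongr (FScale c (FScale d a)) (FScale (c * d) a)
| fcongr_scale1 a : fcongr (FScale 1 a) a
| fcongr_scaleDr c a b :
    fcongr (FScale c (FAdd a b)) (FAdd (FScale c a) (FScale c b))
| fcongr_scaleDl c d a :
    fcongr (FScale (c + d) a) (FAdd (FScale c a) (FScale d a)).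

Definition fequiv : rel fsum := fun a b => `[< fcongr a b >].

Lemma fequiv_refl : reflexive fequiv.
Proof. by move=> a; apply/asboolP; exact: fcongr_refl. Qed.

Lemma fequiv_sym : symmetric fequiv.
Proof. by move=> a b; apply/asboolP/asboolP => ?; exact: fcongr_sym. Qed.

Lemma fequiv_trans : transitive fequiv.
Proof.
move=> b a c /asboolP ab /asboolP bc; apply/asboolP; exact: fcongr_trans bc.
Qed.

Canonical fequiv_equiv :=
  EquivRel fequiv fequiv_refl fequiv_sym fequiv_trans.

Definition presalg : Type := {eq_quot fequiv}.
HB.instance Definition _ := Choice.on presalg.
HB.instance Definition _ := EqQuotient.on presalg.

Local Notation cls := (\pi_presalg).

Lemma clsP a b : fcongr a b -> cls a = cls b.
Proof. by move=> ab; apply/eqmodP/asboolP. Qed.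

Lemma clsK a b : cls a = cls b -> fcongr a b.
Proof. by move=> /eqmodP /asboolP. Qed.

Lemma repr_congr a : fcongr (repr (cls a)) a.
Proof. by apply: clsK; rewrite reprK. Qed.

Definition pres_add (u v : presalg) : presalg := cls (FAdd (repr u) (repr v)).
Definition pres_scale (c : K) (u : presalg) : presalg := cls (FScale c (repr u)).

Lemma cls_add a b : pres_add (cls a) (cls b) = cls (FAdd a b).
Proof. by apply: clsP; apply: fcongr_add; exact: repr_congr. Qed.

Lemma cls_scale c a : pres_scale c (cls a) = cls (FScale c a).
Proof. by apply: clsP; apply: fcongr_scale; exact: repr_congr. Qed.

Lemma pres_addA : associative pres_add.
Proof.
elim/quotW => a; elim/quotW => b; elim/quotW => c.
rewrite (cls_add b c) (cls_add a b) !cls_add.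
by apply: clsP; exact: fcongr_addA.
Qed.

Lemma pres_addC : commutative pres_add.
Proof.
elim/quotW => a; elim/quotW => b.
by rewrite !cls_add; apply: clsP; exact: fcongr_addC.
Qed.

Lemma pres_add0 : left_id (cls FZero) pres_add.
Proof.
by elim/quotW => a; rewrite !cls_add; apply: clsP; exact: fcongr_add0.
Qed.

Lemma pres_addN : left_inverse (cls FZero) (pres_scale (- 1)) pres_add.
Proof.
by elim/quotW => a; rewrite (cls_scale (- 1) a) cls_add; apply: clsP; exact: fcongr_addN.
Qed.

HB.instance Definition _ :=
  GRing.isZmodule.Build presalg pres_addA pres_addC pres_add0 pres_addN.

Lemma pres_scaleA c d u : pres_scale c (pres_scale d u) = pres_scale (c * d) u.
Proof.
elim/quotW: u => a; rewrite (cls_scale d a) !cls_scale.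
by apply: clsP; exact: fcongr_scaleA.
Qed.

Lemma pres_scale1 : left_id 1 pres_scale.
Proof.
by elim/quotW => a; rewrite !cls_scale; apply: clsP; exact: fcongr_scale1.
Qed.

Lemma pres_scaleDr : right_distributive pres_scale +%R.
Proof.
move=> c; elim/quotW => a; elim/quotW => b.
rewrite /GRing.add /= (cls_add a b) (cls_scale c a) (cls_scale c b).
rewrite cls_scale cls_add.
by apply: clsP; exact: fcongr_scaleDr.
Qed.

Lemma pres_scaleDl u : {morph pres_scale^~ u : c d / c + d}.
Proof.
move=> c d; elim/quotW: u => a; rewrite [RHS]/GRing.add /=.
rewrite (cls_scale c a) (cls_scale d a) cls_scale cls_add.
by apply: clsP; exact: fcongr_scaleDl.
Qed.

HB.instance Definition _ := GRing.Zmodule_isLmodule.Build K presalg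
  pres_scaleA pres_scale1 pres_scaleDr pres_scaleDl.

Definition word (w : seq X) : presalg := cls (FWord w).

Lemma feval_word a : feval word a = cls a.
Proof.
elim: a => [w||a IHa b IHb|c a IHa] //=.
  by rewrite IHa IHb; exact: cls_add.
by rewrite IHa; exact: cls_scale.
Qed.

Lemma feval_wrap (V : lmodType K) (f : seq X -> V) s t a :
  feval f (fwrap s t a) = feval (fun w => f (s ++ w ++ t)) a.
Proof.
by elim: a => [w||a IHa b IHb|c a IHa] //=; rewrite ?IHa ?IHb.
Qed.

Lemma feval_linear (V W : lmodType K) (h : {linear V -> W}) f a :
  h (feval f a) = feval (h \o f) a.
Proof.
elim: a => [w||a IHa b IHb|c a IHa] //=; first by rewrite linear0.
  by rewrite linearD IHa IHb.
by rewrite linearZ IHa.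
Qed.

Lemma eq_feval (V : lmodType K) (f h : seq X -> V) a :
  f =1 h -> feval f a = feval h a.
Proof.
by move=> fh; elim: a => [w||a IHa b IHb|c a IHa] //=; rewrite ?IHa ?IHb.
Qed.

Definition respects (V : lmodType K) (f : seq X -> V) : Prop :=
  forall s t a b, r a b -> feval f (fwrap s t a) = feval f (fwrap s t b).

(* the linear extension to the quotient of a function on words satisfying
   [respects], see [lift_word] and [lift_is_linear] *)
Definition lift (V : lmodType K) (f : seq X -> V) (u : presalg) : V :=
  feval f (repr u).

Lemma feval_congr (V : lmodType K) (f : seq X -> V) :
  respects f -> forall a b, fcongr a b -> feval f a = feval f b.
Proof.
move=> fr a b; elim=> //=.
- by move=> ? ? ? _ -> _ ->.
- by move=> ? ? ? ? _ -> _ ->.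
- by move=> ? ? ? _ ->.
- by move=> *; exact: addrA.
- by move=> *; exact: addrC.
- by move=> *; exact: add0r.
- by move=> ?; rewrite scaleN1r addNr.
- by move=> *; exact: scalerA.
- by move=> *; exact: scale1r.
- by move=> *; exact: scalerDr.
- by move=> *; exact: scalerDl.
Qed.

Lemma lift_cls (V : lmodType K) (f : seq X -> V) :
  respects f -> forall a, lift f (cls a) = feval f a.
Proof. by move=> fr a; apply: feval_congr fr _ _ _; exact: repr_congr. Qed.

Lemma lift_word (V : lmodType K) (f : seq X -> V) :
  respects f -> forall w, lift f (word w) = f w.
Proof. by move=> fr w; rewrite lift_cls. Qed.

Lemma lift_is_linear (V : lmodType K) (f : seq X -> V) :
  respects f -> linear (lift f).
Proof.
move=> fr c; elim/quotW => a; elim/quotW => b.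
rewrite [X in X + _](_ : _ = cls (FScale c a)); last exact: cls_scale.
by rewrite [X in lift f X]cls_add !lift_cls.
Qed.

Lemma word_respects : respects word.
Proof.
by move=> s t a b rab; rewrite !feval_word; apply: clsP; exact: fcongr_rel.
Qed.

Lemma word_ind (P : presalg -> Prop) :
  (forall w, P (word w)) -> P 0 -> (forall u v, P u -> P v -> P (u + v)) ->
  (forall c u, P u -> P (c *: u)) -> forall u, P u.
Proof.
move=> Pw P0 PD PZ; elim/quotW; elim => [w||a Pa b Pb|c a Pa].
- exact: Pw.
- exact: P0.
- by rewrite -cls_add; exact: PD.
- by rewrite -cls_scale; exact: PZ.
Qed.

Definition pres_mul (u v : presalg) : presalg :=
  lift (fun s => lift (fun t => word (s ++ t)) v) u.

Lemma cat_respects s t : respects (fun w => word (s ++ w ++ t)).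
Proof.
move=> s' t' a b rab; rewrite !feval_wrap.
have E w : word (s ++ (s' ++ w ++ t') ++ t) =
           word ((s ++ s') ++ w ++ (t' ++ t)) by rewrite !catA.
rewrite !(eq_feval _ E) -!feval_wrap; exact: word_respects.
Qed.

Lemma catl_respects s : respects (fun w => word (s ++ w)).
Proof.
move=> s' t' a b /(cat_respects s [::] s' t'); rewrite !feval_wrap.
have E w : word (s ++ (s' ++ w ++ t') ++ [::]) = word (s ++ s' ++ w ++ t').
  by rewrite cats0.
by rewrite !(eq_feval _ E).
Qed.

Definition pres_mull s : presalg -> presalg := lift (fun t => word (s ++ t)).
Lemma pres_mull_is_linear s : linear (pres_mull s).
Proof. exact/lift_is_linear/catl_respects. Qed.
HB.instance Definition _ s := GRing.isLinear.Build K presalg presalg _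
  (pres_mull s) (pres_mull_is_linear s).

Lemma pres_mull_word s t : pres_mull s (word t) = word (s ++ t).
Proof. exact/lift_word/catl_respects. Qed.

Lemma feval_lin (V : lmodType K) (f h : seq X -> V) c a :
  feval (fun w => c *: f w + h w) a = c *: feval f a + feval h a.
Proof.
elim: a => [w||a IHa b IHb|d a IHa] //=; first by rewrite scaler0 addr0.
  by rewrite IHa IHb scalerDr addrACA.
by rewrite IHa scalerDr !scalerA mulrC.
Qed.

Lemma mul_respects v : respects (fun s => pres_mull s v).
Proof.
move=> s t a b rab; elim/word_ind: v => [w||u v Pu Pv|c u Pu].
- have E x : pres_mull x (word w) = word ([::] ++ x ++ w).
    exact: pres_mull_word.
  by rewrite !(eq_feval _ E); exact: cat_respects.
- have E x : pres_mull x 0 = 0 :> presalg by rewrite linear0.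
  rewrite !(eq_feval _ E); move: (fwrap _ _ a) (fwrap _ _ b) => a' b'.
  have Z c : feval (fun=> 0 : presalg) c = 0.
    elim: c => [w||c IHc d IHd|e c IHc] //=; rewrite ?IHc ?IHd ?addr0 //.
    by rewrite scaler0.
  by rewrite !Z.
- have E x : pres_mull x (u + v) = 1 *: pres_mull x u + pres_mull x v.
    by rewrite linearD scale1r.
  by rewrite !(eq_feval _ E) !feval_lin Pu Pv.
- have E x : pres_mull x (c *: u) = c *: pres_mull x u + pres_mull x 0.
    by rewrite linearZ linear0 addr0.
  rewrite !(eq_feval _ E) !feval_lin Pu; congr (_ + _).
  have F x : pres_mull x 0 = 0 *: pres_mull x u + 0 *: pres_mull x u.
    by rewrite linear0 !scale0r addr0.
  have Z y : feval (fun x => pres_mull x 0) y = 0.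
    elim: y => [w||y IHy d IHd|e y IHy] //=; rewrite ?linear0 //.
      by rewrite IHy IHd addr0.
    by rewrite IHy scaler0.
  by rewrite !Z.
Qed.

Lemma pres_mulDl : left_distributive pres_mul +%R.
Proof.
move=> u v w; have := lift_is_linear (mul_respects w) 1 u v.
by rewrite !scale1r.
Qed.

Lemma pres_scaleAl c u v : c *: pres_mul u v = pres_mul (c *: u) v.
Proof.
have L := lift_is_linear (mul_respects v).
have L0 : pres_mul 0 v = 0.
  by have := L (-1) 0 0; rewrite scaler0 addr0 scaleN1r addNr.
by have := L c u 0; rewrite addr0 -/(pres_mul _ _) => ->; rewrite [lift _ 0]L0 addr0.
Qed.

Lemma pres_mul_word s t : pres_mul (word s) (word t) = word (s ++ t).
Proof.
by rewrite /pres_mul (lift_word (mul_respects _)); exact: pres_mull_word.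
Qed.

Lemma pres_mul_lin w c u v :
  pres_mul w (c *: u + v) = c *: pres_mul w u + pres_mul w v.
Proof.
elim/word_ind: w => [w||a b Pa Pb|d a Pa].
- by rewrite /pres_mul !(lift_word (mul_respects _)) linearP.
- have Z x : pres_mul 0 x = 0.
    by have := pres_scaleAl 0 0 x; rewrite scale0r scaler0 => <-.
  by rewrite !Z scaler0 addr0.
- by rewrite !pres_mulDl Pa Pb scalerDr addrACA.
- by rewrite -!pres_scaleAl Pa scalerDr !scalerA mulrC.
Qed.

Lemma pres_mulDr : right_distributive pres_mul +%R.
Proof. by move=> w u v; have := pres_mul_lin w 1 u v; rewrite !scale1r. Qed.

Lemma pres_mulr0 w : pres_mul w 0 = 0.
Proof.
by have := pres_mul_lin w (-1) 0 0; rewrite scaler0 addr0 scaleN1r addNr.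
Qed.

Lemma pres_scaleAr c u v : c *: pres_mul u v = pres_mul u (c *: v).
Proof. by have := pres_mul_lin u c v 0; rewrite pres_mulr0 !addr0. Qed.

Lemma pres_mul0r w : pres_mul 0 w = 0.
Proof. by have := pres_scaleAl 0 0 w; rewrite scale0r scaler0 => <-. Qed.

Lemma pres_mulA : associative pres_mul.
Proof.
move=> u v w; elim/word_ind: u => [s||a b Pa Pb|d a Pa].
- elim/word_ind: v => [t||a b Pa Pb|d a Pa].
  + elim/word_ind: w => [x||a b Pa Pb|d a Pa].
    * by rewrite !pres_mul_word catA.
    * by rewrite !pres_mulr0.
    * by rewrite !pres_mulDr Pa Pb.
    * by rewrite -!pres_scaleAr Pa.
  + by rewrite !(pres_mul0r, pres_mulr0).
  + by rewrite !(pres_mulDl, pres_mulDr) Pa Pb.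
  + by rewrite -!(pres_scaleAl, pres_scaleAr) Pa.
- by rewrite !pres_mul0r.
- by rewrite !pres_mulDl Pa Pb.
- by rewrite -!pres_scaleAl Pa.
Qed.

Lemma pres_mul1r : left_id (word [::]) pres_mul.
Proof.
elim/word_ind => [s||a b Pa Pb|d a Pa].
- by rewrite pres_mul_word.
- exact: pres_mulr0.
- by rewrite pres_mulDr Pa Pb.
- by rewrite -pres_scaleAr Pa.
Qed.

Lemma pres_mulr1 : right_id (word [::]) pres_mul.
Proof.
elim/word_ind => [s||a b Pa Pb|d a Pa].
- by rewrite pres_mul_word cats0.
- exact: pres_mul0r.
- by rewrite pres_mulDl Pa Pb.
- by rewrite -pres_scaleAl Pa.
Qed.

HB.instance Definition _ := GRing.Zmodule_isPzRing.Build presalg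
  pres_mulA pres_mul1r pres_mulr1 pres_mulDl pres_mulDr.

End Presentation.

Section SymmetricTensors.
Variables (K : fieldType) (g : lmodType K).

Inductive tensor_rel : fsum K g -> fsum K g -> Prop :=
| tensor_relD x y :
    tensor_rel (FWord K [:: x + y]) (FAdd (FWord K [:: x]) (FWord K [:: y]))
| tensor_relZ c x :
    tensor_rel (FWord K [:: c *: x]) (FScale c (FWord K [:: x])).

(* The tensor algebra, as the direct sum over n of the tensor powers of g:
   [tensor_word [:: x1; ...; xn]] is the decomposable tensor x1 (x) ... (x) xn,
   the product is (x), and the n-th tensor power of g is the image of the
   projection [tensor_proj n]. *)
Definition tensor : Type := presalg tensor_rel.
HB.instance Definition _ := GRing.Lmodule.on tensor.
HB.instance Definition _ := GRing.PzRing.on tensor.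

Definition tensor_word (w : seq g) : tensor := word tensor_rel w.

Definition multilinear (V : lmodType K) (f : seq g -> V) : Prop :=
  forall s t c x y,
    f (s ++ (c *: x + y) :: t) = c *: f (s ++ x :: t) + f (s ++ y :: t).

Lemma multilinearD (V : lmodType K) (f : seq g -> V) s t x y :
  multilinear f -> f (s ++ (x + y) :: t) = f (s ++ x :: t) + f (s ++ y :: t).
Proof. by move=> fl; have := fl s t 1 x y; rewrite !scale1r. Qed.

Lemma multilinearZ (V : lmodType K) (f : seq g -> V) s t c x :
  multilinear f -> f (s ++ (c *: x) :: t) = c *: f (s ++ x :: t).
Proof.
move=> fl; have f0 : f (s ++ 0 :: t) = 0.
  by have := fl s t (- 1) 0 0; rewrite scaler0 addr0 scaleN1r addNr.
by have := fl s t c x 0; rewrite !addr0 f0 addr0.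
Qed.

Lemma multilinear_respects (V : lmodType K) (f : seq g -> V) :
  multilinear f -> respects tensor_rel f.
Proof.
move=> fl s t a b [x y|c x] /=.
  exact: multilinearD.
exact: multilinearZ.
Qed.

Lemma tensor_word_multilinear : multilinear tensor_word.
Proof.
move=> s t c x y.
have fr := @word_respects K g tensor_rel.
rewrite /tensor_word.
have /= -> := fr s t _ _ (tensor_relD (c *: x) y).
by have /= -> := fr s t _ _ (tensor_relZ c x).
Qed.

Lemma multilinear_graded (V : lmodType K) (f : seq g -> V) n :
  multilinear f -> multilinear (fun w => if size w == n then f w else 0).
Proof.
move=> fl s t c x y; rewrite !size_cat /=.
by case: ifP => _; [exact: fl|rewrite scaler0 addr0].
Qed.

Definition tensor_proj (n : nat) : tensor -> tensor :=
  lift (fun w => if size w == n then tensor_word w else 0).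

(* x_1 ... x_n |-> x_(sigma 1) ... x_(sigma n) *)
Definition permw n (sigma : 'S_n) (w : seq g) : seq g :=
  [seq nth 0 w (sigma i) | i : 'I_n].

Lemma size_permw n (sigma : 'S_n) w : size (permw sigma w) = n.
Proof. by rewrite size_map size_enum_ord. Qed.

Lemma nth_permw n (sigma : 'S_n) w (i : 'I_n) :
  nth 0 (permw sigma w) i = nth 0 w (sigma i).
Proof.
by rewrite (nth_map i) ?size_enum_ord // nth_ord_enum.
Qed.

Lemma permw_comp n (sigma tau : 'S_n) w :
  permw sigma (permw tau w) = permw (sigma * tau)%g w.
Proof.
apply: (@eq_from_nth _ 0); rewrite !size_permw // => i ltin.
have E rho u : nth 0 (permw rho u) i = nth 0 u (rho (Ordinal ltin)).
  exact: nth_permw rho u (Ordinal ltin).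
by rewrite !E nth_permw permM.
Qed.

Lemma permw_slot n (sigma : 'S_n) s t : n = (size s + (size t).+1)%N ->
  exists s' t', forall x, permw sigma (s ++ x :: t) = s' ++ x :: t'.
Proof.
move=> En; have lt_s : (size s < n)%N by rewrite En addnS ltnS leq_addr.
set k := Ordinal lt_s; set j := (sigma^-1)%g k.
have : j \in enum 'I_n by rewrite mem_enum.
move=> /path.splitPr; move Ee : (enum 'I_n) => e E.
have := enum_uniq 'I_n; rewrite Ee; case: E Ee => e1 e2 Ee ue.
have ne i : i \in e1 ++ e2 -> (sigma i : nat) != size s.
  move=> ie; apply/negP => /eqP Ei.
  have Ek : sigma i = k by exact/val_inj.
  have Eij : i = j by rewrite /j -Ek permK.
  move: ue ie; rewrite Eij -cat_rcons cat_uniq rcons_uniq mem_cat.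
  case/and3P => /andP[je1 _] /hasPn je2 _; rewrite (negbTE je1) /= => /je2.
  by rewrite /= mem_rcons inE eqxx.
pose F x (i : 'I_n) := nth 0 (s ++ x :: t) (sigma i).
have FE x i : i \in e1 ++ e2 -> F x i = F 0 i.
  move=> /ne nei; rewrite /F !nth_cat.
  case: ltngtP nei => // lt _.
  have : (0 < sigma i - size s)%N by rewrite subn_gt0.
  by case: (sigma i - size s)%N.
exists (map (F 0) e1), (map (F 0) e2) => x.
rewrite /permw /image_mem.
rewrite Ee map_cat /=; congr (_ ++ _ :: _).
- by apply/eq_in_map => i ie; apply: FE; rewrite mem_cat ie.
- by rewrite /j permKV nth_cat /= ltnn subnn.
- by apply/eq_in_map => i ie; apply: FE; rewrite mem_cat ie orbT.
Qed.

Lemma multilinear_permw (V : lmodType K) (f : seq g -> V) n (sigma : 'S_n) :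
  multilinear f ->
  multilinear (fun w => if size w == n then f (permw sigma w) else 0).
Proof.
move=> fl s t c x y; rewrite !size_cat /=.
case: eqP => [/esym En|_]; last by rewrite scaler0 addr0.
by have [s' [t' E]] := permw_slot sigma En; rewrite !E fl.
Qed.

(* the action of sigma on the n-th tensor power, extended by 0 *)
Definition tensor_perm n (sigma : 'S_n) : tensor -> tensor :=
  lift (fun w => if size w == n then tensor_word (permw sigma w) else 0).

(* x_1, ..., x_n |-> 1/n! sum_sigma f(x_(sigma 1), ..., x_(sigma n)) *)
Definition symmetrize (V : lmodType K) (f : seq g -> V) (w : seq g) : V :=
  (((size w)`!)%:R^-1 : K) *: \sum_(sigma : 'S_(size w)) f (permw sigma w).

Lemma symmetrize_multilinear (V : lmodType K) (f : seq g -> V) :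
  multilinear f -> multilinear (symmetrize f).
Proof.
move=> fl s t c x y; rewrite /symmetrize.
pose m := (size s + (size t).+1)%N.
have S z : size (s ++ z :: t) = m by rewrite size_cat.
rewrite !S scalerA mulrC -scalerA -scalerDr; congr (_ *: _).
rewrite scaler_sumr -big_split /=; apply: eq_bigr => sigma _.
by have [s' [t' E]] := permw_slot sigma (erefl m); rewrite !E fl.
Qed.

Definition tensor_sym : tensor -> tensor := lift (symmetrize tensor_word).

Lemma tensor_proj_is_linear n : linear (tensor_proj n).
Proof.
apply/lift_is_linear/multilinear_respects.
exact/multilinear_graded/tensor_word_multilinear.
Qed.
HB.instance Definition _ n := GRing.isLinear.Build K tensor tensor _
  (tensor_proj n) (tensor_proj_is_linear n).

Lemma tensor_perm_is_linear n (sigma : 'S_n) : linear (tensor_perm sigma).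
Proof.
apply/lift_is_linear/multilinear_respects.
exact/multilinear_permw/tensor_word_multilinear.
Qed.
HB.instance Definition _ n (sigma : 'S_n) := GRing.isLinear.Build K tensor
  tensor _ (tensor_perm sigma) (tensor_perm_is_linear sigma).

Lemma tensor_sym_is_linear : linear tensor_sym.
Proof.
apply/lift_is_linear/multilinear_respects.
exact/symmetrize_multilinear/tensor_word_multilinear.
Qed.
HB.instance Definition _ := GRing.isLinear.Build K tensor tensor _
  tensor_sym tensor_sym_is_linear.

Lemma tensor_proj_word n w :
  tensor_proj n (tensor_word w) = if size w == n then tensor_word w else 0.
Proof.
apply: lift_word; apply: multilinear_respects.
exact/multilinear_graded/tensor_word_multilinear.
Qed.

Lemma tensor_perm_word n (sigma : 'S_n) w :
  tensor_perm sigma (tensor_word w) =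
  if size w == n then tensor_word (permw sigma w) else 0.
Proof.
apply: lift_word; apply: multilinear_respects.
exact/multilinear_permw/tensor_word_multilinear.
Qed.

Lemma tensor_sym_word w :
  tensor_sym (tensor_word w) = symmetrize tensor_word w.
Proof.
apply: lift_word; apply: multilinear_respects.
exact/symmetrize_multilinear/tensor_word_multilinear.
Qed.

Definition symmetric_tensor : {pred tensor} :=
  [pred a | `[< forall n (sigma : 'S_n), tensor_perm sigma a = tensor_proj n a >]].

Lemma symmetric_tensorP a :
  reflect (forall n (sigma : 'S_n), tensor_perm sigma a = tensor_proj n a)
          (a \in symmetric_tensor).
Proof. exact: asboolP. Qed.

Lemma symmetric_tensor_submod : submod_closed symmetric_tensor.
Proof.
split=> [|c a b /symmetric_tensorP sa /symmetric_tensorP sb].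
  by apply/symmetric_tensorP => n sigma; rewrite !linear0.
by apply/symmetric_tensorP => n sigma; rewrite !linearP /= sa sb.
Qed.
HB.instance Definition _ := GRing.isSubmodClosed.Build K tensor
  symmetric_tensor symmetric_tensor_submod.

Lemma tensor_sym_symmetric a : tensor_sym a \in symmetric_tensor.
Proof.
elim/word_ind: a => [w||a b sa sb|c a sa].
- rewrite [tensor_sym _]tensor_sym_word; apply/symmetric_tensorP => n sigma.
  rewrite /symmetrize !linearZ /=; congr (_ *: _); rewrite !linear_sum /=.
  under eq_bigr do rewrite tensor_perm_word size_permw.
  under [RHS]eq_bigr do rewrite tensor_proj_word size_permw.
  case: eqP => // En; case: n / En sigma => sigma.
  under eq_bigr do rewrite permw_comp.
  by rewrite [RHS](reindex_inj (mulgI sigma)).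
- by rewrite linear0 rpred0.
- by rewrite linearD rpredD.
- by rewrite linearZ rpredZ.
Qed.

Lemma tensor_proj_symmetric n a :
  a \in symmetric_tensor -> tensor_proj n a \in symmetric_tensor.
Proof.
move=> /symmetric_tensorP sa; apply/symmetric_tensorP => m sigma.
have -> : tensor_perm sigma (tensor_proj n a) =
          if n == m then tensor_perm sigma a else 0.
  elim/word_ind: a {sa} => [w||a b sa sb|c a sa].
  - rewrite [tensor_proj _ _]tensor_proj_word [in RHS]tensor_perm_word.
    case: eqP => [<-|ne]; first by rewrite tensor_perm_word; case: eqP.
    rewrite linear0; case: eqP => // Enm; case: eqP => // Em.
    by case: ne; rewrite Enm.
  - by rewrite !linear0 if_same.
  - by rewrite !linearD /= sa sb; case: ifP; rewrite ?addr0.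
  - by rewrite !linearZ /= sa; case: ifP; rewrite ?scaler0.
have -> : tensor_proj m (tensor_proj n a) =
          if n == m then tensor_proj m a else 0.
  elim/word_ind: a {sa} => [w||a b sa sb|c a sa].
  - rewrite [tensor_proj n _]tensor_proj_word [in RHS]tensor_proj_word.
    case: eqP => [<-|ne]; first by rewrite tensor_proj_word; case: eqP.
    rewrite linear0; case: eqP => // Enm; case: eqP => // Em.
    by case: ne; rewrite Enm.
  - by rewrite !linear0 if_same.
  - by rewrite !linearD /= sa sb; case: ifP; rewrite ?addr0.
  - by rewrite !linearZ /= sa; case: ifP; rewrite ?scaler0.
by rewrite sa.
Qed.

Lemma tensor1_symmetric : (1 : tensor) \in symmetric_tensor.
Proof.
apply/symmetric_tensorP => n sigma.
rewrite -[1]/(tensor_word [::]) tensor_perm_word tensor_proj_word.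
case: eqP => // En; congr tensor_word; apply/nilP.
by rewrite /nilp size_permw -En.
Qed.

(* the symmetric tensors, i.e. the direct sum of the S^n(g) *)
Record symalg := Symalg {
  sym_val :> tensor;
  sym_valP : sym_val \in symmetric_tensor
}.
HB.instance Definition _ := [isSub for sym_val].
HB.instance Definition _ := [Choice of symalg by <:].
HB.instance Definition _ := [SubChoice_isSubLmodule of symalg by <:].

Definition sym_proj (n : nat) (x : symalg) : symalg :=
  Symalg (tensor_proj_symmetric n (sym_valP x)).

Definition sym_mul (x y : symalg) : symalg :=
  Symalg (tensor_sym_symmetric (sym_val x * sym_val y)).

Definition sym1 : symalg := Symalg tensor1_symmetric.

End SymmetricTensors.

Section Gutt.
Variables (K : fieldType) (g : lmodType K) (br : g -> g -> g).

(* the relations of the tensor algebra, and x y - y x = [x, y] *)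
Inductive envelop_rel : fsum K g -> fsum K g -> Prop :=
| envelop_relD x y :
    envelop_rel (FWord K [:: x + y]) (FAdd (FWord K [:: x]) (FWord K [:: y]))
| envelop_relZ c x :
    envelop_rel (FWord K [:: c *: x]) (FScale c (FWord K [:: x]))
| envelop_relB x y :
    envelop_rel (FWord K [:: x; y])
                (FAdd (FWord K [:: y; x]) (FWord K [:: br x y])).

(* the universal enveloping algebra; [envelop_word [:: x1; ...; xn]] is the
   product of the x_i *)
Definition envelop : Type := presalg envelop_rel.
HB.instance Definition _ := GRing.Lmodule.on envelop.
HB.instance Definition _ := GRing.PzRing.on envelop.

Definition envelop_word (w : seq g) : envelop := word envelop_rel w.

(* The PBW symmetrization: as the product xi_1 ... xi_n in the symmetric algebra
   is the symmetrization of xi_1 (x) ... (x) xi_n, it suffices to map the latter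
   to 1/n! sum_sigma xi_(sigma 1) ... xi_(sigma n). *)
Definition pbw (x : symalg g) : envelop :=
  lift (symmetrize envelop_word) (sym_val x).

Lemma envelop_word_multilinear : multilinear envelop_word.
Proof.
move=> s t c x y.
have fr := @word_respects K g envelop_rel.
rewrite /envelop_word.
have /= -> := fr s t _ _ (envelop_relD (c *: x) y).
by have /= -> := fr s t _ _ (envelop_relZ c x).
Qed.

Lemma pbw_is_linear : linear pbw.
Proof.
move=> c x y; rewrite /pbw.
have -> : sym_val (c *: x + y) = c *: sym_val x + sym_val y.
  exact: (linearP (val : symalg g -> tensor g)).
apply: lift_is_linear; apply: multilinear_respects.
exact/symmetrize_multilinear/envelop_word_multilinear.
Qed.
HB.instance Definition _ := GRing.isLinear.Build K (symalg g) envelop _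
  pbw pbw_is_linear.

(* [pbw] is bijective by the Poincare-Birkhoff-Witt theorem *)
Definition pbw_inv (u : envelop) : symalg g :=
  xget 0 [set x : symalg g | pbw x = u].

(* the component C_n(x, y) for x in S^k(g) and y in S^l(g) *)
Definition gutt_hom (n k l : nat) (x y : symalg g) : symalg g :=
  if (n <= k + l)%N then sym_proj (k + l - n) (pbw_inv (pbw x * pbw y)) else 0.

Definition gutt_coef (n : nat) (x y : symalg g) : symalg g :=
  \sum_(kl \in [set: nat * nat])
    gutt_hom n kl.1 kl.2 (sym_proj kl.1 x) (sym_proj kl.2 y).

(* In degrees (0, 0) the product is determined by 1 * 1 = 1. *)
Definition gutt_star_hom (z : K) (k l : nat) (x y : symalg g) : symalg g :=
  if (k + l == 0)%N then sym_mul x y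
  else \sum_(n < k + l) z ^+ n *: gutt_hom n k l x y.

Definition gutt_star (z : K) (x y : symalg g) : symalg g :=
  \sum_(kl \in [set: nat * nat])
    gutt_star_hom z kl.1 kl.2 (sym_proj kl.1 x) (sym_proj kl.2 y).

End Gutt.
Variant base_field := RealNumbers | ComplexNumbers.

Definition scalars (R : realType) (F : base_field) : numFieldType :=
  match F with
  | RealNumbers => R : numFieldType
  | ComplexNumbers => R[i] : numFieldType
  end.

Definition modulus (R : realType) (F : base_field) : scalars R F -> R :=
  match F return scalars R F -> R with
  | RealNumbers => fun z : R => `|z|
  | ComplexNumbers => fun z : R[i] => complex.Re `|z|
  end.

Section LocallyConvex.
Variables (R : realType) (F : base_field).
Local Notation K := (scalars R F).

Definition seminorm (V : lmodType K) (p : V -> R) : Prop :=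
  (forall (c : K) x, p (c *: x) = modulus c * p x) /\
  (forall x y, p (x + y) <= p x + p y).

Definition cont_seminorm (V : tvsType K) (p : V -> R) : Prop :=
  seminorm p /\ continuous p.

Definition bilinear_map (U V W : lmodType K) (f : U -> V -> W) : Prop :=
  (forall c x x' y, f (c *: x + x') y = c *: f x y + f x' y) /\
  (forall c x y y', f x (c *: y + y') = c *: f x y + f x y').

(* Completeness for the uniformity of the additive group: the uniform structure
   carried by a [tvsType] is only known to induce the topology. *)
Definition cauchy_filter (V : tvsType K) (G : set_system V) : Prop :=
  forall U : set V, nbhs 0 U ->
    exists2 A, G A & forall x y, A x -> A y -> U (x - y).

Definition complete_tvs (V : tvsType K) : Prop :=
  forall G : set_system V, ProperFilter G -> cauchy_filter G ->
    exists l : V, G --> l.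

Definition abs_summable (V : tvsType K) (a : nat -> V) : Prop :=
  forall q : V -> R, cont_seminorm q -> cvgn (series (fun n => q (a n))).

Definition abs_sum (V : tvsType K) (a : nat -> V) (l : V) : Prop :=
  abs_summable a /\ series a @ \oo --> l.

Definition analytic (V : tvsType K) (f : K -> V) : Prop :=
  forall z0 : K, exists (a : nat -> V) (e : R), 0 < e /\
    forall z, modulus (z - z0) < e ->
      abs_sum (fun n => (z - z0) ^+ n *: a n) (f z).

Section Lie.
Variables (g : tvsType K) (br : g -> g -> g).

Definition lie_bracket : Prop :=
  [/\ bilinear_map br,
      forall x, br x x = 0 &
      forall x y z, br x (br y z) + br y (br z x) + br z (br x y) = 0].

(* a word in n letters: a binary tree with n leaves, i.e. n - 1 brackets *)
Inductive bracket_word : Type :=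
| BLetter of g
| BBracket of bracket_word & bracket_word.

Fixpoint bracket_eval (w : bracket_word) : g :=
  match w with
  | BLetter x => x
  | BBracket v w => br (bracket_eval v) (bracket_eval w)
  end.

Fixpoint bracket_letters (w : bracket_word) : seq g :=
  match w with
  | BLetter x => [:: x]
  | BBracket v w => bracket_letters v ++ bracket_letters w
  end.

Definition asymptotic_estimate (p q : g -> R) : Prop :=
  forall w : bracket_word,
    p (bracket_eval w) <= \prod_(x <- bracket_letters w) q x.

Definition AE_lie_algebra : Prop :=
  [/\ hausdorff_space g,
      lie_bracket,
      continuous (fun xy : g * g => br xy.1 xy.2) &
      forall p, cont_seminorm p ->
        exists2 q, cont_seminorm q & asymptotic_estimate p q].

End Lie.

Section Completion.
Variable g : tvsType K.

(* the projective tensor power p^n on the n-th tensor power of g; the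
   coefficients are only needed for n = 0, where p^0 is the modulus *)
Definition proj_seminorm (p : g -> R) (n : nat) (a : tensor g) : R :=
  inf [set r : R | exists d : seq (K * n.-tuple g),
    a = \sum_(cw <- d) cw.1 *: tensor_word (cw.2 : seq g) /\
    r = \sum_(cw <- d) modulus cw.1 * \prod_(x <- cw.2) p x].

(* p_rho(x) = sum_n n!^rho p^n(x_n), a sum with finite support *)
Definition sym_seminorm (rho : R) (p : g -> R) (x : symalg g) : R :=
  \sum_(n \in [set: nat])
    (n`!%:R `^ rho) * proj_seminorm p n (sym_val (sym_proj n x)).

(* E, with iota, is a Hausdorff completion of the symmetric tensors with respect
   to the seminorms p_rho, p a continuous seminorm of g; these form a directed
   family, so that their balls are a basis of neighbourhoods of 0. *)
Definition is_completion (rho : R) (E : tvsType K) (iota : symalg g -> E) :=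
  [/\ linear iota,
      hausdorff_space E /\ complete_tvs E,
      dense (range iota) &
      forall A : set (symalg g),
        (exists p (e : R), [/\ cont_seminorm p, 0 < e &
           forall x, sym_seminorm rho p x < e -> A x]) <->
        (exists2 U : set E, nbhs 0 U & iota @^-1` U `<=` A)].

Variables (E : tvsType K) (iota : symalg g -> E).

Definition is_cont_extension (f : symalg g -> symalg g -> symalg g)
    (h : E -> E -> E) : Prop :=
  continuous (fun xy : E * E => h xy.1 xy.2) /\
  forall x y, h (iota x) (iota y) = iota (f x y).

(* the continuous extension of f, unique when iota has dense range and E is
   Hausdorff *)
Definition cont_extension (f : symalg g -> symalg g -> symalg g) : E -> E -> E :=
  xget (fun _ _ => 0) [set h | is_cont_extension f h].

Variable br : g -> g -> g.

Definition completed_mul : E -> E -> E := cont_extension (@sym_mul K g).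
Definition completed_coef (n : nat) : E -> E -> E :=
  cont_extension (gutt_coef br n).
Definition completed_star (z : K) : E -> E -> E :=
  cont_extension (gutt_star br z).

End Completion.

Definition topological_algebra (E : tvsType K) (mul : E -> E -> E) (e : E) :=
  [/\ bilinear_map mul, associative mul, left_id e mul /\ right_id e mul &
      continuous (fun xy : E * E => mul xy.1 xy.2)].

(* the algebras (E, star z) are an entire deformation of (E, mul), with Taylor
   coefficients C *)
Definition entire_deformation (E : tvsType K) (mul : E -> E -> E) (e : E)
    (C : nat -> E -> E -> E) (star : K -> E -> E -> E) : Prop :=
  [/\ forall z, topological_algebra (star z) e,
      forall x y, star 0 x y = mul x y &
      forall z x y, abs_summable (fun n => z ^+ n *: C n x y)].

End LocallyConvex.

(* Main.v *)
(* Gutt's formula writes the left multiplication by xi as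
   y^n |-> sum_k (n choose k) B_k (ad y)^k (xi) y^(n-k) with the Bernoulli numbers
   B_k. These operators L_xi satisfy [L_xi, L_eta] = L_[xi, eta]: the defect c
   vanishes on y^n when eta = y, by Euler's quadratic identity for the Bernoulli
   numbers, and an induction on n yields the Bianchi identity
   c(xi, eta; y w) = c(xi, y; eta w) - c(eta, y; xi w); polarizing the former and
   inserting it into the latter gives (1 + 2/n) c = 0. Hence u |-> L_u 1 is defined
   on the enveloping algebra and inverts the symmetrization map.

   Iterating Gutt's formula expands x_1 ... x_m into symmetric products of
   forests of brackets with leaves x_1, ..., x_m, and |B_k / k!| <= 1 bounds the sum
   of |coefficient| * (number of trees)! by 4^m m!. With the asymptotic estimates
   and rho >= 1 this gives
   sum_n |z|^n p_rho(C_n(x, y)) <= (c q)_rho(x) (c q)_rho(y)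
   uniformly in the number of terms. The continuous extensions, the absolute
   convergence and, after re-expansion at z0 on the dense subspace, analyticity
   all follow from this bound; the tails are controlled by replacing z with 2 z. *)

From HB Require Import structures.
From mathcomp Require Import all_boot all_order all_algebra all_fingroup.
From mathcomp Require Import all_classical all_reals all_analysis.
From mathcomp Require Import complex ring lra zify.
Require Import Defs.

Set Implicit Arguments.
Unset Strict Implicit.
Unset Printing Implicit Defensive.

Import Order.TTheory GRing.Theory Num.Theory.
Import numFieldNormedType.Exports.

Local Open Scope classical_set_scope.
Local Open Scope ring_scope.

(** * Multilinear functions of sequences *)

(** [pbw_inv] is a mere choice of preimage, so no coefficient C_n can be computed before the
    symmetrization map is known to be bijective. The operators L_xi serve twice: they prove
    bijectivity without choosing a basis of [g], and the same formula, read as a sum over forests,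
    carries the estimates. Identities in the symmetric algebra are checked on powers y^n only,
    because in characteristic zero a symmetric multilinear map is determined by its diagonal. The
    parameter z is absorbed by the bracket: turning m letters into r trees uses m - r brackets, so
    the star product at z is the one at parameter 1 for the Lie bracket z [x, y], and associativity
    holds for every z at once, zero included. The seminorms p_rho are never extended to the
    completion. Each estimate is proved for elements of the dense subspace near a given point, with
    constants depending on the neighbourhood only, and passes to the limit as a closed condition. *)

Lemma perm_mid (T : eqType) (x : T) u v : perm_eq (u ++ x :: v) (x :: u ++ v).
Proof. exact/permPl/(perm_catCA u [:: x] v). Qed.

Lemma perm_swap (T : eqType) (x y : T) v : perm_eq (x :: y :: v) (y :: x :: v).
Proof. exact: (perm_mid y [:: x] v). Qed.

(** Adjacent swaps carry the head of [w] to the front of [w']; the tails are compared by induction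
    on [w], with the head absorbed into [f]. *)
Lemma perm_invariant_of_swap (T : eqType) (V : Type) (f : seq T -> V) :
  (forall u a b v, f (u ++ a :: b :: v) = f (u ++ b :: a :: v)) ->
  forall w w', perm_eq w w' -> f w = f w'.
Proof.
move=> fs w; elim: w f fs => [|x w IH] f fs w' pw.
  by move: pw; rewrite perm_sym => /perm_nilP ->.
have xw' : x \in w' by rewrite -(perm_mem pw) mem_head.
case/path.splitPr: xw' pw => u v pw.
have {}pw : perm_eq w (u ++ v).
  by rewrite -(perm_cons x) (perm_trans pw) // perm_mid.
rewrite (IH (fun s => f (x :: s)) _ _ pw); last by move=> *; exact: (fs (x :: _)).
have E s : f (s ++ x :: u ++ v) = f (s ++ u ++ x :: v).
  elim: u {pw} s => [//|a u IHu] s.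
  by rewrite /= fs -cat_rcons IHu cat_rcons.
exact: (E [::]).
Qed.

Section Picks.
Variable T : Type.

(** The Leibniz rule in list form: each entry removes one letter and keeps the others in order,
    repeated letters being counted with multiplicity. *)
Fixpoint picks (s : seq T) : seq (T * seq T) :=
  if s is x :: s' then (x, s') :: [seq (yv.1, x :: yv.2) | yv <- picks s']
  else [::].

Lemma size_picks s : size (picks s) = size s.
Proof. by elim: s => [//|x s IH] /=; rewrite size_map IH. Qed.

Lemma picks_nseq n y : picks (nseq n y) = nseq n (y, nseq n.-1 y).
Proof. elim: n => [//|[//|n] IH].
by transitivity ((y, nseq n.+1 y) :: [seq (yv.1, y :: yv.2) | yv <- picks (nseq n.+1 y)]);
  rewrite // IH map_nseq. Qed.

End Picks.

Lemma picks_map (T U : Type) (h : T -> U) s :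
  picks (map h s) = [seq (h yv.1, map h yv.2) | yv <- picks s].
Proof. by elim: s => [//|x s IH] /=; rewrite IH -!map_comp. Qed.

Lemma picks_perm (T : eqType) (s : seq T) yv :
  yv \in picks s -> perm_eq (yv.1 :: yv.2) s.
Proof.
elim: s yv => [//|x s IH] yv /=; rewrite inE => /orP[/eqP-> //|/mapP[zv zs ->]] /=.
by apply: perm_trans (perm_swap _ _ _) _; rewrite perm_cons IH.
Qed.

Section LModule.
Variables (K : numFieldType) (V : lmodType K).

(** For a polynomial P of degree at most n, P(2 c) - 2^n P(c) has no term of degree n, and its other
    coefficients are those of P times 2^i - 2^n, which is nonzero in characteristic zero. *)
Lemma poly_coef_eq0 n (v : nat -> V) :
  (forall c : K, \sum_(i < n) c ^+ i *: v i = 0) ->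
  forall i, (i < n)%N -> v i = 0.
Proof.
elim: n v => [//|n IH] v v0.
have low i : (i < n)%N -> v i = 0.
  move=> lt_in; have: (2 ^+ i - 2 ^+ n) *: v i = 0.
    apply: (IH (fun i => (2 ^+ i - 2 ^+ n) *: v i)) => // c.
    have := v0 (2 * c); have := v0 c; rewrite !big_ord_recr /=.
    move=> /(congr1 (fun x => 2 ^+ n *: x)); rewrite scaler0 => E1 E2.
    have: (\sum_(j < n) (2 * c) ^+ j *: v j + (2 * c) ^+ n *: v n)
        - 2 ^+ n *: (\sum_(j < n) c ^+ j *: v j + c ^+ n *: v n) = 0.
      by rewrite E1 E2 subr0.
    rewrite scalerDr opprD addrACA scalerA -exprMn subrr addr0 => E.
    rewrite -[RHS]E scaler_sumr -sumrB; apply: eq_bigr => j _.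
    by rewrite exprMn !scalerA -scalerBl; congr (_ *: _); ring.
  move/eqP; rewrite scaler_eq0 => /orP[|/eqP //].
  rewrite subr_eq0 -!natrX eqr_nat eqn_exp2l // => /eqP E.
  by rewrite E ltnn in lt_in.
move=> i; rewrite ltnS leq_eqVlt => /orP[/eqP->|/low //].
have := v0 1; rewrite big_ord_recr /= big1 => [|j _]; last by rewrite low ?scaler0.
by rewrite add0r expr1n scale1r.
Qed.

Definition symmetric (T : eqType) (f : seq T -> V) :=
  forall w w', perm_eq w w' -> f w = f w'.

Lemma sum_picks_symmetric (T : eqType) (H : T -> seq T -> V) :
  (forall y, symmetric (H y)) ->
  symmetric (fun w => \sum_(yv <- picks w) H yv.1 yv.2).
Proof.
move=> Hs; apply: perm_invariant_of_swap => u a b v.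
elim: u H Hs => [|x u IH] H Hs /=.
  rewrite !big_cons !big_map !addrA /=; congr (_ + _); first exact: addrC.
  apply: eq_bigr => yv _; apply: Hs.
  exact: perm_swap.
rewrite !big_cons !big_map /=; congr (_ + _).
  by apply: Hs; rewrite perm_cat2l perm_swap.
by apply: (IH (fun y v => H y (x :: v))) => y w w' pw; apply: Hs; rewrite perm_cons.
Qed.

Variable g : lmodType K.

Lemma multilinear_cat (f : seq g -> V) u :
  multilinear f -> multilinear (fun w => f (u ++ w)).
Proof. by move=> fl s t c x y; rewrite !catA; exact: fl. Qed.

Lemma multilinear0 (f : seq g -> V) s t :
  multilinear f -> f (s ++ 0 :: t) = 0.
Proof. by move=> fl; have := multilinearZ s t 0 0 fl; rewrite !scale0r. Qed.

Lemma multilinear_comp (W : lmodType K) (h : {linear V -> W}) (f : seq g -> V) :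
  multilinear f -> multilinear (h \o f).
Proof. by move=> fl s t c x y; rewrite /= fl linearP. Qed.

Lemma sum_picks_multilinear (H : g -> seq g -> V) :
  (forall w, linear (H^~ w)) -> (forall y, multilinear (H y)) ->
  multilinear (fun w => \sum_(yv <- picks w) H yv.1 yv.2).
Proof.
move=> H1 H2 s t c x y; elim: s H H1 H2 => [|a s IH] H H1 H2 /=.
  rewrite !big_cons !big_map /= H1 scalerDr addrACA; congr (_ + _).
  rewrite scaler_sumr -big_split; apply: eq_bigr => yv _.
  exact: (H2 _ [::]).
rewrite !big_cons !big_map /= H2 scalerDr addrACA; congr (_ + _).
by apply: (IH (fun y v => H y (a :: v))) => // z; exact: (multilinear_cat [:: a]).
Qed.

Lemma multilinear_nseqD (f : seq g -> V) n x y (c : K) :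
  multilinear f -> symmetric f ->
  f (nseq n (y + c *: x)) =
  \sum_(i < n.+1) c ^+ i *: ('C(n, i)%:R *: f (nseq i x ++ nseq (n - i) y)).
Proof.
elim: n f => [|n IH] f fl fs.
  by rewrite big_ord_recl big_ord0 /= bin0 !scale1r addr0.
have fsx u : symmetric (fun w => f (u ++ w)).
  by move=> w w' pw; apply: fs; rewrite perm_cat2l.
rewrite /= [X in X :: _]addrC (fl [::]) /=.
have /= -> := IH _ (multilinear_cat [:: x] fl) (fsx [:: x]).
have /= -> := IH _ (multilinear_cat [:: y] fl) (fsx [:: y]).
have E i : (i < n.+1)%N ->
    f ([:: y] ++ nseq i x ++ nseq (n - i) y) = f (nseq i x ++ nseq (n.+1 - i) y).
  move=> lti; rewrite subSn //; apply: fs.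
  by rewrite perm_sym perm_mid.
rewrite [RHS]big_ord_recl /= bin0 expr0 !scale1r ?subn0.
rewrite [X in _ + X = _]big_ord_recl /= bin0 expr0 !scale1r ?subn0.
rewrite addrCA; congr (_ + _).
rewrite [X in _ + X](_ : _ = \sum_(i < n.+1) c ^+ i.+1 *:
   ('C(n, i.+1)%:R *: f (nseq i.+1 x ++ nseq (n - i) y))); last first.
  rewrite big_ord_recr /= bin_small // scale0r scaler0 addr0.
  apply: eq_bigr => i _; rewrite /bump leq0n /= !add1n; congr (_ *: (_ *: _)).
  by rewrite (E i.+1) ?subSS // ltnS ltn_ord.
rewrite scaler_sumr -big_split /=; apply: eq_bigr => i _.
rewrite /bump leq0n add1n binS natrD scalerDl scalerDr addrC subSS.
by congr (_ + _); rewrite scalerA exprS.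
Qed.

(** The copies of y are freed one at a time: after j arbitrary letters v, the coefficient of c in
    f(v, y + c x, ..., y + c x) = 0 is a positive multiple of the value with one further free letter
    x. *)
Lemma polarization (f : seq g -> V) n :
  multilinear f -> symmetric f -> (forall y, f (nseq n y) = 0) ->
  forall w, size w = n -> f w = 0.
Proof.
move=> fl fs f0.
have P j : (j <= n)%N -> forall v y, (size v + (n - j))%N = n -> f (v ++ nseq (n - j) y) = 0.
  elim: j => [|j IH] ltj v y sv.
    by rewrite subn0 in sv *; case: v sv => [_|x v /=]; [exact: f0|lia].
  case: v sv => [|x v] sv; first by move: sv => /=; lia.
  pose m := (n - j.+1)%N.
  have Em : (n - j)%N = m.+1 by rewrite /m; lia.
  have fvs : symmetric (fun w => f (v ++ w)).
    by move=> w w' pw; apply: fs; rewrite perm_cat2l.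
  pose A i := 'C(m.+1, i)%:R *: f (v ++ nseq i x ++ nseq (m.+1 - i) y).
  have A0 : A 1%N = 0.
    apply: (@poly_coef_eq0 m.+2 A) => // c.
    rewrite -(multilinear_nseqD _ _ _ _ (multilinear_cat v fl) fvs) -Em.
    by apply: IH; [exact: ltnW|rewrite Em; move: sv => /=; rewrite -/m; lia].
  move: A0; rewrite /A bin1 subn1 /= => /eqP; rewrite scaler_eq0 pnatr_eq0 /= => /eqP A0.
  by rewrite -/m -[RHS]A0; apply: fs; rewrite perm_sym perm_mid.
move=> w sw; have := P n (leqnn n) w 0; rewrite subnn /= cats0; apply.
by rewrite addn0.
Qed.

End LModule.

(** * Symmetric words *)

Section SymmetricWords.
Variables (K : numFieldType) (g : lmodType K).
Implicit Types u v w : seq g.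

Lemma permw_perm n (sigma : 'S_n) w : size w = n -> perm_eq (permw sigma w) w.
Proof.
move=> sw; rewrite /permw /image_mem.
have {2}-> : w = [seq nth 0 w (val i) | i <- enum 'I_n].
  apply: (@eq_from_nth _ 0); first by rewrite size_map size_enum_ord.
  move=> i; rewrite sw => lti.
  by rewrite (nth_map (Ordinal lti)) ?size_enum_ord //= nth_enum_ord.
rewrite (map_comp (fun i : 'I_n => nth 0 w (val i)) sigma); apply: perm_map.
apply: uniq_perm; rewrite ?enum_uniq //.
  by rewrite map_inj_uniq ?enum_uniq //; exact: perm_inj.
move=> i; rewrite mem_enum; apply/mapP; exists ((sigma^-1)%g i).
  by rewrite mem_enum.
by rewrite permKV.
Qed.

Lemma perm_eq_permw u v : perm_eq u v ->
  exists sigma : 'S_(size v), u = permw sigma v.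
Proof.
move=> puv; have /tuple_permP[sigma E] : perm_eq u (in_tuple v) by [].
exists sigma; rewrite E /permw; apply: eq_map => i /=.
by rewrite (tnth_nth 0).
Qed.

Lemma symmetrizeE (V : lmodType K) (f : seq g -> V) w n : size w = n ->
  symmetrize f w = (n`!%:R^-1 : K) *: \sum_(sigma : 'S_n) f (permw sigma w).
Proof. by move=> <-. Qed.

Lemma fact_neq0 n : n`!%:R != 0 :> K.
Proof. by rewrite pnatr_eq0 -lt0n fact_gt0. Qed.

Lemma symmetrize_symmetric (V : lmodType K) (f : seq g -> V) :
  symmetric (symmetrize f).
Proof.
move=> w w' /perm_eq_permw[tau ->].
rewrite (symmetrizeE _ (size_permw tau w')) /symmetrize; congr (_ *: _).
under eq_bigr do rewrite permw_comp.
by rewrite [RHS](reindex_inj (mulIg tau)).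
Qed.

Lemma sum_perm_const (V : lmodType K) n (x : V) :
  (n`!%:R^-1 : K) *: \sum_(sigma : 'S_n) x = x.
Proof.
rewrite sumr_const card_Sn -[x *+ _]scaler_nat scalerA mulVf ?scale1r ?fact_neq0 //.
Qed.

Lemma symmetrize_id (V : lmodType K) (f : seq g -> V) w :
  symmetric f -> symmetrize f w = f w.
Proof.
move=> fs; rewrite /symmetrize -[RHS](sum_perm_const (size w)).
by congr (_ *: _); apply: eq_bigr => sigma _; apply: fs; rewrite permw_perm.
Qed.

(** The product of the letters in the symmetric algebra, realized as a symmetrized tensor. *)
Definition sym_word w : symalg g := Symalg (tensor_sym_symmetric (tensor_word w)).

Lemma sym_valP_linear c (a b : symalg g) :
  sym_val (c *: a + b) = c *: sym_val a + sym_val b.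
Proof. exact: (linearP (val : symalg g -> tensor g)). Qed.

Lemma sym_val_sum (I : Type) (r : seq I) (F : I -> symalg g) :
  sym_val (\sum_(i <- r) F i) = \sum_(i <- r) sym_val (F i).
Proof. exact: (raddf_sum (val : symalg g -> tensor g)). Qed.

Lemma sym_word_multilinear : multilinear sym_word.
Proof.
move=> s t c x y; apply: val_inj; rewrite [RHS]sym_valP_linear /=.
by rewrite tensor_word_multilinear linearP.
Qed.

Lemma sym_word_symmetric : symmetric sym_word.
Proof.
move=> w w' pw; apply: val_inj; rewrite /= !tensor_sym_word.
exact: symmetrize_symmetric.
Qed.

Lemma tensor_proj_large (a : tensor g) :
  exists N, forall n, (N <= n)%N -> tensor_proj n a = 0.
Proof.
elim/word_ind: a => [w||a b [N Na] [M Mb]|c a [N Na]].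
- exists (size w).+1 => n; rewrite [tensor_proj _ _]tensor_proj_word.
  by case: eqP => // ->; rewrite ltnn.
- by exists 0%N => n _; rewrite linear0.
- exists (maxn N M) => n; rewrite geq_max => /andP[? ?].
  by rewrite linearD /= Na // Mb // addr0.
- by exists N => n /Na E; rewrite linearZ /= E scaler0.
Qed.

Lemma tensor_proj_sum (a : tensor g) N :
  (forall n, (N <= n)%N -> tensor_proj n a = 0) ->
  a = \sum_(n < N) tensor_proj n a.
Proof.
have [N0] : exists N0, forall M, (N0 <= M)%N -> a = \sum_(n < M) tensor_proj n a.
  elim/word_ind: a => [w||a b [M Ma] [M' Mb]|c a [M Ma]].
  - exists (size w).+1 => M lt.
    rewrite (bigD1 (Ordinal lt)) //= tensor_proj_word eqxx big1 ?addr0 //.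
    move=> i; rewrite -val_eqE /= => ne.
    by rewrite tensor_proj_word eq_sym (negbTE ne).
  - by exists 0%N => M _; rewrite big1 // => i _; rewrite linear0.
  - exists (maxn M M') => L; rewrite geq_max => /andP[? ?].
    under eq_bigr do rewrite linearD.
    by rewrite big_split /= -Ma // -Mb.
  - exists M => L /Ma {1}->; rewrite scaler_sumr.
    by apply: eq_bigr => i _; rewrite linearZ.
move=> aN0 N0a; rewrite {1}(aN0 (maxn N0 N) (leq_maxl _ _)).
rewrite -(big_mkord xpredT (fun n => tensor_proj n a)).
rewrite (big_cat_nat (n := N)) ?leq_maxr //= big_mkord.
rewrite [X in _ + X]big_nat_cond [X in _ + X]big1 ?addr0 // => n /andP[/andP[le _] _].
exact: N0a.
Qed.

(** Symmetric tensors are defined through [tensor_perm], degree by degree, while [tensor_sym] is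
    lifted from words. This expansion links the two, so that symmetrization can be seen to fix
    symmetric tensors. *)
Lemma tensor_sym_sum (a : tensor g) : exists N, forall M, (N <= M)%N ->
  tensor_sym a =
  \sum_(n < M) (n`!%:R^-1 : K) *: \sum_(sigma : 'S_n) tensor_perm sigma a.
Proof.
elim/word_ind: a => [w||a b [M Ma] [M' Mb]|c a [M Ma]].
- exists (size w).+1 => M lt; rewrite [tensor_sym _]tensor_sym_word.
  rewrite (bigD1 (Ordinal lt)) //= [X in _ + X]big1 ?addr0.
    rewrite /symmetrize; congr (_ *: _); apply: eq_bigr => sigma _.
    by rewrite [tensor_perm _ _]tensor_perm_word eqxx.
  move=> i; rewrite -val_eqE /= => ne; rewrite big1 ?scaler0 // => sigma _.
  by rewrite [tensor_perm _ _]tensor_perm_word eq_sym (negbTE ne).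
- exists 0%N => M _; rewrite linear0 big1 // => i _.
  by rewrite big1 ?scaler0 // => sigma _; rewrite linear0.
- exists (maxn M M') => L; rewrite geq_max => /andP[? ?].
  rewrite linearD /= (Ma L) // (Mb L) // -big_split /=; apply: eq_bigr => n _.
  rewrite -scalerDr -big_split /=; congr (_ *: _).
  by apply: eq_bigr => sigma _; rewrite linearD.
- exists M => L /Ma E; rewrite linearZ /= E scaler_sumr; apply: eq_bigr => n _.
  rewrite scalerA mulrC -scalerA scaler_sumr; congr (_ *: _).
  by apply: eq_bigr => sigma _; rewrite linearZ.
Qed.

Lemma tensor_sym_id (x : symalg g) : tensor_sym (sym_val x) = sym_val x.
Proof.
have [N pN] := tensor_proj_large (sym_val x).
have [M ME] := tensor_sym_sum (sym_val x).
rewrite (ME (maxn M N) (leq_maxl _ _)).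
rewrite [RHS](@tensor_proj_sum _ (maxn M N)); last first.
  by move=> n; rewrite geq_max => /andP[_ /pN].
apply: eq_bigr => n _; rewrite -[RHS](sum_perm_const n); congr (_ *: _).
by apply: eq_bigr => sigma _; have /symmetric_tensorP := sym_valP x.
Qed.

(** Symmetrization fixes the symmetric tensors, hence maps onto them, and the symmetrized words
    span. *)
Lemma sym_word_ind (P : symalg g -> Prop) :
  (forall w, P (sym_word w)) -> P 0 -> (forall x y, P x -> P y -> P (x + y)) ->
  (forall c x, P x -> P (c *: x)) -> forall x, P x.
Proof.
move=> Pw P0 PD PZ x; have -> : x = Symalg (tensor_sym_symmetric (sym_val x)).
  by apply: val_inj; rewrite /= tensor_sym_id.
elim/word_ind: (sym_val x) => [w||a b Pa Pb|c a Pa].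
- exact: Pw.
- by rewrite [X in P X](_ : _ = 0) //; apply: val_inj; rewrite /= linear0.
- rewrite [X in P X](_ : _ = Symalg (tensor_sym_symmetric a) +
    Symalg (tensor_sym_symmetric b)); first exact: PD.
  by apply: val_inj; rewrite /= linearD.
- rewrite [X in P X](_ : _ = c *: Symalg (tensor_sym_symmetric a)); first exact: PZ.
  by apply: val_inj; rewrite /= linearZ.
Qed.

Lemma eq_linear_sym (V : lmodType K) (f h : {linear symalg g -> V}) :
  (forall w, f (sym_word w) = h (sym_word w)) -> f =1 h.
Proof.
move=> fh; elim/sym_word_ind => [//||x y fx fy|c x fx]; first by rewrite !linear0.
  by rewrite !linearD fx fy.
by rewrite !linearZ fx.
Qed.

(** For symmetric multilinear [f] this is the universal property of the symmetric algebra; for other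
    multilinear [f] the value on a product is the symmetrization of [f]. *)
Definition sym_lift (V : lmodType K) (f : seq g -> V) (x : symalg g) : V :=
  lift f (sym_val x).

Lemma sym_lift_linear (V : lmodType K) (f : seq g -> V) :
  multilinear f -> linear (sym_lift f).
Proof.
move=> fl c x y; rewrite /sym_lift sym_valP_linear.
exact/lift_is_linear/multilinear_respects.
Qed.

Lemma sym_liftE (V : lmodType K) (f : seq g -> V) w :
  multilinear f -> sym_lift f (sym_word w) = symmetrize f w.
Proof.
move=> fl; have fr := multilinear_respects fl.
rewrite /sym_lift /= tensor_sym_word.
pose h : {linear tensor g -> V} := HB.pack (lift f)
  (GRing.isLinear.Build _ _ _ _ (lift f) (lift_is_linear fr)).
rewrite /symmetrize -[lift f _]/(h _) linearZ linear_sum /=; congr (_ *: _).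
by apply: eq_bigr => sigma _; exact: lift_word.
Qed.

Lemma sym_lift_word (V : lmodType K) (f : seq g -> V) w :
  multilinear f -> symmetric f -> sym_lift f (sym_word w) = f w.
Proof. by move=> fl fs; rewrite sym_liftE ?symmetrize_id. Qed.

Lemma sym_proj_linear n : linear (@sym_proj K g n).
Proof.
move=> c x y; apply: val_inj; rewrite [RHS]sym_valP_linear.
by rewrite -[LHS]/(tensor_proj n (sym_val (c *: x + y))) sym_valP_linear linearP.
Qed.
HB.instance Definition _ n := GRing.isLinear.Build K (symalg g) (symalg g) _
  (@sym_proj K g n) (sym_proj_linear n).

Lemma sym_proj_word n w :
  sym_proj n (sym_word w) = if size w == n then sym_word w else 0.
Proof.
apply: val_inj; rewrite /= tensor_sym_word linearZ linear_sum /=.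
under eq_bigr do rewrite tensor_proj_word size_permw.
case: eqP => _; last by rewrite big1 ?scaler0.
by rewrite /= tensor_sym_word.
Qed.

Lemma tensor_scalerAl c (a b : tensor g) : c *: (a * b) = c *: a * b.
Proof. exact: pres_scaleAl. Qed.

Lemma tensor_scalerAr c (a b : tensor g) : c *: (a * b) = a * (c *: b).
Proof. exact: pres_scaleAr. Qed.

Lemma sym_mul_linearl (y : symalg g) : linear (@sym_mul K g ^~ y).
Proof.
move=> c x x'; apply: val_inj; rewrite [RHS]sym_valP_linear.
rewrite -[LHS]/(tensor_sym (sym_val (c *: x + x') * sym_val y)) sym_valP_linear.
by rewrite mulrDl linearD /= -linearZ tensor_scalerAl.
Qed.

Lemma sym_mul_linearr (x : symalg g) : linear (@sym_mul K g x).
Proof.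
move=> c y y'; apply: val_inj; rewrite [RHS]sym_valP_linear.
rewrite -[LHS]/(tensor_sym (sym_val x * sym_val (c *: y + y'))) sym_valP_linear.
by rewrite mulrDr linearD /= -linearZ tensor_scalerAr.
Qed.

(** The outer symmetrization absorbs the permutations of the two factors, so both inner averages run
    over equal terms. *)
Lemma sym_mul_word u v : sym_mul (sym_word u) (sym_word v) = sym_word (u ++ v).
Proof.
apply: val_inj; rewrite /= (tensor_sym_word u) (tensor_sym_word v) /symmetrize.
set a := _^-1; set b := _^-1.
have -> : (a *: \sum_(sigma : 'S_(size u)) tensor_word (permw sigma u)) *
  (b *: \sum_(sigma : 'S_(size v)) tensor_word (permw sigma v)) =
  a *: \sum_(sigma : 'S_(size u)) (b *: \sum_(tau : 'S_(size v))
    tensor_word (permw sigma u ++ permw tau v)).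
  rewrite -tensor_scalerAl mulr_suml; congr (_ *: _); apply: eq_bigr => sigma _.
  rewrite -tensor_scalerAr mulr_sumr; congr (_ *: _); apply: eq_bigr => tau _.
  exact: pres_mul_word.
rewrite linearZ linear_sum /= -[RHS](sum_perm_const (size u)); congr (_ *: _).
apply: eq_bigr => sigma _; rewrite linearZ linear_sum /=.
rewrite -[RHS](sum_perm_const (size v)); congr (_ *: _); apply: eq_bigr => tau _.
rewrite !tensor_sym_word; apply: symmetrize_symmetric.
by apply: perm_cat; rewrite permw_perm.
Qed.

Lemma sym1E : sym1 g = sym_word [::].
Proof.
apply: val_inj; rewrite /= tensor_sym_word /symmetrize -[LHS](sum_perm_const 0).
congr (_ *: _); apply: eq_bigr => sigma _ /=.
by congr tensor_word; apply/esym/nilP; rewrite /nilp size_permw.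
Qed.

End SymmetricWords.

(** * Left multiplication by a Lie algebra element *)

Section LeftMultiplication.
Variables (K : numFieldType) (g : lmodType K).

(** * Bernoulli coefficients *)

Section Coefficients.

Definition beta_next (s : seq K) : K :=
  - (s`_(size s).-1 + \sum_(1 <= k < size s) s`_k * s`_(size s - k))
  / (size s).+1%:R.

Fixpoint betas (n : nat) : seq K :=
  if n is m.+1 then rcons (betas m) (beta_next (betas m)) else [:: 1].

(* beta n = B_n / n!, the Taylor coefficients of t / (e^t - 1), computed from
   Euler's quadratic recursion for the Bernoulli numbers *)
Definition beta n : K := (betas n)`_n.

Lemma size_betas n : size (betas n) = n.+1.
Proof. by elim: n => [//|n IH] /=; rewrite size_rcons IH. Qed.

Lemma nth_betas n i : (i <= n)%N -> (betas n)`_i = beta i.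
Proof.
elim: n => [|n IH]; first by rewrite leqn0 => /eqP->.
rewrite leq_eqVlt => /orP[/eqP-> //|]; rewrite ltnS => lei /=.
by rewrite nth_rcons size_betas ltnS lei IH.
Qed.

Lemma beta0 : beta 0 = 1. Proof. by []. Qed.

Lemma betaS n : beta n.+1 =
  - (beta n + \sum_(1 <= k < n.+1) beta k * beta (n.+1 - k)) / n.+2%:R.
Proof.
rewrite {1}/beta /= nth_rcons size_betas ltnn eqxx /beta_next size_betas /=.
rewrite nth_betas //; congr (- (_ + _) / _).
by rewrite [LHS]big_nat_cond [RHS]big_nat_cond; apply: eq_bigr => k;
  rewrite andbT => /andP[k1 k2]; rewrite !nth_betas //; lia.
Qed.

(** The coefficient of t^(n+1) in t b' = b - b^2 - t b for b(t) = t / (e^t - 1). The sum stops at k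
    = n because the term k = n + 1 of b^2 cancels against b. *)
Lemma beta_euler n : n.+1%:R * beta n.+1 + beta n +
  \sum_(k < n.+1) beta k * beta (n.+1 - k) = 0.
Proof.
rewrite -(big_mkord xpredT (fun k => beta k * beta (n.+1 - k))).
rewrite big_ltn // subn0 beta0 mul1r.
have := betaS n => /(congr1 (fun x => x * n.+2%:R)).
rewrite mulfVK ?pnatr_eq0 // -[n.+2]addn1 natrD => E.
set S := \sum_(_ <= _ < _) _ in E *; set b := beta n.+1 in E *.
have -> : n.+1%:R * b + beta n + (b + S) = b * (n.+1%:R + 1%:R) + (beta n + S) by ring.
by rewrite E addNr.
Qed.

(** In the recursion [betaS] the numerator has n + 1 terms of modulus at most 1, against the
    denominator n + 2. *)
Lemma beta_le1 n : `|beta n| <= 1.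
Proof.
elim/ltn_ind: n => -[|n] IH; first by rewrite beta0 normr1.
rewrite betaS normrM normrN normfV normr_nat ler_pdivrMr ?ltr0n // mul1r.
apply: (le_trans (ler_normD _ _)); rewrite -[n.+2]add1n natrD lerD ?IH //.
apply: (le_trans (ler_norm_sum _ _ _)).
rewrite (@le_trans _ _ (\sum_(1 <= k < n.+1) 1)) //; last first.
  by rewrite sumr_const_nat subn1 /= ler_nat leqnSn.
rewrite !big_nat; apply: ler_sum => k /andP[k1 k2].
by rewrite normrM mulr_ile1 ?IH //; lia.
Qed.

End Coefficients.

Variable br : g -> g -> g.

(** Only the algebra of a Lie bracket, free of topology; it is also applied to the rescaled brackets
    z [x, y]. *)
Definition lie_axioms : Prop :=
  [/\ forall c x x' y, br (c *: x + x') y = c *: br x y + br x' y,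
      forall c x y y', br x (c *: y + y') = c *: br x y + br x y',
      forall x, br x x = 0 &
      forall x y z, br x (br y z) + br y (br z x) + br z (br x y) = 0].

Hypothesis brP : lie_axioms.

Let brl c x x' y : br (c *: x + x') y = c *: br x y + br x' y.
Proof. by case: brP. Qed.
Let brr c x y y' : br x (c *: y + y') = c *: br x y + br x y'.
Proof. by case: brP. Qed.
Let brxx x : br x x = 0. Proof. by case: brP. Qed.
Let br0r x : br x 0 = 0.
Proof. by have := brr (-1) x 0 0; rewrite scaler0 addr0 scaleN1r addNr. Qed.
Let brDl x x' y : br (x + x') y = br x y + br x' y.
Proof. by have := brl 1 x x' y; rewrite !scale1r. Qed.
Let brDr x y y' : br x (y + y') = br x y + br x y'.
Proof. by have := brr 1 x y y'; rewrite !scale1r. Qed.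
Let brC x y : br x y = - br y x.
Proof.
apply/eqP; rewrite -addr_eq0; have := brxx (x + y).
by rewrite brDl !brDr !brxx add0r addr0 => ->.
Qed.
Let brN x y : br x (- y) = - br x y.
Proof. by have := brr (-1) x y 0; rewrite br0r !addr0 !scaleN1r. Qed.
Let jacobi x y z : br (br x y) z = br x (br y z) - br y (br x z).
Proof.
case: brP => _ _ _ J; have := J x y z; rewrite (brC z (br x y)) (brC z x) brN.
by move/subr0_eq.
Qed.

(** Sum over the ordered choices of k letters of [w] to be bracketed onto [xi]. On y^n each of the
    n! / (n - k)! choices gives (ad y)^k (xi) y^(n - k); the 1 / k! missing from the binomial
    coefficient sits in [beta k]. *)
Fixpoint ad_sum (k : nat) (xi : g) (w : seq g) : symalg g :=
  if k is k'.+1 then \sum_(yv <- picks w) ad_sum k' (br yv.1 xi) yv.2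
  else sym_word (xi :: w).

Lemma ad_sum_linear k w : linear (ad_sum k ^~ w).
Proof.
elim: k w => [|k IH] w c x y; first exact: (sym_word_multilinear [::]).
rewrite /= scaler_sumr -big_split; apply: eq_bigr => yv _.
by rewrite brr IH.
Qed.

Lemma ad_sum_multilinear k xi : multilinear (ad_sum k xi).
Proof.
elim: k xi => [|k IH] xi.
  exact: (multilinear_cat [:: xi] (@sym_word_multilinear K g)).
apply: (sum_picks_multilinear (H := fun y v => ad_sum k (br y xi) v)) => //.
by move=> w c x y; rewrite brl ad_sum_linear.
Qed.

Lemma ad_sum_symmetric k xi : symmetric (ad_sum k xi).
Proof.
elim: k xi => [|k IH] xi.
  by move=> w w' pw; apply: sym_word_symmetric; rewrite perm_cons.
by apply: (sum_picks_symmetric (H := fun y v => ad_sum k (br y xi) v)).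
Qed.

Definition left_mul_word (xi : g) (w : seq g) : symalg g :=
  \sum_(k < (size w).+1) beta k *: ad_sum k xi w.

Lemma left_mul_word_symmetric xi : symmetric (left_mul_word xi).
Proof.
move=> w w' pw; rewrite /left_mul_word (perm_size pw); apply: eq_bigr => k _.
by rewrite (ad_sum_symmetric _ _ pw).
Qed.

Lemma left_mul_word_multilinear xi : multilinear (left_mul_word xi).
Proof.
move=> s t c x y; rewrite /left_mul_word !size_cat /= scaler_sumr -big_split.
apply: eq_bigr => k _; rewrite ad_sum_multilinear scalerDr !scalerA.
by rewrite [beta k * c]mulrC.
Qed.

Lemma left_mul_word_linear w : linear (left_mul_word ^~ w).
Proof.
move=> c x y; rewrite /left_mul_word scaler_sumr -big_split.
apply: eq_bigr => k _; rewrite ad_sum_linear scalerDr !scalerA.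
by rewrite [beta k * c]mulrC.
Qed.

(* Gutt's formula: on y^n this is the sum over k of
   (n choose k) B_k (ad y)^k (xi) y^(n - k). *)
Definition left_mul (xi : g) : symalg g -> symalg g := sym_lift (left_mul_word xi).

Lemma left_mul_is_linear xi : linear (left_mul xi).
Proof. exact/sym_lift_linear/left_mul_word_multilinear. Qed.

Lemma left_mulE xi w : left_mul xi (sym_word w) = left_mul_word xi w.
Proof.
by apply: sym_lift_word; [exact: left_mul_word_multilinear|exact: left_mul_word_symmetric].
Qed.


HB.instance Definition _ xi := GRing.isLinear.Build K (symalg g) (symalg g) _
  (left_mul xi) (left_mul_is_linear xi).

Lemma left_mul_linearl x : linear (left_mul ^~ x).
Proof.
move=> c a b; elim/sym_word_ind: x => [w||x y ax ay|d x ax].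
- by rewrite !left_mulE left_mul_word_linear.
- by rewrite !linear0 addr0.
- by rewrite !linearD /= ax ay addrACA.
- have Z e : left_mul e (d *: x) = d *: left_mul e x by exact: linearZ.
  by rewrite !Z ax scalerDr !scalerA mulrC.
Qed.

Lemma iter_ad0 k y : iter k (br y) 0 = 0.
Proof. by elim: k => [//|k IH] /=; rewrite IH br0r. Qed.

Lemma iter_adN k y x : iter k (br y) (- x) = - iter k (br y) x.
Proof. by elim: k => [//|k IH] /=; rewrite IH brN. Qed.

Lemma ad_sum_nseq k xi n y : ad_sum k xi (nseq n y) =
  (n ^_ k)%:R *: sym_word (iter k (br y) xi :: nseq (n - k) y).
Proof.
elim: k xi n => [|k IH] xi n; first by rewrite ffactn0 scale1r subn0.
rewrite [LHS]/= picks_nseq big_nseq iter_addr_0 /= IH -iterS iterSr.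
rewrite -[_ *+ n]scaler_nat scalerA -natrM -ffactnS.
by congr (_ *: sym_word (_ :: nseq _ _)); lia.
Qed.

(** Choosing a copy of y first gives [y, y] = 0, so the first letter chosen must be [b]. *)
Lemma ad_sum_self k y b m :
  ad_sum k.+1 y (b :: nseq m y) = ad_sum k (br b y) (nseq m y).
Proof.
rewrite /= big_cons big_map picks_nseq big_nseq iter_addr_0 /= brxx.
have -> : ad_sum k 0 (b :: nseq m.-1 y) = 0.
  have L := ad_sum_linear k (b :: nseq m.-1 y).
  by have := L (-1) 0 0; rewrite scaler0 addr0 scaleN1r addNr.
by rewrite mul0rn addr0.
Qed.

Lemma sym_word0 w : sym_word (0 :: w) = 0 :> symalg g.
Proof. exact: (multilinear0 [::] _ (@sym_word_multilinear K g)). Qed.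

Lemma sym_wordN x w : sym_word (- x :: w) = - sym_word (x :: w) :> symalg g.
Proof.
have := multilinearZ [::] w (-1) x (@sym_word_multilinear K g).
by rewrite !scaleN1r.
Qed.

Lemma left_mul_self n y : left_mul y (sym_word (nseq n y)) = sym_word (nseq n.+1 y).
Proof.
rewrite left_mulE /left_mul_word big_ord_recl beta0 scale1r big1 ?addr0 // => i _.
by rewrite ad_sum_nseq lift0 iterSr brxx iter_ad0 sym_word0 !scaler0.
Qed.

Lemma left_mul_nseq n xi y : left_mul xi (sym_word (nseq n y)) =
  \sum_(k < n.+1) (beta k * (n ^_ k)%:R) *:
    sym_word (iter k (br y) xi :: nseq (n - k) y).
Proof.
rewrite left_mulE /left_mul_word size_nseq; apply: eq_bigr => k _.
by rewrite ad_sum_nseq scalerA.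
Qed.

Lemma left_mul_cons_nseq m y b : left_mul y (sym_word (b :: nseq m y)) =
  sym_word (b :: nseq m.+1 y) - \sum_(i < m.+1) (beta i.+1 * (m ^_ i)%:R) *:
    sym_word (iter i.+1 (br y) b :: nseq (m - i) y).
Proof.
rewrite left_mulE /left_mul_word /= size_nseq big_ord_recl beta0 scale1r.
congr (_ + _); first exact/sym_word_symmetric/perm_swap.
rewrite -sumrN; apply: eq_bigr => i _; rewrite lift0 ad_sum_self ad_sum_nseq.
by rewrite brC iter_adN sym_wordN !scalerN scalerA -iterSr.
Qed.

(** * Vanishing of the commutator defect *)

Definition commutator_defect (xi eta : g) (x : symalg g) : symalg g :=
  left_mul xi (left_mul eta x) - left_mul eta (left_mul xi x)
  - left_mul (br xi eta) x.

Lemma sum_triangle (V : zmodType) n (F : nat -> nat -> V) :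
  \sum_(k < n) \sum_(i < n - k) F k (k + i)%N = \sum_(j < n) \sum_(k < j.+1) F k j.
Proof.
elim: n => [|n IH]; first by rewrite !big_ord0.
rewrite [RHS]big_ord_recr -IH /= big_ord_recr /= subSnn big_ord1 addn0.
rewrite [X in _ = _ + X]big_ord_recr /= addrA; congr (_ + _).
rewrite -big_split /=; apply: eq_bigr => k _.
by rewrite subSn ?big_ord_recr 1?ltnW //= subnKC // ltnW.
Qed.

(** All terms are expanded in e_j = (ad y)^j (xi) y^(n+1-j). With b_j for [beta j], the coefficient
    of e_(j+1) is n! / (n - j)! times (n + 1) b_(j+1) - (n - j) b_(j+1) + S_j + b_j, which is
    exactly the left side of [beta_euler]. *)
Lemma commutator_defect_gauge xi y n :
  commutator_defect xi y (sym_word (nseq n y)) = 0.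
Proof.
pose e j := sym_word (iter j (br y) xi :: nseq (n.+1 - j) y).
pose S j := \sum_(k < j.+1) beta k * beta (j.+1 - k).
rewrite /commutator_defect left_mul_self.
have -> : left_mul xi (sym_word (nseq n.+1 y)) =
    e 0%N + \sum_(j < n.+1) (beta j.+1 * (n.+1 ^_ j.+1)%:R) *: e j.+1.
  by rewrite left_mul_nseq big_ord_recl beta0 ffactn0 mulr1 scale1r subn0.
have -> : left_mul (br xi y) (sym_word (nseq n y)) =
    - \sum_(j < n.+1) (beta j * (n ^_ j)%:R) *: e j.+1.
  rewrite left_mul_nseq -sumrN; apply: eq_bigr => j _.
  by rewrite brC iter_adN sym_wordN scalerN -iterSr.
have -> : left_mul y (left_mul xi (sym_word (nseq n y))) =
    e 0%N + \sum_(j < n.+1) (beta j.+1 * (n ^_ j.+1)%:R) *: e j.+1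
    - \sum_(j < n.+1) (S j * (n ^_ j)%:R) *: e j.+1.
  rewrite left_mul_nseq linear_sum /=.
  transitivity (\sum_(k < n.+1) (beta k * (n ^_ k)%:R) *: e k -
      \sum_(k < n.+1) \sum_(i < n.+1 - k)
        (beta k * beta ((k + i).+1 - k) * (n ^_ (k + i))%:R) *: e (k + i).+1).
    rewrite -sumrB; apply: eq_bigr => k _; rewrite linearZ /= left_mul_cons_nseq.
    have lek : (k <= n)%N by rewrite -ltnS.
    rewrite scalerBr /e subSn //; congr (_ - _); rewrite scaler_sumr.
    apply: eq_bigr => i _; rewrite scalerA.
    have -> : (n ^_ (k + i))%:R = (n ^_ k)%:R * ((n - k) ^_ i)%:R :> K.
      rewrite -natrM; congr (_%:R); elim: (nat_of_ord i) => [|m IHm].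
        by rewrite addn0 ffactn0 muln1.
      by rewrite addnS !ffactnSr IHm mulnA subnDA.
    rewrite -iterD [(i.+1 + k)%N]addnC addnS subSS subnDA.
    have -> : ((k + i).+1 - k = i.+1)%N by lia.
    by congr (_ *: _); ring.
  rewrite (sum_triangle n.+1 (fun k j =>
    (beta k * beta (j.+1 - k) * (n ^_ j)%:R) *: e j.+1)).
  congr (_ - _); last first.
    by apply: eq_bigr => j _; rewrite /S mulr_suml scaler_suml.
  rewrite big_ord_recl beta0 ffactn0 mul1r scale1r; congr (_ + _).
  by rewrite [RHS]big_ord_recr /= ffact_small // mulr0 scale0r addr0.
rewrite opprK !opprD opprK !addrA (addrAC (e 0%N)) subrr add0r.
rewrite -sumrB -!big_split big1 //= => j _.
rewrite -scalerBl -!scalerDl [X in X *: _](_ : _ = 0) ?scale0r //.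
have lej : (j <= n)%N by rewrite -ltnS.
rewrite [(n.+1 ^_ _)%N]ffactnS [(n ^_ j.+1)%N]ffactnSr !natrM natrB //.
set F := (n ^_ j)%:R; have := beta_euler j; rewrite -/(S j) => E.
rewrite -[RHS](mul0r F) -E -!natr1; ring.
Qed.

Lemma lin_sub3 (V : lmodType K) c (p p' q q' r r' : V) :
  c *: p + p' - (c *: q + q') - (c *: r + r') =
  c *: (p - q - r) + (p' - q' - r').
Proof. by rewrite !scalerBr !opprD !addrA (ACl (1*3*5*2*4*6)). Qed.

Lemma commutator_defect_linear xi eta : linear (commutator_defect xi eta).
Proof.
move=> c x y; rewrite /commutator_defect.
have L e z z' : left_mul e (c *: z + z') = c *: left_mul e z + left_mul e z'.
  exact: linearP.
by rewrite !L lin_sub3.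
Qed.
HB.instance Definition _ xi eta := GRing.isLinear.Build K (symalg g) (symalg g) _
  (commutator_defect xi eta) (commutator_defect_linear xi eta).

Lemma commutator_defect_linearr xi x : linear (commutator_defect xi ^~ x).
Proof.
move=> c y z; rewrite /commutator_defect brr !left_mul_linearl.
have L e w w' : left_mul e (c *: w + w') = c *: left_mul e w + left_mul e w'.
  exact: linearP.
by rewrite !L lin_sub3.
Qed.

Lemma commutator_defectC xi eta x :
  commutator_defect eta xi x = - commutator_defect xi eta x.
Proof.
have L : left_mul (- br xi eta) x = - left_mul (br xi eta) x.
  have := left_mul_linearl x (-1) (br xi eta) 0.
  have := left_mul_linearl x (-1) 0 0.
  by rewrite !scaleN1r oppr0 !addr0 addNr => ->; rewrite addr0.
by rewrite /commutator_defect brC L opprK !opprD !opprK [X in X + _]addrC.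
Qed.

Section VanishingOnShortWords.
Variables (h : {linear symalg g -> symalg g}) (m : nat).
Hypothesis h0 : forall w, (size w <= m)%N -> h (sym_word w) = 0.

Lemma ad_sum_vanish k xi w : (size w < m)%N -> h (ad_sum k xi w) = 0.
Proof.
elim: k xi w => [|k IH] xi w lt; first exact: h0.
rewrite /= linear_sum big_seq big1 // => yv /picks_perm/perm_size /= E.
by apply: IH; rewrite (leq_ltn_trans _ lt) // -E.
Qed.

(** Up to products of at most [size w] factors, which [h] kills, [left_mul y] is multiplication by
    y. *)
Lemma left_mul_vanish y w : (size w <= m)%N ->
  h (left_mul y (sym_word w)) = h (sym_word (y :: w)).
Proof.
move=> le; rewrite left_mulE linear_sum big_ord_recl beta0 /= scale1r.
rewrite big1 ?addr0 // => i _; rewrite linearZ /= linear_sum big_seq big1 ?scaler0 //.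
move=> yv /picks_perm/perm_size /= E.
by apply: ad_sum_vanish; rewrite -E in le.
Qed.

End VanishingOnShortWords.

Lemma commutator_defect_word n w xi eta : size w = n ->
  commutator_defect xi eta (sym_word w) = 0.
Proof.
elim/ltn_ind: n w xi eta => -[|m] IH w xi eta sw.
  by rewrite (size0nil sw); exact: (commutator_defect_gauge xi eta 0).
pose D a b := commutator_defect a b.
have D0 a b v : (size v <= m)%N -> D a b (sym_word v) = 0 by move=> /IH; exact.
have comm v a b : (size v <= m)%N -> left_mul a (left_mul b (sym_word v)) =
    left_mul b (left_mul a (sym_word v)) + left_mul (br a b) (sym_word v).
  by move=> /D0 => /(_ a b)/eqP; rewrite /D /commutator_defect -addrA -opprD subr_eq0 => /eqP.
(* Under the defect the product y v may be replaced by L_y v. On short words the operators already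
   satisfy the commutation relations, so the cyclic sum of the defect over a, b, y cancels by the
   Jacobi identity. *)
have bianchi a b y v : (size v <= m)%N -> D a b (sym_word (y :: v)) =
    D a y (sym_word (b :: v)) - D b y (sym_word (a :: v)).
  have lv e f z u : (size u <= m)%N ->
      D e f (left_mul z (sym_word u)) = D e f (sym_word (z :: u)).
    exact: (@left_mul_vanish (commutator_defect e f) m (D0 e f)).
  move=> sv; rewrite -!lv // /D /commutator_defect.
  have LD e z z' : left_mul e (z + z') = left_mul e z + left_mul e z'.
    exact: linearD.
  have -> : left_mul a (left_mul b (left_mul y (sym_word v))) =
      left_mul a (left_mul y (left_mul b (sym_word v))) +
     (left_mul (br b y) (left_mul a (sym_word v)) +
      left_mul (br a (br b y)) (sym_word v)).
    by rewrite (comm v b y) // LD (comm v a (br b y)).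
  have -> : left_mul b (left_mul a (left_mul y (sym_word v))) =
      left_mul b (left_mul y (left_mul a (sym_word v))) +
     (left_mul (br a y) (left_mul b (sym_word v)) +
      left_mul (br b (br a y)) (sym_word v)).
    by rewrite (comm v a y) // LD (comm v b (br a y)).
  have -> : left_mul (br a b) (left_mul y (sym_word v)) =
      left_mul y (left_mul (br a b) (sym_word v)) +
     (left_mul (br a (br b y)) (sym_word v) - left_mul (br b (br a y)) (sym_word v)).
    rewrite (comm v (br a b) y) // jacobi; congr (_ + _).
    have := left_mul_linearl (sym_word v) (-1) (br b (br a y)) (br a (br b y)).
    by rewrite !scaleN1r [- br b _ + _]addrC => ->; rewrite addrC.
  have -> : left_mul y (left_mul a (left_mul b (sym_word v))) =
      left_mul y (left_mul b (left_mul a (sym_word v))) +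
      left_mul y (left_mul (br a b) (sym_word v)).
    by rewrite (comm v a b) // LD.
  rewrite !(opprD, opprK) !addrA.
  rewrite [LHS](ACl (1*2*4*5*7*3*8*6*9)) /= addrK subrK.
  by rewrite [RHS](ACl (1*7*5*4*3*2*6)) /= subrK.
have Dl a b : multilinear (fun v => D a b (sym_word v)).
  exact: (multilinear_comp (commutator_defect a b) (@sym_word_multilinear K g)).
have Ds a b : symmetric (fun v => D a b (sym_word v)).
  by move=> v v' /(@sym_word_symmetric K g) ->.
(* the first order term in c of D a (y + c b) (y + c b)^n = 0 *)
have polar a b y : m.+1%:R *: D a y (sym_word (b :: nseq m y)) =
    - D a b (sym_word (nseq m.+1 y)).
  pose A e i := 'C(m.+1, i)%:R *: D a e (sym_word (nseq i b ++ nseq (m.+1 - i) y)).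
  have := @poly_coef_eq0 K (symalg g) m.+3
    (fun i => A y i + if i is j.+1 then A b j else 0) _ 1%N.
  rewrite /A bin1 bin0 subn1 subn0 /= scale1r => H.
  apply/eqP; rewrite -addr_eq0; apply/eqP/H => // c {H}.
  rewrite -[RHS](commutator_defect_gauge a (y + c *: b) m.+1).
  rewrite addrC commutator_defect_linearr.
  under eq_bigr do rewrite scalerDr.
  rewrite big_split /= addrC; congr (_ + _).
    rewrite big_ord_recl scaler0 add0r [c *: b + y]addrC.
    have /= := multilinear_nseqD m.+1 b y c (Dl a b) (Ds a b).
    rewrite {1}/D => ->.
    by rewrite scaler_sumr; apply: eq_bigr => i _; rewrite [RHS]scalerA -exprS.
  rewrite [c *: b + y]addrC.
  have /= := multilinear_nseqD m.+1 b y c (Dl a y) (Ds a y).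
  rewrite {1}/D => ->.
  by rewrite big_ord_recr /= bin_small // scale0r scaler0 addr0.
apply: (polarization (Dl xi eta) (Ds xi eta) _ sw) => y.
set T := D xi eta _.
have E : T = D xi y (sym_word (eta :: nseq m y)) - D eta y (sym_word (xi :: nseq m y)).
  by apply: bianchi; rewrite size_nseq.
have TC : D eta xi (sym_word (nseq m.+1 y)) = - T by exact: commutator_defectC.
(* After multiplication by m + 1 each of the two terms contributes -T, the second by antisymmetry of
   the defect. *)
have : m.+1%:R *: T + 2%:R *: T = 0.
  rewrite {1}E scalerBr !polar TC opprK -/T scaler_nat mulr2n.
  by rewrite -opprD addNr.
move/eqP; rewrite -scalerDl scaler_eq0 -natrD pnatr_eq0.
by move/eqP.
Qed.

Lemma left_mul_commutator xi eta x :
  left_mul xi (left_mul eta x) =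
  left_mul eta (left_mul xi x) + left_mul (br xi eta) x.
Proof.
suff : commutator_defect xi eta x = 0.
  by move/eqP; rewrite /commutator_defect -addrA -opprD subr_eq0 => /eqP.
elim/sym_word_ind: x => [w||x y Dx Dy|c x Dx].
- exact: (commutator_defect_word (n := size w)).
- exact: linear0.
- by rewrite linearD /= Dx Dy addr0.
- by rewrite linearZ /= Dx scaler0.
Qed.

End LeftMultiplication.

(** * The Poincare-Birkhoff-Witt theorem *)

Section PoincareBirkhoffWitt.
Variables (K : numFieldType) (g : lmodType K) (br : g -> g -> g).
Hypothesis brP : lie_axioms br.

Definition word_eval (w : seq g) : symalg g := foldr (left_mul br) (sym_word [::]) w.

Let lmul_lin x c a b : left_mul br x (c *: a + b) = c *: left_mul br x a + left_mul br x b.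
Proof. exact: left_mul_is_linear. Qed.

Lemma word_eval_multilinear : multilinear word_eval.
Proof.
move=> s t c x y; rewrite /word_eval !foldr_cat /= left_mul_linearl //.
elim: s => [//|z s IH] /=; rewrite IH; exact: lmul_lin.
Qed.

Lemma word_eval_bracket s x y t : word_eval (s ++ [:: x, y & t]) =
  word_eval (s ++ [:: y, x & t]) + word_eval (s ++ br x y :: t).
Proof.
rewrite /word_eval !foldr_cat /= left_mul_commutator //.
elim: s => [//|z s IH] /=; rewrite IH.
by have L := lmul_lin z 1; rewrite -[X in X + _]scale1r L !scale1r.
Qed.

Lemma word_eval_respects : respects (envelop_rel br) word_eval.
Proof.
move=> s t a b [x y|c x|x y] /=.
- exact: multilinearD word_eval_multilinear.
- exact: multilinearZ word_eval_multilinear.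
- exact: word_eval_bracket.
Qed.

Definition envelop_eval : envelop br -> symalg g := lift word_eval.

Lemma envelop_eval_is_linear : linear envelop_eval.
Proof. exact/lift_is_linear/word_eval_respects. Qed.
HB.instance Definition _ := GRing.isLinear.Build K (envelop br) (symalg g) _
  envelop_eval envelop_eval_is_linear.

Lemma envelop_eval_word w : envelop_eval (envelop_word br w) = word_eval w.
Proof. exact/lift_word/word_eval_respects. Qed.

Lemma pbw_word w : pbw br (sym_word w) = symmetrize (envelop_word br) w.
Proof.
apply: sym_lift_word; last exact: symmetrize_symmetric.
exact/symmetrize_multilinear/envelop_word_multilinear.
Qed.

Lemma symmetrize_nseq (V : lmodType K) (f : seq g -> V) n y :
  symmetrize f (nseq n y) = f (nseq n y).
Proof.
rewrite -[RHS](sum_perm_const n) (symmetrizeE _ (size_nseq n y)).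
congr (_ *: _); apply: eq_bigr => sigma _; congr f.
have /all_pred1P -> : all (pred1 y) (permw sigma (nseq n y)).
  by rewrite (perm_all _ (permw_perm _ _)) ?size_nseq // all_pred1_nseq.
by rewrite size_permw.
Qed.

Lemma word_eval_nseq n y : word_eval (nseq n y) = sym_word (nseq n y).
Proof.
by elim: n => [//|n IH]; rewrite /= -/(word_eval _) IH left_mul_self.
Qed.

(** Both sides are symmetric and multilinear in the letters, and they agree on y^n because L_y y^n =
    y^(n+1). *)
Lemma pbwK : cancel (pbw br) envelop_eval.
Proof.
have idl : linear (@idfun (symalg g)) by [].
move=> x; rewrite -[RHS]/(idfun x) -[LHS]/((envelop_eval \o pbw br) x).
apply: eq_linear_sym => w /=; rewrite pbw_word; apply/eqP; rewrite -subr_eq0; apply/eqP.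
pose f w := envelop_eval (symmetrize (envelop_word br) w) - sym_word w.
apply: (polarization (f := f) (n := size w)) => // [||y].
- move=> s t c a b; rewrite /f.
  rewrite (symmetrize_multilinear (@envelop_word_multilinear K g br)) linearP.
  by rewrite sym_word_multilinear scalerBr opprD addrACA.
- move=> u v puv; rewrite /f (symmetrize_symmetric _ puv).
  by rewrite (sym_word_symmetric puv).
- by rewrite /f symmetrize_nseq envelop_eval_word word_eval_nseq subrr.
Qed.

(** Swapping two letters changes a word by a shorter one, on which the difference N vanishes by
    induction. On words of length m the difference is therefore symmetric and equals its value on
    the symmetrized word, an element of the image of [pbw], where [pbwK] applies. *)
Lemma envelop_evalK : cancel envelop_eval (pbw br).
Proof.
pose N u := u - pbw br (envelop_eval u).
have NP c u v : N (c *: u + v) = c *: N u + N v.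
  have E : pbw br (envelop_eval (c *: u + v)) =
      c *: pbw br (envelop_eval u) + pbw br (envelop_eval v) by rewrite !linearP.
  by rewrite /N E scalerBr opprD addrACA.
have ND u v : N (u + v) = N u + N v by have := NP 1 u v; rewrite !scale1r.
have N0 : N 0 = 0 by rewrite /N !linear0 ?addr0.
have NZ c u : N (c *: u) = c *: N u by have := NP c u 0; rewrite N0 !addr0.
suff NE u : N u = 0 by move=> u; apply/esym/eqP; rewrite -subr_eq0; apply/eqP/NE.
elim/word_ind: u => [w|//|u v Nu Nv|c u Nu]; last 2 first.
- by rewrite ND Nu Nv addr0.
- by rewrite NZ Nu scaler0.
rewrite -/(envelop_word br w); move: {2}(size w) (erefl (size w)) => m.
elim/ltn_ind: m w => m IH w sw.
(* The cut-off is there because [symmetric] concerns all sequences, while the induction hypothesis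
   controls swaps at length m only. *)
pose f v := if size v == m then N (envelop_word br v) else 0.
have fs : symmetric f.
  apply: perm_invariant_of_swap => u a b v; rewrite /f !size_cat /=.
  case: eqP => // Em.
  have -> : envelop_word br (u ++ [:: a, b & v]) =
      envelop_word br (u ++ [:: b, a & v]) + envelop_word br (u ++ br a b :: v).
    exact: (@word_respects K g (envelop_rel br) u v _ _ (envelop_relB br a b)).
  rewrite ND [X in _ + X](IH (size (u ++ br a b :: v))) ?addr0 //.
  by rewrite size_cat /=; lia.
have -> : N (envelop_word br w) = f w by rewrite /f sw eqxx.
rewrite -(symmetrize_id w fs).
have -> : symmetrize f w = N (symmetrize (envelop_word br) w).
  rewrite /symmetrize NZ; congr (_ *: _).
  rewrite (big_morph N ND N0); apply: eq_bigr => sigma _.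
  by rewrite /f size_permw; case: eqP => //; rewrite sw.
by rewrite -pbw_word /N pbwK subrr.
Qed.

(** Bijectivity leaves [pbw_inv] no choice. *)
Lemma pbw_invE u : pbw_inv u = envelop_eval u.
Proof.
apply: (can_inj pbwK); rewrite envelop_evalK /pbw_inv.
by apply: (@xgetPex _ 0 [set x | pbw br x = u]); exists (envelop_eval u);
  exact: envelop_evalK.
Qed.

(* the star product with deformation parameter 1 *)
Definition star1 (x y : symalg g) : symalg g := envelop_eval (pbw br x * pbw br y).

Lemma star1_linearl y : linear (star1 ^~ y).
Proof.
move=> c a b; rewrite /star1 -linearP; congr envelop_eval.
rewrite linearP mulrDl; congr (_ + _); symmetry; exact: pres_scaleAl.
Qed.

Lemma star1_linearr x : linear (star1 x).
Proof.
move=> c a b; rewrite /star1 -linearP; congr envelop_eval.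
rewrite linearP mulrDr; congr (_ + _); symmetry; exact: pres_scaleAr.
Qed.

Lemma star1A : associative star1.
Proof. by move=> x y z; rewrite /star1 !envelop_evalK mulrA. Qed.

Lemma pbw1 : pbw br (sym_word [::]) = 1.
Proof. by rewrite pbw_word (symmetrize_nseq _ 0 0). Qed.

Lemma star11x : left_id (sym_word [::]) star1.
Proof. by move=> x; rewrite /star1 pbw1 mul1r pbwK. Qed.

Lemma star1x1 : right_id (sym_word [::]) star1.
Proof. by move=> x; rewrite /star1 pbw1 mulr1 pbwK. Qed.

Lemma star1_word u v : star1 (sym_word u) (sym_word v) =
  symmetrize (fun u' => symmetrize (fun v' => word_eval (u' ++ v')) v) u.
Proof.
rewrite /star1 !pbw_word /symmetrize.
set a := _^-1; set b := _^-1.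
have -> : (a *: \sum_(sigma : 'S_(size u)) envelop_word br (permw sigma u)) *
  (b *: \sum_(sigma : 'S_(size v)) envelop_word br (permw sigma v)) =
  a *: \sum_(sigma : 'S_(size u)) (b *: \sum_(tau : 'S_(size v))
    envelop_word br (permw sigma u ++ permw tau v)).
  have Al c (x y : envelop br) : c *: (x * y) = c *: x * y by exact: pres_scaleAl.
  have Ar c (x y : envelop br) : c *: (x * y) = x * (c *: y) by exact: pres_scaleAr.
  rewrite -Al mulr_suml; congr (_ *: _); apply: eq_bigr => sigma _.
  rewrite -Ar mulr_sumr; congr (_ *: _); apply: eq_bigr => tau _.
  exact: pres_mul_word.
rewrite linearZ linear_sum /=; congr (_ *: _); apply: eq_bigr => sigma _.
rewrite linearZ linear_sum /=; congr (_ *: _); apply: eq_bigr => tau _.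
exact: envelop_eval_word.
Qed.

End PoincareBirkhoffWitt.

(** * Forests *)

Section Modulus.
Variables (R : realType) (F : base_field).
Local Notation K := (scalars R F).
Implicit Types c d : K.

Lemma modulus_ge0 c : 0 <= modulus c.
Proof. by case: F c => [c|[a b]] /=; rewrite ?normr_ge0 ?sqrtr_ge0. Qed.

Lemma modulus0 : modulus (0 : K) = 0.
Proof. by case: F => /=; [exact: normr0|exact: Normc.normc0]. Qed.

Lemma modulus1 : modulus (1 : K) = 1.
Proof. by case: F => /=; [exact: normr1|exact: Normc.normc1]. Qed.

Lemma modulusM c d : modulus (c * d) = modulus c * modulus d.
Proof. by case: F c d => c d; [exact: normrM|exact: Normc.normcM]. Qed.

Lemma modulusN c : modulus (- c) = modulus c.
Proof. by case: F c => c; [exact: normrN|exact: normcN]. Qed.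

Lemma modulus_le1 c : `|c| <= 1 -> modulus c <= 1.
Proof. by case: F c => [//|c]; rewrite lecE => /andP[_]. Qed.

Lemma modulusX c n : modulus (c ^+ n) = modulus c ^+ n.
Proof. by elim: n => [|n IH]; rewrite ?expr0 ?modulus1 // !exprS modulusM IH. Qed.

Lemma modulus_nat n : modulus (n%:R : K) = n%:R.
Proof.
case: F; first exact: normr_nat.
rewrite -[LHS]/(complex.Re `|n%:R : R[i]|) normr_nat.
by elim: n => [//|n IH]; rewrite -!natr1 -IH; case: (n%:R : R[i]).
Qed.

Lemma modulusV c : modulus c^-1 = (modulus c)^-1.
Proof. by case: F c => c; [exact: normfV|exact: Normc.normcV]. Qed.

End Modulus.

Section Forests.
Variables (R : realType) (F : base_field) (g : tvsType (scalars R F)).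
Local Notation K := (scalars R F).
Local Notation bracket_word := (bracket_word g).
Local Notation beta := (beta K).

HB.instance Definition _ := gen_eqMixin bracket_word.

(** The formal counterpart of [ad_sum]: k trees of the forest are bracketed onto [t] in all ordered
    ways, before any bracket is evaluated. *)
Fixpoint graft (k : nat) (t : bracket_word) (f : seq bracket_word) :
    seq (seq bracket_word) :=
  if k is k'.+1 then
    flatten [seq graft k' (BBracket yv.1 t) yv.2 | yv <- picks f]
  else [:: t :: f].

Definition grow (x : g) (cf : K * seq bracket_word) : seq (K * seq bracket_word) :=
  flatten [seq [seq (cf.1 * beta k, f) | f <- graft k (BLetter x) cf.2]
          | k <- index_iota 0 (size cf.2).+1].
Arguments grow : simpl never.

(* For every Lie bracket, the product of the letters of u in the enveloping
   algebra is the symmetrization of the sum of c f over the (c, f) in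
   [word_forests u], where f stands for the product of its trees. *)
Fixpoint word_forests (u : seq g) : seq (K * seq bracket_word) :=
  if u is x :: u' then flatten [seq grow x cf | cf <- word_forests u'] else [:: (1, [::])].

Definition forest_letters (f : seq bracket_word) : seq g :=
  flatten (map (@bracket_letters R F g) f).

Definition forest_word (br : g -> g -> g) (f : seq bracket_word) : symalg g :=
  sym_word (map (bracket_eval br) f).

Lemma forest_letters_perm f f' :
  perm_eq f f' -> perm_eq (forest_letters f) (forest_letters f').
Proof. by move=> pf; apply/perm_flatten/perm_map. Qed.

Lemma ad_sum_forest br k t f :
  ad_sum br k (bracket_eval br t) (map (bracket_eval br) f) =
  \sum_(f' <- graft k t f) forest_word br f'.
Proof.
elim: k t f => [|k IH] t f; first by rewrite big_seq1.
rewrite /= big_flatten /= picks_map !big_map; apply: eq_bigr => yv _.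
by rewrite -IH.
Qed.

Lemma word_eval_forests br u : lie_axioms br ->
  word_eval br u = \sum_(cf <- word_forests u) cf.1 *: forest_word br cf.2.
Proof.
move=> brP; elim: u => [|x u IH]; first by rewrite big_seq1 scale1r.
rewrite /= -/(word_eval br u) IH linear_sum /= big_flatten big_map.
apply: eq_bigr => cf _; rewrite linearZ /= left_mulE // big_flatten big_map.
rewrite /left_mul_word size_map big_mkord scaler_sumr; apply: eq_bigr => k _.
by rewrite (ad_sum_forest br k (BLetter x)) big_map !scaler_sumr; apply: eq_bigr => f _;
  rewrite scalerA.
Qed.

Lemma graft_letters k t f f' : f' \in graft k t f ->
  perm_eq (forest_letters f') (bracket_letters t ++ forest_letters f).
Proof.
elim: k t f => [|k IH] t f /=; first by rewrite inE => /eqP->.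
case/flattenP => s /mapP[yv /picks_perm pw ->] /IH pf'.
apply: (perm_trans pf') => /=; rewrite -catA perm_sym.
apply: perm_trans (_ : perm_eq (bracket_letters t ++ bracket_letters yv.1 ++ forest_letters yv.2) _).
  by rewrite perm_cat2l perm_sym (forest_letters_perm pw).
by rewrite perm_catCA.
Qed.

Lemma word_forests_letters u cf : cf \in word_forests u ->
  perm_eq (forest_letters cf.2) u.
Proof.
elim: u cf => [|x u IH] cf /=; first by rewrite inE => /eqP->.
case/flattenP => s /mapP[cf' /IH pu ->] /flattenP[s' /mapP[k _ ->]] /mapP[f ff ->] /=.
by rewrite (perm_trans (graft_letters ff)) //= perm_cons.
Qed.

(** The k chosen trees merge with [t] into a single tree, which joins the remaining [size f - k]
    ones. *)
Lemma graft_size k t f : (k <= size f)%N ->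
  size (graft k t f) = (size f ^_ k)%N /\
  forall f', f' \in graft k t f -> size f' = ((size f).+1 - k)%N.
Proof.
elim: k t f => [|k IH] t f lt /=.
  by split=> // f'; rewrite inE subn0 => /eqP->.
have H yv : yv \in picks f -> size yv.2 = (size f).-1.
  by move=> /picks_perm/perm_size <-.
have ltk : (k <= (size f).-1)%N by lia.
split.
  rewrite size_flatten /shape -map_comp sumnE big_map big_seq.
  rewrite (eq_bigr (fun=> ((size f).-1 ^_ k)%N)) => [|yv /H E /=]; last first.
    by rewrite (IH _ _ _).1 E.
  by rewrite -big_seq big_const_seq count_predT iter_addn_0 size_picks ffactnS mulnC.
move=> f' /flattenP[s /mapP[yv /H E ->]] f's.
by rewrite (IH (BBracket yv.1 t) yv.2 _).2 ?E //; lia.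
Qed.

Lemma bracket_letters_gt0 (t : bracket_word) : (0 < size (bracket_letters t))%N.
Proof. by elim: t => //= t1 h1 t2 _; rewrite size_cat addn_gt0 h1. Qed.

Lemma forest_size (f : seq bracket_word) : (size f <= size (forest_letters f))%N.
Proof.
elim: f => [//|t f IH]; rewrite /forest_letters /= size_cat.
by rewrite -add1n leq_add // bracket_letters_gt0.
Qed.

Lemma word_forests_size u cf : cf \in word_forests u -> (size cf.2 <= size u)%N.
Proof.
by move=> /word_forests_letters/perm_size <-; exact: forest_size.
Qed.

Lemma word_forests_size_gt0 u cf :
  cf \in word_forests u -> u != [::] -> (0 < size cf.2)%N.
Proof.
move=> /word_forests_letters; case: cf.2 => //=.
by rewrite /forest_letters /= perm_sym => /perm_nilP ->.
Qed.

Definition forest_weight (cf : K * seq bracket_word) : R :=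
  modulus cf.1 * (2 ^+ size cf.2 * (size cf.2)`!%:R).

(* The weights 2^r absorb the sum over k: grafting k of r trees gives
   r! / (r - k)! forests of r + 1 - k trees. *)
Lemma word_forests_weight u :
  \sum_(cf <- word_forests u) forest_weight cf <= 4 ^+ size u * (size u)`!%:R.
Proof.
elim: u => [|x u IH].
  by rewrite big_seq1 /forest_weight /= modulus1 !mulr1.
(* A new letter multiplies the total weight by at most 4 (|u| + 1); iterated, this is 4^m m!. *)
apply: (@le_trans _ _ (\sum_(cf <- word_forests u)
    4 * (size u).+1%:R * forest_weight cf)); last first.
  rewrite -mulr_sumr /= exprS factS natrM mulrACA ler_wpM2l // mulr_ge0 //.
rewrite /= big_flatten big_map big_seq [X in _ <= X]big_seq.
apply: ler_sum => cf /word_forests_size le; rewrite big_flatten big_map.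
have [r Er] : exists r, size cf.2 = r by exists (size cf.2).
rewrite Er in le *.
apply: (@le_trans _ _ (\sum_(0 <= k < r.+1)
   2 ^+ (r.+1 - k) * (modulus cf.1 * ((r`!)%:R * (size u).+1%:R)))).
  rewrite big_nat [X in _ <= X]big_nat; apply: ler_sum => k /andP[_ lek].
  rewrite ltnS -Er in lek; have [Sg Sf] := graft_size (BLetter x) lek.
  rewrite big_map big_seq.
  apply: (@le_trans _ _ (\sum_(f' <- graft k (BLetter x) cf.2)
     modulus cf.1 * (2 ^+ (r.+1 - k) * (r.+1 - k)`!%:R))).
    rewrite [X in _ <= X]big_seq; apply: ler_sum => f' /Sf E.
    rewrite /forest_weight /= E Er modulusM -mulrA ler_wpM2l ?modulus_ge0 //.
    by rewrite ler_piMl ?modulus_le1 ?beta_le1 // mulr_ge0 // exprn_ge0.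
  rewrite big_const_seq count_predT iter_addr_0 Sg -[X in X <= _]mulr_natl Er.
  rewrite mulrCA [X in _ <= X]mulrCA ler_wpM2l ?modulus_ge0 // mulrCA.
  rewrite ler_wpM2l ?exprn_ge0 // -!natrM ler_nat.
  (* Here r! / (r - k)! times (r - k + 1)! is (r - k + 1) r!, and r - k + 1 is at most |u| + 1. *)
  rewrite Er in lek; rewrite subSn // factS mulnCA mulnA [(_ * r ^_ k)%N]mulnC.
  rewrite -mulnA [((r - k).+1 * _)%N]mulnC mulnA ffact_fact // leq_mul // ltnS.
  exact: leq_trans (leq_subr _ _) le.
rewrite -mulr_suml /forest_weight Er.
have -> : 4 * (size u).+1%:R * (modulus cf.1 * (2 ^+ r * r`!%:R)) =
    4 * 2 ^+ r * (modulus cf.1 * (r`!%:R * (size u).+1%:R)) :> R by ring.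
rewrite ler_wpM2r ?mulr_ge0 ?modulus_ge0 //.
(* This geometric sum is the origin of the constant 4. *)
have -> : \sum_(0 <= k < r.+1) 2 ^+ (r.+1 - k) = 4 * 2 ^+ r - 2 :> R.
  elim: (r) => [|n IHn]; first by rewrite big_nat1 subn0 expr1 expr0; ring.
  rewrite big_nat_recl // subn0 IHn !exprS; ring.
by rewrite lerBlDr lerDl.
Qed.

Lemma bracket_eval_scale (br : g -> g -> g) (z : K) t : lie_axioms br ->
  bracket_eval (fun x y => z *: br x y) t =
  z ^+ (size (bracket_letters t)).-1 *: bracket_eval br t.
Proof.
case=> brl brr _ _.
have b0r x : br x 0 = 0.
  by have := brr (-1) x 0 0; rewrite scaler0 addr0 scaleN1r addNr.
have b0l x : br 0 x = 0.
  by have := brl (-1) 0 0 x; rewrite scaler0 addr0 scaleN1r addNr.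
have bl c x y : br (c *: x) y = c *: br x y.
  by have := brl c x 0 y; rewrite b0l !addr0.
have brz c x y : br x (c *: y) = c *: br x y.
  by have := brr c x y 0; rewrite b0r !addr0.
elim: t => [x|t1 IH1 t2 IH2] /=; first by rewrite scale1r.
rewrite IH1 IH2 bl brz !scalerA size_cat -!exprD -exprS; congr (z ^+ _ *: _).
by have := bracket_letters_gt0 t1; have := bracket_letters_gt0 t2; lia.
Qed.

(** A tree with l leaves has l - 1 brackets, so a forest with m leaves and r trees has m - r. *)
Lemma forest_word_scale (br : g -> g -> g) (z : K) f : lie_axioms br ->
  forest_word (fun x y => z *: br x y) f =
  z ^+ (size (forest_letters f) - size f) *: forest_word br f.
Proof.
move=> brP; rewrite /forest_word.
have S s : forall f, sym_word (s ++ map (bracket_eval (fun x y => z *: br x y)) f) =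
    z ^+ (size (forest_letters f) - size f) *: sym_word (s ++ map (bracket_eval br) f).
  move=> {}f; elim: f s => [|t f IH] s; first by rewrite scale1r.
  rewrite /= bracket_eval_scale // multilinearZ; last exact: sym_word_multilinear.
  rewrite -cat_rcons IH scalerA cat_rcons -exprD; congr (_ ^+ _ *: _).
  rewrite /forest_letters /= size_cat.
  have := bracket_letters_gt0 t; have := forest_size f; rewrite /forest_letters; lia.
exact: (S [::]).
Qed.

End Forests.

(** * The Gutt star product on symmetric tensors *)

Section GradedSums.
Variables (R : realType) (F : base_field) (g : tvsType (scalars R F)).
Local Notation K := (scalars R F).
Local Notation S := (symalg g).

Lemma sym_proj_large (x : S) : exists N, forall n, (N <= n)%N -> sym_proj n x = 0.
Proof.
have [N xN] := tensor_proj_large (sym_val x).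
by exists N => n /xN E; apply: val_inj; rewrite /= E.
Qed.

Lemma fsum_pairs (V : zmodType) (f : nat -> nat -> V) N M :
  (forall k l, (N <= k)%N -> f k l = 0) -> (forall k l, (M <= l)%N -> f k l = 0) ->
  \sum_(kl \in [set: nat * nat]) f kl.1 kl.2 = \sum_(k < N) \sum_(l < M) f k l.
Proof.
move=> fN fM; pose r := [seq (k, l) | k <- iota 0 N, l <- iota 0 M].
rewrite (@fsbigE _ _ _ _ _ r) //; first last.
- move=> [k l] _ nr /=; have [leN|ltN] := leqP N k; first exact: fN.
  have [leM|ltM] := leqP M l; first exact: fM.
  by case/negP: nr; apply: allpairs_f; rewrite mem_iota.
- by rewrite allpairs_uniq ?iota_uniq // => -[? ?] [? ?] _ _ /= [-> ->].
rewrite (eq_bigl xpredT); last by move=> i; rewrite in_setT.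
rewrite big_allpairs -(big_mkord xpredT (fun k => \sum_(l < M) f k l)).
rewrite /index_iota subn0; apply: eq_bigr => k _.
by rewrite -(big_mkord xpredT (fun l => f k l)) /index_iota subn0.
Qed.

(** The common shape of [gutt_coef] and [gutt_star]; through it both are reduced to homogeneous
    arguments. *)
Definition graded_sum (H : nat -> nat -> S -> S -> S) (x y : S) : S :=
  \sum_(kl \in [set: nat * nat])
    H kl.1 kl.2 (sym_proj kl.1 x) (sym_proj kl.2 y).

Lemma bilinear_map0l (U V W : lmodType K) (f : U -> V -> W) y :
  bilinear_map f -> f 0 y = 0.
Proof. by case=> fl _; have := fl (-1) 0 0 y; rewrite scaler0 addr0 scaleN1r addNr. Qed.

Lemma bilinear_map0r (U V W : lmodType K) (f : U -> V -> W) x :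
  bilinear_map f -> f x 0 = 0.
Proof. by case=> _ fr; have := fr (-1) x 0 0; rewrite scaler0 addr0 scaleN1r addNr. Qed.

Lemma bilinear_mapDl (U V W : lmodType K) (f : U -> V -> W) x x' y :
  bilinear_map f -> f (x + x') y = f x y + f x' y.
Proof. by case=> fl _; have := fl 1 x x' y; rewrite !scale1r. Qed.

Lemma bilinear_mapDr (U V W : lmodType K) (f : U -> V -> W) x y y' :
  bilinear_map f -> f x (y + y') = f x y + f x y'.
Proof. by case=> _ fr; have := fr 1 x y y'; rewrite !scale1r. Qed.

Lemma bilinear_mapZl (U V W : lmodType K) (f : U -> V -> W) c x y :
  bilinear_map f -> f (c *: x) y = c *: f x y.
Proof.
by move=> fL; have := fL.1 c x 0 y; rewrite (bilinear_map0l _ fL) !addr0.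
Qed.

Lemma bilinear_mapZr (U V W : lmodType K) (f : U -> V -> W) c x y :
  bilinear_map f -> f x (c *: y) = c *: f x y.
Proof.
by move=> fL; have := fL.2 c x y 0; rewrite (bilinear_map0r _ fL) !addr0.
Qed.

Section Bilinear.
Variable H : nat -> nat -> S -> S -> S.
Hypothesis HL : forall k l, bilinear_map (H k l).

Lemma graded_sumE x y N M : (forall n, (N <= n)%N -> sym_proj n x = 0) ->
  (forall n, (M <= n)%N -> sym_proj n y = 0) ->
  graded_sum H x y = \sum_(k < N) \sum_(l < M) H k l (sym_proj k x) (sym_proj l y).
Proof.
move=> xN yM.
apply: (@fsum_pairs _ (fun k l => H k l (sym_proj k x) (sym_proj l y))) => k l le.
  by rewrite xN ?bilinear_map0l.
by rewrite yM ?bilinear_map0r.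
Qed.

Lemma graded_sum_bilinear : bilinear_map (graded_sum H).
Proof.
split=> [c x x' y|c x y y'].
  have [N xN] := sym_proj_large x; have [N' xN'] := sym_proj_large x'.
  have [M yM] := sym_proj_large y; pose L := maxn N N'.
  have xL n : (L <= n)%N -> sym_proj n x = 0 by rewrite geq_max => /andP[/xN].
  have xL' n : (L <= n)%N -> sym_proj n x' = 0 by rewrite geq_max => /andP[_ /xN'].
  rewrite (graded_sumE xL yM) (graded_sumE xL' yM) (@graded_sumE _ _ L M) //; last first.
    by move=> n len; rewrite linearP /= xL // xL' // scaler0 addr0.
  rewrite scaler_sumr -big_split; apply: eq_bigr => k _.
  rewrite scaler_sumr -big_split; apply: eq_bigr => l _.
  by rewrite linearP (HL k l).1.
have [N yN] := sym_proj_large y; have [N' yN'] := sym_proj_large y'.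
have [M xM] := sym_proj_large x; pose L := maxn N N'.
have yL n : (L <= n)%N -> sym_proj n y = 0 by rewrite geq_max => /andP[/yN].
have yL' n : (L <= n)%N -> sym_proj n y' = 0 by rewrite geq_max => /andP[_ /yN'].
rewrite (graded_sumE xM yL) (graded_sumE xM yL') (@graded_sumE _ _ M L) //; last first.
  by move=> n len; rewrite linearP /= yL // yL' // scaler0 addr0.
rewrite scaler_sumr -big_split; apply: eq_bigr => k _.
rewrite scaler_sumr -big_split; apply: eq_bigr => l _.
by rewrite linearP (HL k l).2.
Qed.

Lemma graded_sum_word u v : graded_sum H (sym_word u) (sym_word v) =
  H (size u) (size v) (sym_word u) (sym_word v).
Proof.
rewrite (@graded_sumE _ _ (size u).+1 (size v).+1); first last.
- by move=> n lt; rewrite sym_proj_word; case: eqP => // E; rewrite E ltnn in lt.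
- by move=> n lt; rewrite sym_proj_word; case: eqP => // E; rewrite E ltnn in lt.
rewrite big_ord_recr /= big1 ?add0r => [|k _].
  rewrite big_ord_recr /= big1 ?add0r ?sym_proj_word ?eqxx // => l _.
  by rewrite [sym_proj l _]sym_proj_word gtn_eqF ?ltn_ord ?bilinear_map0r.
by rewrite big1 // => l _; rewrite sym_proj_word gtn_eqF ?ltn_ord ?bilinear_map0l.
Qed.

End Bilinear.

Lemma bilinear_map_eq (V : lmodType K) (f h : S -> S -> V) :
  bilinear_map f -> bilinear_map h ->
  (forall u v, f (sym_word u) (sym_word v) = h (sym_word u) (sym_word v)) ->
  forall x y, f x y = h x y.
Proof.
move=> fL hL fh x y; elim/sym_word_ind: x => [u||x x' IH IH'|c x IH].
- elim/sym_word_ind: y => [v//||y y' IH IH'|c y IH].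
  + by rewrite (bilinear_map0r _ fL) (bilinear_map0r _ hL).
  + by rewrite (bilinear_mapDr _ _ _ fL) (bilinear_mapDr _ _ _ hL) IH IH'.
  + by rewrite (bilinear_mapZr _ _ _ fL) (bilinear_mapZr _ _ _ hL) IH.
- by rewrite (bilinear_map0l _ fL) (bilinear_map0l _ hL).
- by rewrite (bilinear_mapDl _ _ _ fL) (bilinear_mapDl _ _ _ hL) IH IH'.
- by rewrite (bilinear_mapZl _ _ _ fL) (bilinear_mapZl _ _ _ hL) IH.
Qed.

Lemma bilinear_map_sum (I : Type) (r : seq I) (U V W : lmodType K)
    (f : I -> U -> V -> W) (c : I -> K) :
  (forall i, bilinear_map (f i)) ->
  bilinear_map (fun x y => \sum_(i <- r) c i *: f i x y).
Proof.
move=> fL; split=> [d x x' y|d x y y']; rewrite scaler_sumr -big_split;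
  apply: eq_bigr => i _; rewrite ?(fL i).1 ?(fL i).2 scalerDr !scalerA;
  by rewrite [c i * d]mulrC.
Qed.

Lemma fsum_nat (V : zmodType) (f : nat -> V) N : (forall n, (N <= n)%N -> f n = 0) ->
  \sum_(n \in [set: nat]) f n = \sum_(n < N) f n.
Proof.
move=> fN; rewrite fsbig_ord; apply/esym/fsbig_widen => // n [_ /= /negP].
by rewrite -leqNgt => /fN.
Qed.

Lemma fsum_family_bilinear (V : lmodType K) (C : nat -> S -> S -> V) (c : nat -> K) :
  (forall n, bilinear_map (C n)) ->
  (forall x y, exists N, forall n, (N <= n)%N -> C n x y = 0) ->
  bilinear_map (fun x y => \sum_(n \in [set: nat]) c n *: C n x y).
Proof.
move=> CL Cf; have E x y N : (forall n, (N <= n)%N -> C n x y = 0) ->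
    \sum_(n \in [set: nat]) c n *: C n x y = \sum_(n < N) c n *: C n x y.
  by move=> CN; apply: fsum_nat => n /CN ->; rewrite scaler0.
split=> [d x x' y|d x y y'].
  have [N xN] := Cf x y; have [N' xN'] := Cf x' y; pose M := maxn N N'.
  have xM n : (M <= n)%N -> C n x y = 0 by rewrite geq_max => /andP[/xN].
  have xM' n : (M <= n)%N -> C n x' y = 0 by rewrite geq_max => /andP[_ /xN'].
  rewrite (E _ _ _ xM) (E _ _ _ xM') (E _ _ M); last first.
    by move=> n le; rewrite (CL n).1 xM // xM' // scaler0 addr0.
  exact: (bilinear_map_sum _ _ (fun i : 'I_M => CL i)).1.
have [N xN] := Cf x y; have [N' xN'] := Cf x y'; pose M := maxn N N'.
have xM n : (M <= n)%N -> C n x y = 0 by rewrite geq_max => /andP[/xN].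
have xM' n : (M <= n)%N -> C n x y' = 0 by rewrite geq_max => /andP[_ /xN'].
rewrite (E _ _ _ xM) (E _ _ _ xM') (E _ _ M); last first.
  by move=> n le; rewrite (CL n).2 xM // xM' // scaler0 addr0.
exact: (bilinear_map_sum _ _ (fun i : 'I_M => CL i)).2.
Qed.

(** * The star product as a product for the rescaled bracket *)

Section Gutt.
Variable br : g -> g -> g.
Hypothesis brP : lie_axioms br.

Lemma scale_lie_axioms (z : K) : lie_axioms (fun x y => z *: br x y).
Proof.
case: brP => brl brr brxx J; split.
- by move=> c x x' y; rewrite brl scalerDr !scalerA mulrC.
- by move=> c x y y'; rewrite brr scalerDr !scalerA mulrC.
- by move=> x; rewrite brxx scaler0.
have brz x c y : br x (c *: y) = c *: br x y.
  have b0 : br x 0 = 0.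
    by have := brr (-1) x 0 0; rewrite scaler0 addr0 scaleN1r addNr.
  by have := brr c x y 0; rewrite b0 !addr0.
by move=> x y t; rewrite !brz !scalerA -!scalerDr J scaler0.
Qed.

Lemma star1_bilinear : bilinear_map (star1 br).
Proof.
by split=> [c x x' y|c x y y']; [exact: (star1_linearl brP y)|exact: (star1_linearr brP x)].
Qed.

Lemma gutt_homE n k l x y : gutt_hom br n k l x y =
  if (n <= k + l)%N then sym_proj (k + l - n) (star1 br x y) else 0.
Proof. by rewrite /gutt_hom pbw_invE. Qed.

Lemma gutt_hom_bilinear n k l : bilinear_map (gutt_hom br n k l).
Proof.
split=> *; rewrite !gutt_homE; case: ifP => _; rewrite ?scaler0 ?addr0 //.
  by rewrite star1_bilinear.1 linearP.
by rewrite star1_bilinear.2 linearP.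
Qed.

Lemma gutt_coef_bilinear n : bilinear_map (gutt_coef br n).
Proof. by apply: graded_sum_bilinear => k l; exact: gutt_hom_bilinear. Qed.

Lemma gutt_coef_word n u v : gutt_coef br n (sym_word u) (sym_word v) =
  if (n <= size u + size v)%N
  then sym_proj (size u + size v - n) (star1 br (sym_word u) (sym_word v)) else 0.
Proof.
rewrite -gutt_homE; apply: (graded_sum_word (H := gutt_hom br n)) => k l.
exact: gutt_hom_bilinear.
Qed.

Lemma sym_mul_bilinear : bilinear_map (@sym_mul K g).
Proof.
by split=> [c x x' y|c x y y']; [exact: (sym_mul_linearl y)|exact: (sym_mul_linearr x)].
Qed.

Lemma gutt_star_hom_bilinear z k l : bilinear_map (gutt_star_hom br z k l).
Proof.
rewrite /gutt_star_hom; case: eqP => _; first exact: sym_mul_bilinear.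
exact: (bilinear_map_sum _ _ (fun i : 'I_(k + l) => gutt_hom_bilinear i k l)).
Qed.

Lemma gutt_star_bilinear z : bilinear_map (gutt_star br z).
Proof. by apply: graded_sum_bilinear => k l; exact: gutt_star_hom_bilinear. Qed.

Lemma gutt_star_word z u v : gutt_star br z (sym_word u) (sym_word v) =
  gutt_star_hom br z (size u) (size v) (sym_word u) (sym_word v).
Proof.
apply: (graded_sum_word (H := gutt_star_hom br z)) => k l.
exact: gutt_star_hom_bilinear.
Qed.

(** The part of degree r <= m is multiplied by z^(m - r), the power counting the brackets that turn
    m letters into r trees. Nonnegative exponents keep z = 0 admissible. *)
Definition degree_twist (z : K) (m : nat) (x : S) : S :=
  \sum_(n < m.+1) z ^+ n *: sym_proj (m - n) x.

Lemma degree_twist_linear z m : linear (degree_twist z m).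
Proof.
move=> c x y; rewrite /degree_twist scaler_sumr -big_split; apply: eq_bigr => n _.
by rewrite linearP scalerDr !scalerA [c * _]mulrC.
Qed.
HB.instance Definition _ z m := GRing.isLinear.Build K S S _
  (degree_twist z m) (degree_twist_linear z m).

Lemma sym_proj_forest n f :
  sym_proj n (forest_word br f) = if size f == n then forest_word br f else 0.
Proof. by rewrite sym_proj_word size_map. Qed.

Lemma degree_twist_forest z m f : (size f <= m)%N ->
  degree_twist z m (forest_word br f) = z ^+ (m - size f) *: forest_word br f.
Proof.
move=> le; have lt : (m - size f < m.+1)%N by lia.
rewrite /degree_twist (bigD1 (Ordinal lt)) //= big1 ?addr0 => [|i ne].
  by rewrite sym_proj_forest subKn // eqxx.
rewrite sym_proj_forest; case: eqP => [E|]; last by rewrite scaler0.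
case/eqP: ne; apply: val_inj => /=; rewrite E subKn // -ltnS; exact: ltn_ord.
Qed.

Lemma word_eval_scale z u : word_eval (fun x y => z *: br x y) u =
  degree_twist z (size u) (word_eval br u).
Proof.
rewrite !word_eval_forests //; last exact: scale_lie_axioms.
rewrite linear_sum /= big_seq [RHS]big_seq; apply: eq_bigr => cf uf.
rewrite linearZ /= degree_twist_forest ?word_forests_size // forest_word_scale //.
by rewrite (perm_size (word_forests_letters uf)).
Qed.

Lemma word_eval_proj0 u : u != [::] -> sym_proj 0 (word_eval br u) = 0.
Proof.
move=> u0; rewrite word_eval_forests // linear_sum big_seq big1 // => cf uf.
rewrite linearZ /= sym_proj_forest gtn_eqF ?scaler0 //.
exact: word_forests_size_gt0 uf u0.
Qed.

Lemma linear_symmetrize (V W : lmodType K) (h : {linear V -> W}) (f : seq g -> V) u :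
  h (symmetrize f u) = symmetrize (h \o f) u.
Proof. by rewrite /symmetrize linearZ linear_sum. Qed.

Lemma eq_symmetrize (V : lmodType K) (f h : seq g -> V) u :
  (forall u', size u' = size u -> f u' = h u') -> symmetrize f u = symmetrize h u.
Proof.
move=> fh; congr (_ *: _); apply: eq_bigr => sigma _; apply: fh.
exact: size_permw.
Qed.

Lemma star1_scale_word z u v :
  star1 (fun x y => z *: br x y) (sym_word u) (sym_word v) =
  degree_twist z (size u + size v) (star1 br (sym_word u) (sym_word v)).
Proof.
rewrite !star1_word //; last exact: scale_lie_axioms.
rewrite linear_symmetrize; apply: eq_symmetrize => u' su' /=.
rewrite linear_symmetrize; apply: eq_symmetrize => v' sv' /=.
by rewrite word_eval_scale size_cat su' sv'.
Qed.

Lemma star1_proj0 u v : u ++ v != [::] ->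
  sym_proj 0 (star1 br (sym_word u) (sym_word v)) = 0.
Proof.
move=> uv0; rewrite star1_word // linear_symmetrize.
rewrite (@eq_symmetrize _ _ (fun=> 0)) ?symmetrize_id // => u' su' /=.
rewrite linear_symmetrize.
rewrite (@eq_symmetrize _ _ (fun=> 0)) ?symmetrize_id // => v' sv' /=.
rewrite word_eval_proj0 // -size_eq0 size_cat su' sv' -size_cat size_eq0 //.
Qed.

(** Associativity and the unit laws for every z follow from this form. In the definition n stops at
    k + l - 1, whereas [degree_twist] reaches n = k + l; the extra term has degree 0 and vanishes
    because a nonempty word yields no empty forest. *)
Lemma gutt_starE z x y :
  gutt_star br z x y = star1 (fun x y => z *: br x y) x y.
Proof.
have zP := scale_lie_axioms z.
apply: bilinear_map_eq.
- exact: gutt_star_bilinear.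
- by split=> *; [exact: (star1_linearl zP)|exact: (star1_linearr zP)].
move=> u v; rewrite gutt_star_word /gutt_star_hom; case: eqP => [/eqP|uv0].
  rewrite addn_eq0 !size_eq0 => /andP[/eqP-> /eqP->].
  by rewrite sym_mul_word star11x.
rewrite star1_scale_word /degree_twist big_ord_recr /= subnn star1_proj0; last first.
  by rewrite -size_eq0 size_cat; apply/eqP.
rewrite scaler0 addr0; apply: eq_bigr => n _.
by rewrite gutt_homE ltnW.
Qed.

Lemma gutt_coef_finite x y :
  exists N, forall n, (N <= n)%N -> gutt_coef br n x y = 0.
Proof.
elim/sym_word_ind: x => [u||x x' [N IH] [N' IH']|c x [N IH]].
- elim/sym_word_ind: y => [v||y y' [N IH] [N' IH']|c y [N IH]].
  + by exists (size u + size v).+1 => n ltn; rewrite gutt_coef_word leqNgt ltn.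
  + by exists 0%N => n _; rewrite (bilinear_map0r _ (gutt_coef_bilinear n)).
  + exists (maxn N N') => n; rewrite geq_max => /andP[/IH E /IH' E'].
    by rewrite (bilinear_mapDr _ _ _ (gutt_coef_bilinear n)) E E' addr0.
  + exists N => n /IH E.
    by rewrite (bilinear_mapZr _ _ _ (gutt_coef_bilinear n)) E scaler0.
- by exists 0%N => n _; rewrite (bilinear_map0l _ (gutt_coef_bilinear n)).
- exists (maxn N N') => n; rewrite geq_max => /andP[/IH E /IH' E'].
  by rewrite (bilinear_mapDl _ _ _ (gutt_coef_bilinear n)) E E' addr0.
- exists N => n /IH E.
  by rewrite (bilinear_mapZl _ _ _ (gutt_coef_bilinear n)) E scaler0.
Qed.

Lemma gutt_star_sum z x y :
  gutt_star br z x y = \sum_(n \in [set: nat]) z ^+ n *: gutt_coef br n x y.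
Proof.
move: x y; apply: (bilinear_map_eq (h := fun x y =>
  \sum_(n \in [set: nat]) z ^+ n *: gutt_coef br n x y)).
- exact: gutt_star_bilinear.
- exact: (fsum_family_bilinear _ gutt_coef_bilinear gutt_coef_finite).
move=> u v; rewrite gutt_starE star1_scale_word /degree_twist.
rewrite (@fsum_nat _ _ (size u + size v).+1) => [|n ltn]; last first.
  by rewrite gutt_coef_word leqNgt ltn scaler0.
by apply: eq_bigr => n _; rewrite gutt_coef_word -ltnS ltn_ord.
Qed.

(** For the zero bracket all terms with k >= 1 of Gutt's formula vanish, so words evaluate to their
    symmetric products. *)
Lemma gutt_star0 x y : gutt_star br 0 x y = sym_mul x y.
Proof.
apply: bilinear_map_eq.
- exact: gutt_star_bilinear.
- exact: sym_mul_bilinear.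
move=> u v; rewrite gutt_starE star1_word; last exact: scale_lie_axioms.
have zP := scale_lie_axioms 0.
have E w : word_eval (fun x y => 0 *: br x y) w = sym_word w.
  elim: w => [//|a w IH]; rewrite /= -/(word_eval _ w) IH left_mulE //.
  rewrite /left_mul_word big_ord_recl beta0 scale1r big1 ?addr0 // => i _.
  rewrite lift0 /= big1 ?scaler0 // => yv _; rewrite scale0r.
  have := ad_sum_linear zP i yv.2 (-1) 0 0.
  by rewrite scaler0 addr0 scaleN1r addNr.
rewrite sym_mul_word -[RHS](symmetrize_id (f := fun u' => sym_word (u' ++ v))).
  apply: eq_symmetrize => u' _.
  rewrite -[RHS](symmetrize_id (f := fun v' => sym_word (u' ++ v'))).
    by apply: eq_symmetrize => v' _; rewrite E.
  by move=> w w' pw; apply: sym_word_symmetric; rewrite perm_cat2l.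
by move=> w w' pw; apply: sym_word_symmetric; rewrite perm_cat2r.
Qed.

End Gutt.
End GradedSums.

(** * Seminorm estimates *)

Section Seminorms.
Variables (R : realType) (F : base_field).
Local Notation K := (scalars R F).

Section Generic.
Variables (V : lmodType K) (p : V -> R).

(* a seminorm up to the weaker form [p (c x) <= |c| p x] of homogeneity *)
Definition sub_seminorm : Prop :=
  (forall x y, p (x + y) <= p x + p y) /\ (forall c x, p (c *: x) <= modulus c * p x).

Hypothesis pS : sub_seminorm.

Lemma sub_seminorm_le0 : p 0 <= 0.
Proof. by have := pS.2 0 0; rewrite scale0r modulus0 mul0r. Qed.

Lemma sub_seminorm_sum (I : Type) (r : seq I) (f : I -> V) :
  p (\sum_(i <- r) f i) <= \sum_(i <- r) p (f i).
Proof.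
elim: r => [|i r IH]; first by rewrite !big_nil sub_seminorm_le0.
by rewrite !big_cons (le_trans (pS.1 _ _)) // lerD2l.
Qed.

Lemma sub_seminorm_comb (I : Type) (r : seq I) (c : I -> K) (f : I -> V) :
  p (\sum_(i <- r) c i *: f i) <= \sum_(i <- r) modulus (c i) * p (f i).
Proof.
apply: (le_trans (sub_seminorm_sum _ _)); apply: ler_sum => i _; exact: pS.2.
Qed.

End Generic.

Lemma seminorm0 (V : lmodType K) (p : V -> R) : seminorm p -> p 0 = 0.
Proof. by case=> pZ _; have := pZ 0 0; rewrite scale0r modulus0 mul0r. Qed.

Lemma seminorm_ge0 (V : lmodType K) (p : V -> R) x : seminorm p -> 0 <= p x.
Proof.
move=> pP; have := pP.2 x (- x); rewrite subrr (seminorm0 pP) -scaleN1r pP.1.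
by rewrite modulusN modulus1 mul1r => h; lra.
Qed.

Lemma sub_seminorm_family_sum (V : lmodType K) n (w : nat -> R) (p : nat -> V -> R) :
  (forall i, (i < n)%N -> 0 <= w i) ->
  (forall i, (i < n)%N -> sub_seminorm (p i)) ->
  sub_seminorm (fun x => \sum_(i < n) w i * p i x).
Proof.
move=> w0 pS; split=> [x y|c x].
  rewrite -big_split /=; apply: ler_sum => i _; rewrite -mulrDr ler_wpM2l ?w0 //.
  exact: (pS i _).1.
rewrite mulr_sumr; apply: ler_sum => i _; rewrite mulrCA ler_wpM2l ?w0 //.
exact: (pS i _).2.
Qed.

Lemma sub_seminorm_comp (V W : lmodType K) (p : W -> R) (h : V -> W) :
  linear h -> sub_seminorm p -> sub_seminorm (p \o h).
Proof.
move=> hL pS.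
have hD x y : h (x + y) = h x + h y by have := hL 1 x y; rewrite !scale1r.
have h0 : h 0 = 0 by have := hL (-1) 0 0; rewrite scaler0 addr0 scaleN1r addNr.
have hZ c x : h (c *: x) = c *: h x by have := hL c x 0; rewrite h0 !addr0.
by split=> [x y|c x] /=; rewrite ?hD ?hZ; [exact: pS.1|exact: pS.2].
Qed.

(** * Projective tensor powers of a seminorm *)

Section TensorSeminorm.
Variables (g : tvsType K) (p : g -> R) (n : nat).
Hypothesis pP : seminorm p.
Let p_ge0 x : 0 <= p x. Proof. exact: seminorm_ge0. Qed.

Definition tensor_comb (d : seq (K * n.-tuple g)) : tensor g :=
  \sum_(cw <- d) cw.1 *: tensor_word (cw.2 : seq g).

Definition comb_weight (d : seq (K * n.-tuple g)) : R :=
  \sum_(cw <- d) modulus cw.1 * \prod_(x <- cw.2) p x.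

Lemma prod_seminorm_ge0 (w : seq g) : 0 <= \prod_(x <- w) p x.
Proof. by apply: prodr_ge0 => x _; exact: p_ge0. Qed.

Lemma comb_weight_ge0 d : 0 <= comb_weight d.
Proof.
by apply: sumr_ge0 => cw _; rewrite mulr_ge0 ?modulus_ge0 ?prod_seminorm_ge0.
Qed.

Lemma tensor_comb_exists a : exists d, tensor_proj n a = tensor_comb d.
Proof.
elim/word_ind: a => [w||a b [d da] [d' db]|c a [d da]].
- rewrite [tensor_proj _ _]tensor_proj_word; case: eqP => [/eqP sw|_].
    by exists [:: (1, Tuple sw)]; rewrite /tensor_comb big_seq1 scale1r.
  by exists [::]; rewrite /tensor_comb big_nil.
- by exists [::]; rewrite /tensor_comb big_nil linear0.
- by exists (d ++ d'); rewrite linearD /= da db /tensor_comb big_cat.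
- exists [seq (c * cw.1, cw.2) | cw <- d].
  rewrite linearZ /= da /tensor_comb big_map scaler_sumr.
  by apply: eq_bigr => cw _; rewrite scalerA.
Qed.

Lemma proj_seminorm_le d : proj_seminorm p n (tensor_comb d) <= comb_weight d.
Proof.
apply: ge_inf; last by exists d.
by exists 0 => _ [d' [_ ->]]; exact: comb_weight_ge0.
Qed.

Lemma proj_seminorm_ge0 a : 0 <= proj_seminorm p n a.
Proof.
rewrite /proj_seminorm; set E := [set _ | _].
have [E0|/set0P nE] := eqVneq E set0; first by rewrite E0 inf0.
by apply: lb_le_inf => // _ [d' [_ ->]]; exact: comb_weight_ge0.
Qed.

(** The projection ensures that representations by words of length n exist, so that the infimum is
    approached. *)
Lemma proj_seminorm_adherent a e : 0 < e -> exists d,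
  tensor_proj n a = tensor_comb d /\
  comb_weight d < proj_seminorm p n (tensor_proj n a) + e.
Proof.
move=> e0; have [d dE] := tensor_comb_exists a.
have [|r [d' [d'E ->]] lt] := @inf_adherent R [set r | exists d,
    tensor_proj n a = tensor_comb d /\ r = comb_weight d] e e0.
  split; first by exists (comb_weight d), d.
  by exists 0 => _ [d' [_ ->]]; exact: comb_weight_ge0.
by exists d'.
Qed.

End TensorSeminorm.

Section SymSeminorm.
Variables (g : tvsType K) (rho : R).
Hypothesis rho1 : 1 <= rho.
Local Notation S := (symalg g).

Definition factr (n : nat) : R := n`!%:R `^ rho.

Lemma factr_ge0 n : 0 <= factr n. Proof. exact: powR_ge0. Qed.

Section OneSeminorm.
Variable p : g -> R.
Hypothesis pP : seminorm p.
Let p_ge0 x : 0 <= p x. Proof. exact: seminorm_ge0. Qed.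

Definition hom_seminorm n (x : S) : R := proj_seminorm p n (sym_val (sym_proj n x)).

Lemma hom_seminorm_sub n : sub_seminorm (hom_seminorm n).
Proof.
split=> [x y|c x].
  apply/ler_addgt0Pr => e e0.
  have [d [dE dlt]] := proj_seminorm_adherent n pP (sym_val x) (divr_gt0 e0 (ltr0Sn _ 1)).
  have [d' [dE' dlt']] := proj_seminorm_adherent n pP (sym_val y) (divr_gt0 e0 (ltr0Sn _ 1)).
  have := proj_seminorm_le pP (d ++ d').
  rewrite /tensor_comb /comb_weight !big_cat -/(tensor_comb d) -/(tensor_comb d').
  rewrite -/(comb_weight p d) -/(comb_weight p d') -dE -dE' /= => H.
  have -> : hom_seminorm n (x + y) =
      proj_seminorm p n (tensor_proj n (sym_val x) + tensor_proj n (sym_val y)).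
    by rewrite /hom_seminorm linearD.
  apply: (le_trans H); rewrite /hom_seminorm /=.
  move: dlt dlt'; lra.
apply/ler_addgt0Pr => e e0.
have m0 := modulus_ge0 c.
(* The 1 covers c = 0. *)
have e0' : 0 < e / (modulus c + 1) by rewrite divr_gt0 // ltr_wpDl.
have [d [dE dlt]] := proj_seminorm_adherent n pP (sym_val x) e0'.
have := proj_seminorm_le pP [seq (c * cw.1, cw.2) | cw <- d].
have -> : tensor_comb [seq (c * cw.1, cw.2) | cw <- d] = sym_val (sym_proj n (c *: x)).
  rewrite linearZ /= -[RHS]/(c *: tensor_proj n (sym_val x)) dE /tensor_comb big_map.
  by rewrite scaler_sumr; apply: eq_bigr => cw _; rewrite scalerA.
move=> H; apply: (le_trans H).
have -> : comb_weight p [seq (c * cw.1, cw.2) | cw <- d] = modulus c * comb_weight p d.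
  rewrite /comb_weight big_map mulr_sumr; apply: eq_bigr => cw _.
  by rewrite modulusM mulrA.
apply: (le_trans (ler_wpM2l m0 (ltW dlt))); rewrite mulrDr lerD2l mulrA.
by rewrite ler_pdivrMr ?ltr_wpDl // mulrDr mulr1 mulrC lerDl ltW.
Qed.

Lemma hom_seminorm_ge0 n x : 0 <= hom_seminorm n x.
Proof. exact: proj_seminorm_ge0. Qed.

(** The n! permuted words with coefficients 1 / n! form an explicit representation, all with the
    same product of seminorms. *)
Lemma hom_seminorm_word n (w : seq g) : hom_seminorm n (sym_word w) <=
  if size w == n then \prod_(x <- w) p x else 0.
Proof.
rewrite /hom_seminorm sym_proj_word; case: eqP => [<-|_]; last first.
  have := proj_seminorm_le pP ([::] : seq (K * n.-tuple g)).
  by rewrite /tensor_comb /comb_weight !big_nil.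
pose d := [seq ((((size w)`!)%:R^-1 : K), Tuple (introT eqP (size_permw sigma w))) |
           sigma : 'S_(size w)].
have := proj_seminorm_le pP d; rewrite /tensor_comb /comb_weight !big_image /=.
rewrite -scaler_sumr tensor_sym_word => /le_trans; apply.
rewrite (eq_bigr (fun=> ((size w)`!)%:R^-1 * \prod_(x <- w) p x)) => [|sigma _].
  rewrite sumr_const card_Sn -[X in X <= _]mulr_natl mulrA divff ?mul1r //.
by rewrite modulusV modulus_nat; congr (_ * _); apply: perm_big; exact: permw_perm.
Qed.

Lemma sym_seminormE x N : (forall n, (N <= n)%N -> sym_proj n x = 0) ->
  sym_seminorm rho p x = \sum_(n < N) factr n * hom_seminorm n x.
Proof.
move=> xN; apply: (@fsum_nat _ (fun n => factr n * hom_seminorm n x)) => n /xN E.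
have H0 : hom_seminorm n 0 = 0.
  apply: le_anti; rewrite hom_seminorm_ge0 andbT.
  exact: sub_seminorm_le0 (hom_seminorm_sub n).
by rewrite /hom_seminorm E; move: H0; rewrite /hom_seminorm linear0 => ->; rewrite mulr0.
Qed.

Lemma sym_seminorm_sub : sub_seminorm (sym_seminorm rho p).
Proof.
split=> [x y|c x].
  have [N xN] := sym_proj_large x; have [M yM] := sym_proj_large y.
  pose L := maxn N M.
  have xL n : (L <= n)%N -> sym_proj n x = 0 by rewrite geq_max => /andP[/xN].
  have yL n : (L <= n)%N -> sym_proj n y = 0 by rewrite geq_max => /andP[_ /yM].
  rewrite (sym_seminormE xL) (sym_seminormE yL) (@sym_seminormE _ L); last first.
    by move=> n le; rewrite linearD /= xL // yL // addr0.
  rewrite -big_split /=; apply: ler_sum => i _; rewrite -mulrDr.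
  by rewrite ler_wpM2l ?factr_ge0 // (hom_seminorm_sub i).1.
have [N xN] := sym_proj_large x.
rewrite (sym_seminormE xN) (@sym_seminormE _ N); last first.
  by move=> n le; rewrite linearZ /= xN // scaler0.
rewrite mulr_sumr; apply: ler_sum => i _; rewrite mulrCA.
by rewrite ler_wpM2l ?factr_ge0 // (hom_seminorm_sub i).2.
Qed.

Lemma sym_seminorm_ge0 x : 0 <= sym_seminorm rho p x.
Proof.
have [N xN] := sym_proj_large x; rewrite (sym_seminormE xN).
by apply: sumr_ge0 => i _; rewrite mulr_ge0 ?factr_ge0 ?hom_seminorm_ge0.
Qed.

Lemma sym_seminorm_word (w : seq g) :
  sym_seminorm rho p (sym_word w) <= factr (size w) * \prod_(x <- w) p x.
Proof.
rewrite (@sym_seminormE _ (size w).+1); last first.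
  by move=> n lt; rewrite sym_proj_word ltn_eqF.
rewrite big_ord_recr /= big1_seq ?add0r => [|i _]; last first.
  apply/le_anti; rewrite mulr_ge0 ?factr_ge0 ?hom_seminorm_ge0 // andbT.
  rewrite mulr_ge0_le0 ?factr_ge0 //; apply: le_trans (hom_seminorm_word _ _) _.
  by rewrite gtn_eqF.
rewrite ler_wpM2l ?factr_ge0 //; apply: le_trans (hom_seminorm_word _ _) _.
by rewrite eqxx.
Qed.

(** The universal property of projective seminorms: a bound on words passes to every representation
    by words, and nearly optimal ones give the claim in each degree. *)
Lemma sub_seminorm_bound (h : S -> R) (M : R) : 0 <= M -> sub_seminorm h ->
  (forall w, h (sym_word w) <= M * (factr (size w) * \prod_(x <- w) p x)) ->
  forall x, h x <= M * sym_seminorm rho p x.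
Proof.
move=> M0 hS hw x; have [N xN] := sym_proj_large x; rewrite (sym_seminormE xN).
have {1}-> : x = \sum_(n < N) sym_proj n x.
  apply: val_inj; rewrite [RHS]sym_val_sum; apply: tensor_proj_sum => n /xN E.
  by have := congr1 (@sym_val _ _) E.
apply: (le_trans (sub_seminorm_sum hS _ _)); rewrite mulr_sumr.
apply: ler_sum => n _; apply/ler_addgt0Pr => e e0.
set B := M * factr n; have B0 : 0 <= B by rewrite mulr_ge0 ?factr_ge0.
have e0' : 0 < e / (B + 1) by rewrite divr_gt0 // ltr_wpDl.
have [d [dE dlt]] := proj_seminorm_adherent n pP (sym_val x) e0'.
have -> : sym_proj n x = \sum_(cw <- d) cw.1 *: sym_word (cw.2 : seq g).
  apply: val_inj; rewrite [RHS]sym_val_sum [LHS]/= -[LHS](tensor_sym_id (sym_proj n x)).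
  rewrite [X in tensor_sym X]/= dE linear_sum; apply: eq_bigr => cw _.
  by rewrite linearZ.
apply: (le_trans (sub_seminorm_comb hS _ _ _)).
apply: (@le_trans _ _ (B * comb_weight p d)).
  rewrite /comb_weight mulr_sumr; apply: ler_sum => cw _.
  rewrite mulrCA ler_wpM2l ?modulus_ge0 // /B -mulrA.
  by have := hw cw.2; rewrite size_tuple.
apply: (le_trans (ler_wpM2l B0 (ltW dlt))).
rewrite mulrDr /hom_seminorm mulrA lerD2l.
by rewrite mulrA ler_pdivrMr ?ltr_wpDl // mulrDr mulr1 mulrC lerDl ltW.
Qed.

End OneSeminorm.

Lemma symmetrize_seminorm_le (h : S -> R) (f : seq g -> S) u B :
  sub_seminorm h -> (forall u', perm_eq u' u -> h (f u') <= B) ->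
  h (symmetrize f u) <= B.
Proof.
move=> hS fB; apply: (le_trans (hS.2 _ _)).
apply: (@le_trans _ _ (((size u)`!)%:R^-1 * \sum_(sigma : 'S_(size u)) B)).
  rewrite modulusV modulus_nat ler_wpM2l ?invr_ge0 //.
  apply: (le_trans (sub_seminorm_sum hS _ _)); apply: ler_sum => sigma _.
  by apply: fB; rewrite permw_perm.
rewrite sumr_const card_Sn -[X in _ * X <= _]mulr_natl mulrA mulVf ?mul1r //.
Qed.

(** * Estimate of the Gutt coefficients *)

Section Estimate.
Variables (br : g -> g -> g) (p q : g -> R) (w : R).
Hypotheses (brP : lie_axioms br) (pP : seminorm p) (qP : seminorm q).
Hypotheses (pq : asymptotic_estimate br p q) (w0 : 0 <= w).
Let p_ge0 x : 0 <= p x. Proof. exact: seminorm_ge0. Qed.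

(** The asymptotic estimate bounds each tree by the product over its leaves. As the forest has r <=
    m trees, m = [size u], and rho >= 1, also r!^rho <= r! m!^(rho - 1). *)
Lemma forest_word_seminorm (f : seq (bracket_word g)) u :
  perm_eq (forest_letters f) u ->
  sym_seminorm rho p (forest_word br f) <=
  (size f)`!%:R * (size u)`!%:R `^ (rho - 1) * \prod_(x <- u) q x.
Proof.
move=> fu; apply: (le_trans (sym_seminorm_word pP _)); rewrite size_map big_map.
have sfu : (size f <= size u)%N by rewrite -(perm_size fu) forest_size.
apply: ler_pM; rewrite ?factr_ge0 //.
- by apply: prodr_ge0 => t _.
- rewrite /factr -{1}[rho](subrK 1) addrC [_ `^ (1 + _)]powRD; last first.
    by apply/implyP => _; rewrite pnatr_eq0 -lt0n fact_gt0.
  rewrite powRr1 // ler_wpM2l //; apply: ge0_ler_powR; rewrite ?subr_ge0 ?nnegrE //.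
  by rewrite ler_nat leq_fact.
rewrite -(perm_big _ fu) /forest_letters big_flatten big_map.
by apply: ler_prod => t _; rewrite p_ge0 pq.
Qed.

(** On the product [star1] of two words of total length [m] this is the sum of the w^n p_rho(C_n),
    packed into one sub-seminorm that can be evaluated forest by forest. *)
Definition graded_seminorm N m (x : S) : R :=
  \sum_(n < N) w ^+ n *
    sym_seminorm rho p (if (n <= m)%N then sym_proj (m - n) x else 0).

Lemma graded_seminorm_sub N m : sub_seminorm (graded_seminorm N m).
Proof.
apply: (@sub_seminorm_family_sum _ N (fun n => w ^+ n) (fun n x =>
  sym_seminorm rho p (if (n <= m)%N then sym_proj (m - n) x else 0))) => n _.
  exact: exprn_ge0.
apply: (@sub_seminorm_comp _ _ (sym_seminorm rho p)
  (fun x => if (n <= m)%N then sym_proj (m - n) x else 0)).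
  by move=> c x y; case: ifP => _; rewrite ?linearP // scaler0 addr0.
exact: sym_seminorm_sub.
Qed.

Lemma sym_seminorm0 : sym_seminorm rho p 0 = 0.
Proof.
apply: le_anti; rewrite sym_seminorm_ge0 // andbT.
exact: sub_seminorm_le0 (sym_seminorm_sub pP).
Qed.

(** A forest is homogeneous, so at most n = m - [size f] contributes. The base 1 + w allows raising
    the exponent to m even when w < 1. *)
Lemma graded_seminorm_forest N m (f : seq (bracket_word g)) : (size f <= m)%N ->
  graded_seminorm N m (forest_word br f) <=
  (1 + w) ^+ m * sym_seminorm rho p (forest_word br f).
Proof.
move=> le; set s := sym_seminorm _ _ _.
have s0 : 0 <= s by exact: sym_seminorm_ge0.
have W1 : 1 <= 1 + w by rewrite lerDl.
have E n : sym_seminorm rho p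
    (if (n <= m)%N then sym_proj (m - n) (forest_word br f) else 0) =
    if n == (m - size f)%N then s else 0.
  case: ifP => [lenm|/negbT]; last first.
    rewrite -ltnNge => lt; rewrite sym_seminorm0 gtn_eqF //.
    exact: leq_ltn_trans (leq_subr _ _) lt.
  rewrite sym_proj_forest; have -> : (size f == m - n)%N = (n == m - size f)%N.
    by apply/eqP/eqP; lia.
  by case: eqP => // _; exact: sym_seminorm0.
rewrite /graded_seminorm; under eq_bigr do rewrite E.
have [ltN|leN] := ltnP (m - size f)%N N; last first.
  rewrite big1 ?mulr_ge0 ?exprn_ge0 ?addr_ge0 // => n _.
  by rewrite ltn_eqF ?mulr0 // (leq_trans (ltn_ord n)).
rewrite (bigD1 (Ordinal ltN)) //= eqxx big1 ?addr0 => [|n ne]; last first.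
  by rewrite -val_eqE /= in ne; rewrite (negbTE ne) mulr0.
rewrite ler_wpM2r //; apply: (@le_trans _ _ ((1 + w) ^+ (m - size f))).
  by rewrite lerXn2r ?nnegrE ?addr_ge0 // lerDr.
by rewrite ler_weXn2l // leq_subr.
Qed.

(** The r! of each forest joins its coefficient in the weight, whose total is at most 4^m m!, and m!
    m!^(rho - 1) = m!^rho; the factor 2^r >= 1 of the weight is discarded. *)
Lemma graded_seminorm_word_eval N u :
  graded_seminorm N (size u) (word_eval br u) <=
  (4 * (1 + w)) ^+ size u * factr (size u) * \prod_(x <- u) q x.
Proof.
rewrite word_eval_forests //.
apply: (le_trans (sub_seminorm_comb (graded_seminorm_sub N (size u)) _ _ _)).
pose A := (1 + w) ^+ size u * (size u)`!%:R `^ (rho - 1) * \prod_(x <- u) q x.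
have A0 : 0 <= A.
  by rewrite !mulr_ge0 ?exprn_ge0 ?addr_ge0 ?powR_ge0 // prod_seminorm_ge0.
apply: (@le_trans _ _ (A * \sum_(cf <- word_forests u) forest_weight cf)).
  rewrite mulr_sumr big_seq [X in _ <= X]big_seq; apply: ler_sum => cf uf.
  rewrite [X in _ <= X]mulrCA ler_wpM2l ?modulus_ge0 //.
  apply: (le_trans (graded_seminorm_forest _ (word_forests_size uf))).
  apply: (@le_trans _ _ (A * (size cf.2)`!%:R)); last first.
    rewrite ler_wpM2l // ler_peMl // exprn_ege1 //; lra.
  have -> : A * (size cf.2)`!%:R = (1 + w) ^+ size u *
     ((size cf.2)`!%:R * (size u)`!%:R `^ (rho - 1) * \prod_(x <- u) q x).
    by rewrite /A; ring.
  rewrite ler_wpM2l ?exprn_ge0 ?addr_ge0 //.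
  exact: forest_word_seminorm (word_forests_letters uf).
apply: (le_trans (ler_wpM2l A0 (word_forests_weight u))).
rewrite le_eqVlt; apply/orP; left; apply/eqP.
rewrite /A /factr -[in RHS](subrK 1 rho) [_ `^ (_ + 1)]powRD; last first.
  by apply/implyP => _; rewrite pnatr_eq0 -lt0n fact_gt0.
rewrite powRr1 // exprMn; ring.
Qed.

Lemma graded_seminorm_star1 N u v :
  graded_seminorm N (size u + size v) (star1 br (sym_word u) (sym_word v)) <=
  (4 * (1 + w)) ^+ (size u + size v) * factr (size u + size v) *
    (\prod_(x <- u) q x * \prod_(x <- v) q x).
Proof.
rewrite star1_word //.
have gS := graded_seminorm_sub N (size u + size v).
apply: (symmetrize_seminorm_le gS) => u' pu; apply: (symmetrize_seminorm_le gS) => v' pv.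
have := graded_seminorm_word_eval N (u' ++ v').
by rewrite size_cat (perm_size pu) (perm_size pv) big_cat /= (perm_big _ pu) (perm_big _ pv).
Qed.

(** The 4 comes from counting forests, 1 + w from the powers of the parameter, and 2^rho from
    splitting (k + l)!^rho between the two factors. *)
Definition estimate_const : R := 4 * (1 + w) * 2 `^ rho.

Lemma estimate_const_ge0 : 0 <= estimate_const.
Proof. by rewrite !mulr_ge0 ?powR_ge0 ?addr_ge0. Qed.

(** The binomial coefficient (k + l)! / (k! l!) is at most 2^(k+l). *)
Lemma factr_add k l : factr (k + l) <= (2 `^ rho) ^+ (k + l) * (factr k * factr l).
Proof.
have rho0 : 0 <= rho by exact: le_trans rho1.
have -> : (2 `^ rho) ^+ (k + l) = (2 ^+ (k + l)) `^ rho :> R.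
  by rewrite -powR_mulrn ?powR_ge0 // -powRrM mulrC powRrM powR_mulrn.
rewrite /factr -!powRM ?mulr_ge0 ?exprn_ge0 //.
apply: ge0_ler_powR; rewrite ?nnegrE ?mulr_ge0 ?exprn_ge0 //.
rewrite -natrX -!natrM ler_nat -(bin_fact (leq_addr l k)) addKn leq_mul //.
rewrite -[2%N]/(1 + 1)%N expnDn (bigD1 (inord k)) //= inordK ?ltnS ?leq_addr //.
by rewrite !exp1n !muln1 leq_addr.
Qed.

(** [sub_seminorm_bound], used once for each argument, reduces the claim to words; there the power
    of the constant is absorbed by rescaling [q], one factor per letter. *)
Lemma gutt_coef_estimate N x y :
  \sum_(n < N) w ^+ n * sym_seminorm rho p (gutt_coef br n x y) <=
  sym_seminorm rho (fun x => estimate_const * q x) x *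
  sym_seminorm rho (fun x => estimate_const * q x) y.
Proof.
set c := estimate_const; have c0 : 0 <= c by exact: estimate_const_ge0.
have cqP : seminorm (fun x => c * q x).
  split=> [d a|a b]; first by rewrite qP.1 mulrCA.
  by rewrite -mulrDr ler_wpM2l // qP.2.
have hS (f : nat -> S -> S) : (forall n, linear (f n)) ->
    sub_seminorm (fun x => \sum_(n < N) w ^+ n * sym_seminorm rho p (f n x)).
  move=> fL; apply: (@sub_seminorm_family_sum _ N (fun n => w ^+ n)
    (fun n x => sym_seminorm rho p (f n x))) => n _; first exact: exprn_ge0.
  exact: (sub_seminorm_comp (fL n) (sym_seminorm_sub pP)).
have gl n v : linear (gutt_coef br n ^~ v).
  by move=> d a b; exact: (gutt_coef_bilinear brP n).1.
have gr n u : linear (gutt_coef br n u).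
  by move=> d a b; exact: (gutt_coef_bilinear brP n).2.
have prodc (u : seq g) : \prod_(x <- u) (c * q x) = c ^+ size u * \prod_(x <- u) q x.
  by rewrite big_split /= big_const_seq count_predT iter_mulr_1.
have s0 := sym_seminorm_ge0 cqP.
apply: (sub_seminorm_bound cqP _ (hS (fun n => gutt_coef br n x) (fun n => gr n x))) => // v.
rewrite mulrC.
apply: (sub_seminorm_bound cqP _ (hS (fun n x => gutt_coef br n x (sym_word v))
  (fun n => gl n (sym_word v)))) => [|u].
  by rewrite mulr_ge0 ?factr_ge0 ?prod_seminorm_ge0.
rewrite /=; under eq_bigr do rewrite gutt_coef_word //.
apply: (le_trans (graded_seminorm_star1 N u v)); rewrite !prodc.
have P0 := prod_seminorm_ge0 qP.
apply: (le_trans (ler_wpM2r _ (ler_wpM2l _ (factr_add (size u) (size v))))).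
- by rewrite mulr_ge0.
- by rewrite exprn_ge0 // mulr_ge0 ?addr_ge0.
rewrite le_eqVlt; apply/orP; left; apply/eqP.
rewrite /c /estimate_const !exprD !exprMn; ring.
Qed.

End Estimate.
End SymSeminorm.
End Seminorms.

(** * Extension to the completion *)

Section DenseExtension.
Variables (T : Type) (X : topologicalType) (j : T -> X).
Hypothesis jD : dense (range j).

Lemma dense_meets (x : X) (U : set X) : nbhs x U -> exists t, U (j t).
Proof.
rewrite nbhsE => -[] O [] oO Ox OU.
have [|z [Oz [t _ tz]]] := jD _ oO; first by exists x.
by exists t; apply: OU; rewrite tz.
Qed.

Definition trace_nbhs (x : X) : set_system T :=
  filter_from (nbhs x) (fun U => j @^-1` U).

#[local] Instance trace_nbhs_filter (x : X) : ProperFilter (trace_nbhs x).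
Proof.
apply: filter_from_proper.
  apply: filter_from_filter; first by exists setT; exact: filterT.
  by move=> U V xU xV; exists (U `&` V) => //; exact: filterI.
by move=> U /dense_meets.
Qed.

Lemma trace_cvg (Y : topologicalType) (h : X -> Y) x :
  {for x, continuous h} -> h \o j @ trace_nbhs x --> h x.
Proof. by move=> hc A /hc xA; exists (h @^-1` A). Qed.

(** Estimates hold only for elements near x, so the closed condition is required just on the trace
    of a neighbourhood [O]. *)
Lemma closed_trace (Y : topologicalType) (h : X -> Y) x (A : set Y) (O : set X) :
  {for x, continuous h} -> closed A -> nbhs x O ->
  (forall t, O (j t) -> A (h (j t))) -> A (h x).
Proof.
move=> hc cA xO OA; apply: (closed_cvg A cA _ (h x) (trace_cvg hc)).
by exists O.
Qed.

Lemma dense_eq (Y : topologicalType) (h1 h2 : X -> Y) : hausdorff_space Y ->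
  continuous h1 -> continuous h2 -> (forall t, h1 (j t) = h2 (j t)) -> h1 =1 h2.
Proof.
move=> hY c1 c2 E x; apply: (@cvg_unique _ hY (h1 \o j @ trace_nbhs x)).
  exact: (trace_cvg (c1 x)).
rewrite /=; have -> : h1 \o j = h2 \o j by apply/funext.
exact: (trace_cvg (c2 x)).
Qed.

(** The limits along traces define the extension. It is continuous because [Y] is regular, and it
    restricts to [phi] because [Y] is Hausdorff. *)
Lemma dense_extension (Y : uniformType) (phi : T -> Y) : hausdorff_space Y ->
  (forall x, exists l : Y, phi @ trace_nbhs x --> l) ->
  exists2 h : X -> Y, continuous h & forall t, h (j t) = phi t.
Proof.
move=> hY /choice[h hP]; exists h.
  move=> x A /= /uniform_regular[B xB BA].
  have [U xU UB] := hP x B xB.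
  rewrite nbhsE in xU; case: xU => O [oO Ox] OU.
  suff: nbhs x (h @^-1` A) by [].
  rewrite nbhsE; exists O => // y Oy.
  apply: BA; apply: (closed_cvg (closure B) _ _ (h y) (hP y)).
    exact: closed_closure.
  by exists O; [exact: open_nbhs_nbhs|move=> t /OU/UB/subset_closure].
move=> t; apply: hY => A B /(hP (j t))[U xU UA] tB; exists (phi t); split.
  by apply: UA; exact: (nbhs_singleton xU).
exact: (nbhs_singleton tB).
Qed.

End DenseExtension.

Lemma dense_pair (S T : Type) (X Y : topologicalType) (i : S -> X) (j : T -> Y) :
  dense (range i) -> dense (range j) ->
  dense (range (fun ab : S * T => (i ab.1, j ab.2))).
Proof.
move=> iD jD O [[x y] Oxy] oO.
have := open_nbhs_nbhs (conj oO Oxy) => -[[U V] /= [xU yV] UVO].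
have [s Us] := dense_meets iD xU; have [t Vt] := dense_meets jD yV.
by exists (i s, j t); split; [exact: UVO|exists (s, t)].
Qed.

Section Completion.
Variables (R : realType) (F : base_field) (g : tvsType (scalars R F)) (rho : R).
Variables (E : tvsType (scalars R F)) (iota : symalg g -> E).
Local Notation K := (scalars R F).
Local Notation S := (symalg g).
Local Notation ss := (@sym_seminorm R F g rho).
Hypothesis hE : is_completion rho iota.

Lemma iota_linear : linear iota. Proof. by case: hE. Qed.

Lemma iotaD x y : iota (x + y) = iota x + iota y.
Proof. by have := iota_linear 1 x y; rewrite !scale1r. Qed.

Lemma iota0 : iota 0 = 0.
Proof. by have := iota_linear (-1) 0 0; rewrite scaler0 addr0 scaleN1r addNr. Qed.

Lemma iotaZ c x : iota (c *: x) = c *: iota x.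
Proof. by have := iota_linear c x 0; rewrite iota0 !addr0. Qed.

Lemma iotaB x y : iota (x - y) = iota x - iota y.
Proof. by rewrite -scaleN1r iotaD iotaZ scaleN1r. Qed.

Lemma iota_sum (I : Type) (r : seq I) (f : I -> S) :
  iota (\sum_(i <- r) f i) = \sum_(i <- r) iota (f i).
Proof. by apply: (big_morph iota iotaD iota0). Qed.

Lemma completion_hausdorff : hausdorff_space E. Proof. by case: hE => _ []. Qed.
Lemma completion_complete : complete_tvs E. Proof. by case: hE => _ []. Qed.
Lemma iota_dense : dense (range iota). Proof. by case: hE. Qed.

Let iota2 (ab : S * S) : E * E := (iota ab.1, iota ab.2).

Lemma iota2_dense : dense (range iota2).
Proof. exact: dense_pair iota_dense iota_dense. Qed.

Lemma nbhs0_ball (U : set E) : nbhs 0 U -> exists (p : g -> R) (e : R),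
  [/\ cont_seminorm p, 0 < e & forall a, ss p a < e -> U (iota a)].
Proof. by move=> U0; case: hE => _ _ _ /(_ (iota @^-1` U))[_]; apply; exists U. Qed.

Lemma ball_nbhs0 (p : g -> R) (e : R) : cont_seminorm p -> 0 < e ->
  exists2 U : set E, nbhs 0 U & forall a, U (iota a) -> ss p a < e.
Proof.
move=> pP e0; case: hE => _ _ _ /(_ [set a | ss p a < e])[H _].
by have [|U U0 HU] := H; [exists p, e|exists U].
Qed.

Lemma nbhs_diameter (x : E) (p : g -> R) (e : R) : cont_seminorm p -> 0 < e ->
  exists2 U : set E, nbhs x U &
    forall a b, U (iota a) -> U (iota b) -> ss p (a - b) < e.
Proof.
move=> pP e0; have [V V0 HV] := ball_nbhs0 pP e0.
have := @sub_continuous E (x, x) V; rewrite /= subrr => /(_ V0)[[U1 U2] /= [xU1 xU2] UV].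
exists (U1 `&` U2); first exact: filterI.
by move=> a b [a1 _] [_ b2]; apply: HV; rewrite iotaB; exact: (UV (iota a, iota b)).
Qed.

(** In a small neighbourhood the elements of the dense subspace differ from one fixed [a0] by less
    than 1. *)
Lemma nbhs_bounded (x : E) (p : g -> R) : cont_seminorm p ->
  exists (U : set E) (A : R), [/\ nbhs x U, 0 <= A & forall a, U (iota a) -> ss p a <= A].
Proof.
move=> pP; have [U xU HU] := nbhs_diameter x pP ltr01.
have [a0 Ua0] := dense_meets iota_dense xU.
have pS := seminorm_ge0 _ pP.1.
exists U, (1 + ss p a0); split => // [|a Ua].
  by rewrite addr_ge0 // sym_seminorm_ge0 //; exact: pP.1.
have := (sym_seminorm_sub rho pP.1).1 (a - a0) a0; rewrite subrK => /le_trans; apply.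
by rewrite lerD2r ltW ?HU.
Qed.

Lemma nbhs2_bounded (x y : E) (p : g -> R) : cont_seminorm p ->
  exists (O : set (E * E)) (A B : R), [/\ nbhs (x, y) O, 0 <= A, 0 <= B &
    forall a b, O (iota a, iota b) -> ss p a <= A /\ ss p b <= B].
Proof.
move=> pP; have [U [A [xU A0 UA]]] := nbhs_bounded x pP.
have [V [B [yV B0 VB]]] := nbhs_bounded y pP.
exists (U `*` V), A, B; split => //; first by exists (U, V).
by move=> a b [/= /UA ? /VB ?].
Qed.

Definition bounded_bilinear (f : S -> S -> S) : Prop :=
  bilinear_map f /\ forall p, cont_seminorm p -> exists2 q, cont_seminorm q &
    forall a b, ss p (f a b) <= ss q a * ss q b.

(** The values of [f] along the trace of (x, y) form a Cauchy filter: f a b - f a' b' is split as f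
    (a - a') b + f a' (b - b'), and the seminorms stay bounded near x and y. *)
Lemma bounded_bilinear_extension f : bounded_bilinear f ->
  exists h, is_cont_extension iota f h.
Proof.
move=> [fL fB].
have fDl a b c : f (a - b) c = f a c - f b c.
  by rewrite -scaleN1r (bilinear_mapDl _ _ _ fL) (bilinear_mapZl _ _ _ fL) scaleN1r.
have fDr a b c : f a (b - c) = f a b - f a c.
  by rewrite -scaleN1r (bilinear_mapDr _ _ _ fL) (bilinear_mapZr _ _ _ fL) scaleN1r.
have [[x y]|h hc hf] := dense_extension iota2_dense (phi := fun ab => iota (f ab.1 ab.2))
    completion_hausdorff.
  apply: completion_complete.
    exact: (@fmap_proper_filter _ _ _ _ (trace_nbhs_filter iota2_dense (x, y))).
  move=> W /nbhs0_ball[p [e [pP e0 HW]]]; have [q qP Hq] := fB p pP.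
  have [N [A [B [xyN A0 B0 NAB]]]] := nbhs2_bounded x y qP.
  (* The two summands then give d B + A d < e; the 1 keeps the denominator positive. *)
  pose d := e / (A + B + 1).
  have AB1 : 0 < A + B + 1 by rewrite ltr_wpDl ?addr_ge0.
  have d0 : 0 < d by rewrite divr_gt0.
  have [U xU HU] := nbhs_diameter x qP d0; have [V yV HV] := nbhs_diameter y qP d0.
  pose Q := N `&` (U `*` V).
  exists ((fun ab => iota (f ab.1 ab.2)) @` (iota2 @^-1` Q)).
    exists Q; last by move=> ab Qab; exists ab.
    by apply: filterI => //; exists (U, V).
  move=> _ _ [[a b] /= [Nab [/= Ua Vb]] <-] [[a' b'] /= [Nab' [/= Ua' Vb']] <-] /=.
  rewrite -iotaB; apply: HW.
  have -> : f a b - f a' b' = f (a - a') b + f a' (b - b').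
    by rewrite fDl fDr addrA subrK.
  have [qa qb] := NAB _ _ Nab; have [qa' qb'] := NAB _ _ Nab'.
  have q0 := sym_seminorm_ge0 rho qP.1.
  apply: (le_lt_trans ((sym_seminorm_sub rho pP.1).1 _ _)).
  apply: (@le_lt_trans _ _ (d * B + A * d)).
    apply: lerD; apply: (le_trans (Hq _ _)); apply: ler_pM => //; apply: ltW.
      exact: HU.
    exact: HV.
  rewrite [A * d]mulrC -mulrDr /d mulrAC ltr_pdivrMr // ltr_pM2l //.
  by rewrite addrC ltrDl.
exists (fun x y => h (x, y)); split; last by move=> a b; exact: (hf (a, b)).
by have -> : (fun xy : E * E => h (xy.1, xy.2)) = h by apply/funext => -[].
Qed.

Lemma cont_extensionP f : bounded_bilinear f ->
  is_cont_extension iota f (cont_extension iota f).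
Proof. by move=> /bounded_bilinear_extension; exact: xgetPex. Qed.


Lemma modulus_surj (t : R) : 0 <= t -> exists c : K, modulus c = t.
Proof.
move=> t0; case: F; first by exists t; exact: ger0_norm.
exists (t%:C)%C; rewrite -[LHS]/(complex.Re `|(t%:C)%C|) normc_def /=.
by rewrite expr0n /= addr0 sqrtr_sqr ger0_norm.
Qed.

(** Homogeneity turns the inclusion of a ball of p_rho in the unit ball of [Q] into an inequality of
    seminorms. *)
Lemma seminorm_completion_bound (Q : E -> R) : cont_seminorm Q ->
  exists (p : g -> R) (e : R), [/\ cont_seminorm p, 0 < e &
    forall a, Q (iota a) <= ss p a / e].
Proof.
move=> [QP Qc].
have : nbhs (0 : E) [set x | Q x < 1].
  have := Qc 0 [set r | r < 1]; apply.
  by rewrite (seminorm0 QP); exact: (open_nbhs_nbhs (conj (@open_lt R 1) ltr01)).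
move=> /nbhs0_ball[p [e [pP e0 H]]]; exists p, e; split=> // a.
rewrite ler_pdivlMr //; apply/ler_addgt0Pr => d d0.
have s0 := sym_seminorm_ge0 rho pP.1 a.
have sd0 : 0 < ss p a + d by rewrite ltr_wpDl.
have [c cE] := modulus_surj (ltW (divr_gt0 e0 sd0)).
have : Q (iota (c *: a)) < 1.
  apply: H; apply: (le_lt_trans ((sym_seminorm_sub rho pP.1).2 _ _)).
  by rewrite cE mulrAC ltr_pdivrMr // ltr_pM2l // ltrDl.
rewrite iotaZ QP.1 cE mulrAC ltr_pdivrMr // mul1r mulrC; exact: ltW.
Qed.

(** What the Gutt coefficients share with their re-expansions at any z0. The bound is demanded for
    every radius [w], which leaves room to enlarge the radius. *)
Definition entire_family (C : nat -> S -> S -> S) : Prop :=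
  [/\ forall n, bilinear_map (C n),
      forall a b, exists N, forall n, (N <= n)%N -> C n a b = 0 &
      forall p (w : R), cont_seminorm p -> 0 <= w -> exists2 q, cont_seminorm q &
        forall N a b, \sum_(n < N) w ^+ n * ss p (C n a b) <= ss q a * ss q b].

Definition family_sum (C : nat -> S -> S -> S) (z : K) (a b : S) : S :=
  \sum_(n \in [set: nat]) z ^+ n *: C n a b.

Lemma family_sumE C z a b N : (forall n, (N <= n)%N -> C n a b = 0) ->
  family_sum C z a b = \sum_(n < N) z ^+ n *: C n a b.
Proof.
move=> CN; apply: (fsum_nat (f := fun n => z ^+ n *: C n a b)) => n /CN ->.
exact: scaler0.
Qed.

Lemma entire_family_bounded C n : entire_family C -> bounded_bilinear (C n).
Proof.
case=> CL Cf CB; split=> // p pP; have [q qP Hq] := CB p 1 pP ler01.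
exists q => // a b; apply: le_trans (Hq n.+1 a b).
rewrite big_ord_recr /= expr1n mul1r lerDr; apply: sumr_ge0 => i _.
by rewrite expr1n mul1r sym_seminorm_ge0 //; exact: pP.1.
Qed.

Lemma family_sum_bounded C z : entire_family C -> bounded_bilinear (family_sum C z).
Proof.
case=> CL Cf CB; split; first exact: fsum_family_bilinear.
move=> p pP; have [q qP Hq] := CB p (modulus z) pP (modulus_ge0 z).
exists q => // a b; have [N CN] := Cf a b; apply: le_trans (Hq N a b).
rewrite (family_sumE _ CN).
apply: (le_trans (sub_seminorm_comb (sym_seminorm_sub rho pP.1) _ _ _)).
by apply: ler_sum => n _; rewrite modulusX.
Qed.

Lemma continuous_comp2 (X : topologicalType) (h : E -> E -> E) (f1 f2 : X -> E) :
  continuous (fun xy : E * E => h xy.1 xy.2) -> continuous f1 -> continuous f2 ->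
  continuous (fun x => h (f1 x) (f2 x)).
Proof.
move=> hc c1 c2 x; apply: (@continuous2_cvg _ _ _ _ (nbhs x) _ f1 f2 h (f1 x) (f2 x)); first exact: (hc (_, _)).
  exact: c1.
exact: c2.
Qed.

Lemma continuous_addE (X : topologicalType) (f1 f2 : X -> E) :
  continuous f1 -> continuous f2 -> continuous (fun x => f1 x + f2 x).
Proof. by apply: (continuous_comp2 (h := +%R)); exact: add_continuous. Qed.

Lemma continuous_scaleE (X : topologicalType) (c : K) (f : X -> E) :
  continuous f -> continuous (fun x => c *: f x).
Proof.
move=> fc x; apply: (@continuous2_cvg _ K^o E E (nbhs x) _ (fun=> c) f *:%R c (f x)).
- exact: (scale_continuous (c, f x)).
- exact: cvg_cst.
- exact: fc.
Qed.

Lemma continuous_sumE (X : topologicalType) N (f : nat -> X -> E) :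
  (forall n, continuous (f n)) -> continuous (fun x => \sum_(n < N) f n x).
Proof.
move=> fc; elim: N => [|N IH] x.
  rewrite (_ : (fun x => _) = fun=> 0); first exact: cvg_cst.
  by apply/funext => y; rewrite big_ord0.
rewrite (_ : (fun x => _) = fun x => \sum_(n < N) f n x + f N x); last first.
  by apply/funext => y; rewrite big_ord_recr.
exact: continuous_addE.
Qed.

(** * Convergence of entire families *)

Section EntireSum.
Variables (C : nat -> S -> S -> S) (Ch : nat -> E -> E -> E) (z : K) (fh : E -> E -> E).
Hypothesis CP : entire_family C.
Hypothesis ChP : forall n, is_cont_extension iota (C n) (Ch n).
Hypothesis fhP : is_cont_extension iota (family_sum C z) fh.

(** The partial sums are nondecreasing, so boundedness suffices: on dense pairs near (x, y) they are
    at most A B / e, a closed condition that passes to (x, y). *)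
Lemma entire_family_abs_summable x y : abs_summable (fun n => z ^+ n *: Ch n x y).
Proof.
move=> Q QP; have [p [e [pP e0 Qp]]] := seminorm_completion_bound QP.
have [_ _ CB] := CP.
have [q qP Hq] := CB p (modulus z) pP (modulus_ge0 z).
have [N [A [B [xyN A0 B0 NAB]]]] := nbhs2_bounded x y qP.
have q0 := sym_seminorm_ge0 rho qP.1.
have Qge0 v : 0 <= Q v by apply: seminorm_ge0; exact: QP.1.
apply: nondecreasing_is_cvgn.
  apply/nondecreasing_seqP => n; rewrite /series /= big_nat_recr //= lerDl.
  exact: Qge0.
exists (A * B / e) => _ [n _ <-]; rewrite /series /= big_mkord.
pose G (xy : E * E) := \sum_(k < n) Q (z ^+ k *: Ch k xy.1 xy.2).
have Gc : continuous G.
  rewrite /G; elim: (n) => [|m IH] xy.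
    rewrite (_ : (fun xy => _) = fun=> 0); first exact: cvg_cst.
    by apply/funext => v; rewrite big_ord0.
  rewrite (_ : (fun xy => _) = fun xy => \sum_(k < m) Q (z ^+ k *: Ch k xy.1 xy.2) +
    Q (z ^+ m *: Ch m xy.1 xy.2)); last by apply/funext => v; rewrite big_ord_recr.
  apply: cvgD; first exact: IH.
  apply: (@continuous_comp _ _ _ (fun xy : E * E => z ^+ m *: Ch m xy.1 xy.2) Q).
    by apply: continuous_scaleE; have [] := ChP m.
  exact: QP.2.
apply: (closed_trace (j := iota2) iota2_dense (h := G) (x := (x, y))
  (A := [set r | r <= A * B / e]) (O := N)).
- exact: (Gc (x, y)).
- exact: closed_le.
- exact: xyN.
move=> [a b] /NAB[/= qa qb].
apply: (@le_trans _ _ ((ss q a * ss q b) / e)); last first.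
  by rewrite ler_pM2r ?invr_gt0 //; apply: ler_pM.
apply: (@le_trans _ _ ((\sum_(k < n) modulus z ^+ k * ss p (C k a b)) / e)); last first.
  by rewrite ler_pM2r ?invr_gt0.
rewrite /G mulr_suml; apply: ler_sum => k _ /=.
have [_ ->] := ChP k; rewrite QP.1.1 modulusX -mulrA ler_wpM2l ?Qp //.
by rewrite exprn_ge0 ?modulus_ge0.
Qed.

(** The tail from n on is at most A B / 2^n for all dense pairs in one neighbourhood [N] of (x, y);
    this uniformity lets the estimate pass to (x, y). *)
Lemma entire_family_cvg x y : series (fun n => z ^+ n *: Ch n x y) @ \oo --> fh x y.
Proof.
move=> U /= Ul.
pose V := [set v : E | U (fh x y + v)].
have V0 : nbhs (0 : E) V.
  have := @add_continuous E (fh x y, 0) U; rewrite /= addr0 => /(_ Ul)[[U1 U2] /= [xU1 xU2] UV].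
  apply: filterS xU2 => v U2v; apply: (UV (fh x y, v)); split => //=.
  exact: nbhs_singleton.
(* In the limit only the closure of the neighbourhood reached on dense pairs is attained, hence a
   smaller one with closure in [V]. *)
have [V' V'0 V'V] := @uniform_regular E 0 V V0.
have [p [e [pP e0 HV']]] := nbhs0_ball V'0.
have [CL Cf CB] := CP.
have w0 : 0 <= 2 * modulus z by rewrite mulr_ge0 ?modulus_ge0.
have [q qP Hq] := CB p _ pP w0.
have [N [A [B [xyN A0 B0 NAB]]]] := nbhs2_bounded x y qP.
have q0 := sym_seminorm_ge0 rho qP.1.
(* Any n0 > A B / e will do, because n <= 2^n. *)
have [n0 n0P] : exists n0, forall n, (n0 <= n)%N -> A * B / 2 ^+ n < e.
  have [n0 n0lt] : exists n0 : nat, A * B / e < n0%:R.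
    exists (Num.bound (A * B / e)); have := archi_boundP (divr_ge0 (mulr_ge0 A0 B0) (ltW e0)).
    exact.
  exists n0 => n len; rewrite ltr_pdivrMr ?exprn_gt0 // [e * _]mulrC -ltr_pdivrMr //.
  apply: (lt_le_trans n0lt); rewrite -natrX ler_nat; apply: (leq_trans len).
  exact/ltnW/ltn_expl.
exists n0 => // n /= len.
pose T (xy : E * E) := \sum_(k < n) z ^+ k *: Ch k xy.1 xy.2 - fh xy.1 xy.2.
have -> : series (fun n => z ^+ n *: Ch n x y) n = fh x y + T (x, y).
  by rewrite /T /series /= big_mkord addrC subrK.
suff : V (T (x, y)) by [].
apply: V'V; apply: (closed_trace (j := iota2) iota2_dense (h := T) (x := (x, y)) (O := N)) => //.
- have [fc _] := fhP; rewrite /T.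
  have Sc : continuous (fun xy : E * E => \sum_(k < n) z ^+ k *: Ch k xy.1 xy.2).
    have := @continuous_sumE (E * E)%type n (fun k (xy : E * E) => z ^+ k *: Ch k xy.1 xy.2).
    apply => k.
    by apply: continuous_scaleE; have [] := ChP k.
  rewrite (_ : (fun xy => _) = fun xy : E * E =>
    \sum_(k < n) z ^+ k *: Ch k xy.1 xy.2 + (-1) *: fh xy.1 xy.2); last first.
    by apply/funext => v; rewrite scaleN1r.
  by apply: (continuous_addE Sc _); exact: continuous_scaleE.
- exact: closed_closure.
move=> [a b] /NAB[/= qa qb]; apply: subset_closure.
have -> : T (iota2 (a, b)) =
    iota (\sum_(k < n) z ^+ k *: C k a b - family_sum C z a b).
  rewrite /T /= iotaB iota_sum; have [_ ->] := fhP; congr (_ - _).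
  by apply: eq_bigr => k _; have [_ ->] := ChP k; rewrite iotaZ.
apply: HV'; have [M CM] := Cf a b.
have CL' k : (n + M <= k)%N -> C k a b = 0.
  by move=> le; apply: CM; exact: leq_trans (leq_addl _ _) le.
rewrite (family_sumE z CL') big_split_ord /= opprD addrA subrr add0r -sumrN.
apply: (@le_lt_trans _ _ (A * B / 2 ^+ n)); last exact: n0P.
rewrite ler_pdivlMr ?exprn_gt0 //.
apply: (@le_trans _ _ (ss q a * ss q b)); last exact: ler_pM.
apply: le_trans (Hq (n + M)%N a b); rewrite big_split_ord /=.
apply: ler_wpDl.
  apply: sumr_ge0 => i _; rewrite mulr_ge0 ?exprn_ge0 // sym_seminorm_ge0 //.
  exact: pP.1.
under eq_bigr do rewrite -scaleNr.
apply: (le_trans (ler_wpM2r _ (sub_seminorm_comb (sym_seminorm_sub rho pP.1) _ _ _))).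
  exact: exprn_ge0.
rewrite mulr_suml; apply: ler_sum => i _.
rewrite modulusN modulusX exprMn mulrC mulrA ler_wpM2r //.
  by apply: sym_seminorm_ge0; exact: pP.1.
rewrite ler_wpM2r ?exprn_ge0 ?modulus_ge0 // exprD ler_peMr ?exprn_ge0 //.
by rewrite exprn_ege1 // ler1n.
Qed.

Lemma entire_family_abs_sum x y : abs_sum (fun n => z ^+ n *: Ch n x y) (fh x y).
Proof. split; [exact: entire_family_abs_summable|exact: entire_family_cvg]. Qed.

End EntireSum.

End Completion.

(** * Analyticity *)

Section ShiftedFamily.
Variables (R : realType) (F : base_field) (g : tvsType (scalars R F)) (rho : R).
Local Notation K := (scalars R F).
Local Notation S := (symalg g).
Local Notation ss := (@sym_seminorm R F g rho).

Lemma binomial_sum (A : comNzRingType) N m (a b : A) : (m < N)%N ->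
  \sum_(n < N) 'C(m, n)%:R * (a ^+ (m - n) * b ^+ n) = (a + b) ^+ m.
Proof.
move=> lt; rewrite exprDn.
rewrite -(big_mkord xpredT (fun n => 'C(m, n)%:R * (a ^+ (m - n) * b ^+ n))).
rewrite (big_cat_nat (n := m.+1)) //= [X in _ + X]big_nat_cond [X in _ + X]big1 ?addr0.
  by rewrite big_mkord; apply: eq_bigr => i _; rewrite mulr_natl.
by move=> i /andP[/andP[lti _] _]; rewrite bin_small ?mul0r.
Qed.

Variable C : nat -> S -> S -> S.
Hypothesis CP : entire_family rho C.

(* the Taylor coefficients at z0 of the polynomial z |-> sum_m z^m C m a b *)
Definition shifted_family (z0 : K) (n : nat) (a b : S) : S :=
  \sum_(m \in [set: nat]) ('C(m, n)%:R * z0 ^+ (m - n)) *: C m a b.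

Lemma shifted_familyE z0 n a b N : (forall m, (N <= m)%N -> C m a b = 0) ->
  shifted_family z0 n a b =
  \sum_(m < N) ('C(m, n)%:R * z0 ^+ (m - n)) *: C m a b.
Proof.
move=> CN; apply: (fsum_nat (f := fun m => ('C(m, n)%:R * z0 ^+ (m - n)) *: C m a b)).
by move=> m /CN ->; rewrite scaler0.
Qed.

Lemma shifted_family_large z0 n a b N : (forall m, (N <= m)%N -> C m a b = 0) ->
  (N <= n)%N -> shifted_family z0 n a b = 0.
Proof.
move=> CN le; rewrite (shifted_familyE _ _ CN) big1 // => m _.
by rewrite bin_small ?mul0r ?scale0r // (leq_trans (ltn_ord m)).
Qed.

Lemma shifted_family_sum z0 z a b :
  family_sum (shifted_family z0) (z - z0) a b = family_sum C z a b.
Proof.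
have [_ Cf _] := CP; have [N CN] := Cf a b.
rewrite (family_sumE _ (fun n => @shifted_family_large z0 n a b N CN)) (family_sumE _ CN).
under eq_bigr do rewrite (shifted_familyE _ _ CN) scaler_sumr.
rewrite exchange_big; apply: eq_bigr => m _ /=.
rewrite -[in RHS](subrK z0 z) [z - z0 + z0]addrC.
rewrite -(binomial_sum z0 (z - z0) (ltn_ord m)) scaler_suml.
apply: eq_bigr => n _; rewrite scalerA; congr (_ *: _); ring.
Qed.

(** After exchanging the sums, the binomial theorem dominates the shifted family at radius [w] by
    the original one at radius |z0| + w. *)
Lemma shifted_family_entire z0 : entire_family rho (shifted_family z0).
Proof.
have [CL Cf CB] := CP; split.
- by move=> n; exact: fsum_family_bilinear.
- move=> a b; have [N CN] := Cf a b; exists N => n; exact: shifted_family_large.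
move=> p w pP w0; have W0 : 0 <= modulus z0 + w by rewrite addr_ge0 ?modulus_ge0.
have [q qP Hq] := CB p _ pP W0; exists q => // N a b; have [M CM] := Cf a b.
have s0 := sym_seminorm_ge0 rho pP.1.
apply: le_trans (Hq M a b).
apply: (@le_trans _ _ (\sum_(n < N) \sum_(m < M)
    ('C(m, n)%:R * (modulus z0 ^+ (m - n) * w ^+ n)) * ss p (C m a b))).
  apply: ler_sum => n _; rewrite (shifted_familyE _ _ CM).
  apply: (le_trans (ler_wpM2l (exprn_ge0 n w0)
    (sub_seminorm_comb (sym_seminorm_sub rho pP.1) _ _ _))).
  rewrite mulr_sumr; apply: ler_sum => m _.
  by rewrite modulusM modulusX modulus_nat le_eqVlt; apply/orP; left; apply/eqP; ring.
rewrite exchange_big; apply: ler_sum => m _ /=; rewrite -mulr_suml ler_wpM2r //.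
(* N may fall short of m + 1; nonnegative terms are added to complete the binomial sum. *)
rewrite -(@binomial_sum _ (N + m.+1) m) ?leq_addl // big_split_ord /= lerDl.
by apply: sumr_ge0 => i _; rewrite !mulr_ge0 ?exprn_ge0 ?modulus_ge0.
Qed.

End ShiftedFamily.

(** * The Gutt coefficients as an entire family *)

Section GuttFamily.
Variables (R : realType) (F : base_field) (g : tvsType (scalars R F)).
Variables (br : g -> g -> g) (rho : R).
Hypotheses (hg : AE_lie_algebra br) (rho1 : 1 <= rho).

Lemma AE_lie_axioms : lie_axioms br.
Proof. by case: hg => _ [[brl brr] brxx J] _ _; split. Qed.

Lemma gutt_coef_entire : entire_family rho (gutt_coef br).
Proof.
have brP := AE_lie_axioms; case: hg => _ _ _ AE; split.
- exact: gutt_coef_bilinear.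
- exact: gutt_coef_finite.
move=> p w pP w0; have [q qP pq] := AE p pP.
exists (fun x => estimate_const rho w * q x); last first.
  by move=> N a b; apply: gutt_coef_estimate => //; [exact: pP.1|exact: qP.1].
have c0 := estimate_const_ge0 rho w0.
split; last by move=> x; apply: cvgM; [exact: cvg_cst|exact: qP.2].
split=> [c x|x y]; first by rewrite qP.1.1 mulrCA.
by rewrite -mulrDr ler_wpM2l // qP.1.2.
Qed.

Lemma gutt_star_family z : gutt_star br z = family_sum (gutt_coef br) z.
Proof.
apply/funext => a; apply/funext => b; exact: (gutt_star_sum AE_lie_axioms).
Qed.

End GuttFamily.

Theorem proposition3p6 (R : realType) (F : base_field)
    (g : tvsType (scalars R F)) (br : g -> g -> g) (rho : R)
    (E : tvsType (scalars R F)) (iota : symalg g -> E)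
    (hg : AE_lie_algebra br) (hrho : 1 <= rho)
    (hE : is_completion rho iota) :
  let mul := completed_mul iota in
  let C := completed_coef iota br in
  let star := completed_star iota br in
  [/\ is_cont_extension iota (@sym_mul (scalars R F) g) mul,
      (forall n, is_cont_extension iota (gutt_coef br n) (C n)) &
      (forall z, is_cont_extension iota (gutt_star br z) (star z))] /\
  (forall x y : E,
      analytic (fun z => star z x y) /\
      forall z : scalars R F,
        abs_sum (fun n => z ^+ n *: C n x y) (star z x y)) /\
  entire_deformation mul (iota (sym1 g)) C star.
Proof.
move=> mul C star.
have brP := AE_lie_axioms hg; have entC := gutt_coef_entire hg hrho.
have CP n : is_cont_extension iota (gutt_coef br n) (C n).
  exact: (cont_extensionP hE (entire_family_bounded n entC)).
have sP z : is_cont_extension iota (gutt_star br z) (star z).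
  apply: (cont_extensionP hE); rewrite gutt_star_family //.
  exact: family_sum_bounded.
(* As the star product at 0 the symmetric product inherits a continuous extension from the
   family. *)
have mE : @sym_mul (scalars R F) g = gutt_star br 0.
  by apply/funext => a; apply/funext => b; rewrite gutt_star0.
have mP : is_cont_extension iota (@sym_mul (scalars R F) g) mul.
  apply: (cont_extensionP hE); rewrite mE gutt_star_family //.
  exact: family_sum_bounded.
have sP' z : is_cont_extension iota (family_sum (gutt_coef br) z) (star z).
  by rewrite -gutt_star_family.
have sumP z x y : abs_sum (fun n => z ^+ n *: C n x y) (star z x y).
  exact: (entire_family_abs_sum hE entC CP (sP' z)).
(* Identities on the completion are equalities of continuous maps in one, two or three arguments,
   checked on the dense images of elements, pairs and triples. *)
have i1 := iota_dense hE; have haus := completion_hausdorff hE.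
have i2 := dense_pair i1 i1; have i3 := dense_pair i1 i2.
split; [by split|split].
  move=> x y; split=> // z0.
  have entD := shifted_family_entire entC z0.
  pose D n := cont_extension iota (shifted_family (gutt_coef br) z0 n).
  (* The re-expanded series converges for every z, so the radius 1 is arbitrary. *)
  exists (fun n => D n x y), 1.
  split=> // z _; apply: (entire_family_abs_sum hE entD (Ch := D) (fh := star z)).
    by move=> n; apply: (cont_extensionP hE); exact: entire_family_bounded.
  (* On the dense subspace re-expansion at z0 leaves the polynomial in z unchanged, so [star z] is
     also the sum of the shifted family at z - z0. *)
  suff -> : family_sum (shifted_family (gutt_coef br) z0) (z - z0) =
    family_sum (gutt_coef br) z by [].
  by apply/funext => a; apply/funext => b; exact: (shifted_family_sum entC).
have fstc : continuous (fun xy : E * E => xy.1) by move=> ?; exact: cvg_fst.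
have sndc : continuous (fun xy : E * E => xy.2) by move=> ?; exact: cvg_snd.
have fst3 : continuous (fun t : E * (E * E) => t.1) by move=> ?; exact: cvg_fst.
have snd3 : continuous (fun t : E * (E * E) => t.2.1).
  by move=> t; apply: cvg_comp; [exact: cvg_snd|exact: cvg_fst].
have thd3 : continuous (fun t : E * (E * E) => t.2.2).
  by move=> t; apply: cvg_comp; [exact: cvg_snd|exact: cvg_snd].
have idc : continuous (@idfun E) by move=> ?; exact: cvg_id.
have cstc (v : E) : continuous (fun _ : E => v) by move=> ?; exact: cvg_cst.
split.
- move=> z; have [sc sE] := sP z; have bil := gutt_star_bilinear brP z.
  have scc (f1 f2 : E * (E * E) -> E) : continuous f1 -> continuous f2 ->
      continuous (fun t => star z (f1 t) (f2 t)) by exact: continuous_comp2.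
  have lin3 c (f1 f2 : E * (E * E) -> E) : continuous f1 -> continuous f2 ->
      continuous (fun t => c *: f1 t + f2 t).
    by move=> c1 c2; apply: continuous_addE => //; exact: continuous_scaleE.
  split => //.
  + split=> [c x x' y|c x y y'].
      apply: (dense_eq i3 haus (h1 := fun t => star z (c *: t.1 + t.2.1) t.2.2)
        (h2 := fun t => c *: star z t.1 t.2.2 + star z t.2.1 t.2.2) _ _ _ (x, (x', y))).
      * by apply: scc => //; exact: lin3.
      * by apply: lin3; exact: scc.
      * by move=> [a [a' b]] /=; rewrite -(iota_linear hE) !sE bil.1 (iota_linear hE).
    apply: (dense_eq i3 haus (h1 := fun t => star z t.1 (c *: t.2.1 + t.2.2))
      (h2 := fun t => c *: star z t.1 t.2.1 + star z t.1 t.2.2) _ _ _ (x, (y, y'))).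
    * by apply: scc => //; exact: lin3.
    * by apply: lin3; exact: scc.
    * by move=> [a [a' b]] /=; rewrite -(iota_linear hE) !sE bil.2 (iota_linear hE).
  + move=> x y t; apply: (dense_eq i3 haus
      (h1 := fun t => star z t.1 (star z t.2.1 t.2.2))
      (h2 := fun t => star z (star z t.1 t.2.1) t.2.2) _ _ _ (x, (y, t))).
    * exact: (scc _ _ fst3 (scc _ _ snd3 thd3)).
    * exact: (scc _ _ (scc _ _ fst3 snd3) thd3).
    * move=> [a [b c]] /=; rewrite !sE !gutt_starE // star1A //.
      exact: scale_lie_axioms.
  + split=> x.
      apply: (dense_eq i1 haus (h1 := fun x => star z (iota (sym1 g)) x) (h2 := idfun) _ _ _ x).
      * by apply: continuous_comp2 => //; exact: idc.
      * exact: idc.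
      * by move=> a /=; rewrite sE gutt_starE // sym1E star11x //; exact: scale_lie_axioms.
    apply: (dense_eq i1 haus (h1 := fun x => star z x (iota (sym1 g))) (h2 := idfun) _ _ _ x).
    * by apply: continuous_comp2 => //; exact: idc.
    * exact: idc.
    * by move=> a /=; rewrite sE gutt_starE // sym1E star1x1 //; exact: scale_lie_axioms.
- move=> x y; have [sc sE] := sP 0; have [mc mE'] := mP.
  apply: (dense_eq i2 haus (h1 := fun t => star 0 t.1 t.2) (h2 := fun t => mul t.1 t.2)
    sc mc _ (x, y)).
  by move=> [a b] /=; rewrite sE mE' mE.
- by move=> z x y; have [] := sumP z x y.
Qed.
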